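(* Let $p\ge3$ be fixed and suppose the following conditions hold. (B1) There exist positive constants $\mu,c_1,\lambda_1$ and a positive definite matrix $\dot\Psi_0$ such that $\langle\Psi(\theta_1)-\Psi(\theta_2),\theta_1-\theta_2\rangle\ge\mu\|\theta_1-\theta_2\|^2$ for $\theta_1,\theta_2\in\Theta$, $\|\Psi(\theta)-\Psi(\theta^* )-\dot\Psi_0(\theta-\theta^* )\|\le c_1\|\theta-\theta^*\|^2$ for $\theta\in\Theta$, and $\lambda_{\min}(\dot\Psi_0)\ge\lambda_1$. (B2) There exist a function $h_0:\mathcal{X}\to\mathbb{R}_+$ and a constant $c_2>0$ such that for any $\theta,\theta'\in\Theta$ and each coordinate $j$, $|h_{\theta,j}(X)-h_{\theta',j}(X)|\le h_0(X)\|\theta-\theta'\|$, and $\|h_0(X)\|_p\le c_2$. (B3) With $\xi_i=h_{\theta^*}(X_i)$ and $\Sigma=\mathbb{E}\{\xi_i\xi_i^{\top}\}$, there exist positive constants $c_3,\lambda_2$ such that $\lambda_{\min}(\Sigma)\ge\lambda_2$ and $\|\xi_1\|_p\le c_3d^{1/2}$. Let $D_\Theta=\sup_{\theta_1,\theta_2\in\Theta}\|\theta_1-\theta_2\|$ be the diameter of $\Theta$. Then $$\sup_{A\in\mathcal{A}}\bigl|\mathbb{P}\bigl(\sqrt n\,\Sigma^{-1/2}\dot\Psi_0(\hat\theta_n-\theta^* )\in A\bigr)-\mathbb{P}(Z\in A)\bigr|\le C(D_\Theta+1)^2d^{7/2}n^{-1/2+\epsilon_p},$$ where $\epsilon_p=1/(2p-2)$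 and $C>0$ is a constant depending on $p,c_1,c_2,c_3,\lambda_1,\lambda_2$ and $\mu$.
   Context: $X,X_1,\dots,X_n$ are i.i.d. random variables taking values in a measurable space $\mathcal{X}$. $\Theta\subset\mathbb{R}^d$ is the parameter space; for each $\theta\in\Theta$, $h_\theta:\mathcal{X}\to\mathbb{R}^d$ with $j$-th coordinate $h_{\theta,j}$. Put $\Psi_n(\theta)=\frac1n\sum_{i=1}^nh_\theta(X_i)$ and $\Psi(\theta)=\mathbb{E}\{h_\theta(X)\}$. $\hat\theta_n,\theta^*\in\Theta$ satisfy $\Psi_n(\hat\theta_n)=0$ and $\Psi(\theta^* )=0$. For a random variable or vector $Y$, $\|Y\|_p=(\mathbb{E}\|Y\|^p)^{1/p}$, with $\|\cdot\|$ the Euclidean norm. $\lambda_{\min}$ is the smallest eigenvalue. $\mathcal{A}$ is the collection of all convex sets in $\mathbb{R}^d$, $Z\sim N(0,I_d)$. *)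

(* Defs.v *)
From HB Require Import structures.
From mathcomp Require Import all_boot all_order all_algebra.
From mathcomp Require Import all_classical all_reals all_analysis.

Set Implicit Arguments.
Unset Strict Implicit.
Unset Printing Implicit Defensive.

Import Order.TTheory GRing.Theory Num.Theory.
Import numFieldNormedType.Exports.

Local Open Scope classical_set_scope.
Local Open Scope ring_scope.

Section LinearAlgebra.
Context {R : realType} {d : nat}.
Implicit Types (u v : 'cV[R]_d) (A B : 'M[R]_d) (Theta : set 'cV[R]_d).

Definition dotv u v : R := \sum_i u i 0 * v i 0.

(* The norm that the library puts on matrices is the sup norm, hence this
   separate Euclidean norm. *)
Definition enorm v : R := Num.sqrt (dotv v v).

Definition posdefmx A : Prop :=
  A^T = A /\ forall v, v != 0 -> 0 < dotv v (A *m v).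

(* Only used for symmetric matrices with 0 < d: the set is then finite and
   nonempty, so that the infimum is a minimum. *)
Definition lambda_min A : R := inf [set a | eigenvalue A a].

(* A ^ (-1/2) for a positive definite A: the set is then a singleton. *)
Definition invsqrtmx A : 'M[R]_d :=
  xget 0 [set B | posdefmx B /\ B *m B = invmx A].

(* Extended-real valued: it is +oo when Theta is unbounded. *)
Definition diameter Theta : \bar R :=
  ereal_sup [set (enorm (t.1 - t.2))%:E | t in Theta `*` Theta].

End LinearAlgebra.

Section Probability.
Context {dT : measure_display} {T : measurableType dT} {R : realType}.
Variable P : probability T R.

(* Entrywise expectation; meaningful when all entries are integrable. *)
Definition expectation_mx (m k : nat) (Y : T -> 'M[R]_(m, k)) : 'M[R]_(m, k) :=
  \matrix_(i, j) fine ('E_P[fun w => Y w i j])%E.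

(* || Y ||_p = (E |Y|^p)^(1/p) with |.| the Euclidean norm; possibly +oo. *)
Definition vec_Lnorm (d : nat) (p : R) (Y : T -> 'cV[R]_d) : \bar R :=
  Lnorm P p%:E (fun w => (enorm (Y w))%:E).

(* Allowing B i = setT yields the product rule for every subfamily. *)
Definition mutually_independent {dS : measure_display} {S : measurableType dS}
    (I : finType) (Y : I -> T -> S) : Prop :=
  forall B : I -> set S, (forall i, measurable (B i)) ->
    P (\bigcap_(i in [set: I]) (Y i @^-1` B i)) =
    (\prod_(i : I) P (Y i @^-1` B i))%E.

Definition identically_distributed {dS : measure_display}
    {S : measurableType dS} (I : finType) (Y : I -> T -> S) : Prop :=
  forall (i j : I) (B : set S), measurable B ->
    P (Y i @^-1` B) = P (Y j @^-1` B).

Definition iid {dS : measure_display} {S : measurableType dS}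
    (I : finType) (Y : I -> T -> S) : Prop :=
  mutually_independent Y /\ identically_distributed Y.

Definition random_vector (d : nat) (Y : T -> 'cV[R]_d) : Prop :=
  forall j, measurable_fun [set: T] (fun w => Y w j 0).

(* Z ~ N(0, I_d): the coordinates are independent N(0, 1) variables. *)
Definition std_gaussian (d : nat) (Z : T -> 'cV[R]_d) : Prop :=
  [/\ random_vector Z,
      mutually_independent (fun (j : 'I_d) w => Z w j 0) &
      forall (j : 'I_d) (B : set R), measurable B ->
        P ((fun w => Z w j 0) @^-1` B) = normal_prob 0 1 B].

End Probability.

Section ConvexDistance.
Context {R : realType} {d : nat}.
Context {dT : measure_display} {T : measurableType dT} (P : probability T R).
Context {dU : measure_display} {U : measurableType dU} (Q : probability U R).

(* The two vectors may live on different probability spaces. A convex set need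
   not be Borel, and A is required to be such that both probabilities make
   sense. *)
Definition convex_distance (Y : T -> 'cV[R]_d) (Z : U -> 'cV[R]_d) : \bar R :=
  ereal_sup [set `| P (Y @^-1` A) - Q (Z @^-1` A) |%E
            | A in [set A : set 'cV[R]_d |
                [/\ convex_set A, measurable (Y @^-1` A)
                  & measurable (Z @^-1` A)]]].

End ConvexDistance.

(* Main.v *)
Require Import Defs.
From HB Require Import structures.
From mathcomp Require Import all_boot all_order all_algebra.
From mathcomp Require Import all_classical all_reals all_analysis.
From mathcomp Require Import measurable_realfun complex ring lra.

Set Implicit Arguments.
Unset Strict Implicit.
Unset Printing Implicit Defensive.

Import Order.TTheory GRing.Theory Num.Theory.
Import numFieldNormedType.Exports.

Local Open Scope classical_set_scope.
Local Open Scope ring_scope.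

(* Strong monotonicity shows that, outside an event of probability
   O(1 / sqrt n), the vector sqrt n Sigma^(-1/2) dPsi0 (theta_hat - theta_star)
   differs by O(d^(5/2) (D + 1) (ln n)^2 / sqrt n) from the normalized sum W of
   the independent vectors - Sigma^(-1/2) xi_i. The deviations of the empirical
   process are bounded by exponential inequalities for truncated sums over a
   net of mesh 1 / (n^2 d), and n^(eps_p) absorbs (ln n)^2.

   A bounded convex set lies between {rho < 0} and {rho <= 0}, where rho is a
   supremum of affine functions with unit gradients; P(|rho Z| <= r) is then
   O(r sqrt d). To compare W with Z, one smooths by a small Gaussian vector and
   replaces the summands one by one by Gaussian ones. The cost of a replacement
   is a third order Taylor remainder, localized on a shell {|rho| <= r} whose
   probability under the hybrid sum is at most that under Z plus the error
   being estimated. So an error bound t improves to a + t / 2, hence to 2 a,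
   with a of order d^(5/2) ln n / sqrt n. *)

(** * Euclidean norm and random vectors *)

(** The remainder for one summand of size h = 1 / sqrt n under Gaussian noise of scale tau is (h /
    tau)^3 times the oscillation, at scale tau, of the probability that rho <= 0 as a function of
    the starting point. This oscillation is bounded by the probability of a shell of width about
    tau, hence is O(d tau + dl) if dl bounds the distance from every hybrid to Z for every rho. The
    first part gives h (h / tau)^2, and tau^2 >= (n - k) / n makes the total a harmonic sum: this is
    the origin of ln n. The part in dl gives dl (h / tau)^3; with an initial noise of scale e1 h it
    is at most (dl / e1) (h / tau)^2, and e1 proportional to the harmonic sum turns the total into a
    fraction of dl. The recursion therefore has to treat all rho and all hybrids together, which
    asks for a class of sets stable under translations, dilations and changes of level. Shifts are
    moved onto the Gaussian density, so that no function on R^d has to be differentiated. In the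
    empirical part, truncating at sqrt n costs n * n^(-3/2) by third moments. *)

Section EuclideanNorm.
Context {R : realType} {d : nat}.
Implicit Types (u v w : 'cV[R]_d) (a : R).

Lemma dotvC u v : dotv u v = dotv v u.
Proof. by apply: eq_bigr => i _; rewrite mulrC. Qed.

Lemma dotvDl u v w : dotv (u + v) w = dotv u w + dotv v w.
Proof. by rewrite -big_split; apply: eq_bigr => i _; rewrite mxE mulrDl. Qed.

Lemma dotvDr u v w : dotv w (u + v) = dotv w u + dotv w v.
Proof. by rewrite dotvC dotvDl !(dotvC w). Qed.

Lemma dotvZl a u v : dotv (a *: u) v = a * dotv u v.
Proof. by rewrite mulr_sumr; apply: eq_bigr => i _; rewrite mxE mulrA. Qed.

Lemma dotvZr a u v : dotv u (a *: v) = a * dotv u v.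
Proof. by rewrite dotvC dotvZl dotvC. Qed.

Lemma dotvNl u v : dotv (- u) v = - dotv u v.
Proof. by rewrite -scaleN1r dotvZl mulN1r. Qed.

Lemma dotvNr u v : dotv u (- v) = - dotv u v.
Proof. by rewrite dotvC dotvNl dotvC. Qed.

Lemma dotvBl u v w : dotv (u - v) w = dotv u w - dotv v w.
Proof. by rewrite dotvDl dotvNl. Qed.

Lemma dotvBr u v w : dotv w (u - v) = dotv w u - dotv w v.
Proof. by rewrite dotvDr dotvNr. Qed.

Lemma dot0v v : dotv 0 v = 0.
Proof. by rewrite -(scale0r 0) dotvZl mul0r. Qed.

Lemma dotv_ge0 v : 0 <= dotv v v.
Proof. by apply: sumr_ge0 => i _; rewrite -expr2 sqr_ge0. Qed.

Lemma dotv_eq0 v : dotv v v = 0 -> v = 0.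
Proof.
move=> /eqP; rewrite psumr_eq0; last by move=> i _; rewrite -expr2 sqr_ge0.
move=> /allP h; apply/colP => i; have := h i (mem_index_enum _).
by rewrite mulf_eq0 orbb mxE => /eqP.
Qed.

Lemma dotv_delta v i : dotv v (delta_mx i 0) = v i 0.
Proof.
rewrite /dotv (bigD1 i)//= big1 ?addr0; first by rewrite mxE !eqxx mulr1.
by move=> j ji; rewrite mxE (negbTE ji) mulr0.
Qed.

Lemma enorm_ge0 v : 0 <= enorm v.
Proof. exact: sqrtr_ge0. Qed.

Lemma enorm_sqr v : enorm v ^+ 2 = dotv v v.
Proof. by rewrite sqr_sqrtr// dotv_ge0. Qed.

Lemma enorm0 : enorm (0 : 'cV[R]_d) = 0.
Proof. by rewrite /enorm dot0v sqrtr0. Qed.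

Lemma enormZ a v : enorm (a *: v) = `|a| * enorm v.
Proof. by rewrite /enorm dotvZl dotvZr mulrA -expr2 sqrtrM ?sqr_ge0// sqrtr_sqr. Qed.

Lemma enormN v : enorm (- v) = enorm v.
Proof. by rewrite -scaleN1r enormZ normrN1 mul1r. Qed.

Lemma enormC u v : enorm (u - v) = enorm (v - u).
Proof. by rewrite -enormN opprB. Qed.

Lemma enorm_eq0 v : enorm v = 0 -> v = 0.
Proof. by move=> v0; apply: dotv_eq0; rewrite -enorm_sqr v0 expr0n. Qed.

Lemma enorm_gt0 v : v != 0 -> 0 < enorm v.
Proof.
by move=> v0; rewrite lt_def enorm_ge0 andbT; apply: contra v0 => /eqP/enorm_eq0/eqP.
Qed.

Lemma CauchySchwarz u v : `|dotv u v| <= enorm u * enorm v.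
Proof.
rewrite -sqrtr_sqr /enorm -sqrtrM ?dotv_ge0// ler_wsqrtr//.
have [->|v0] := eqVneq v 0; first by rewrite dotvC dot0v expr0n/= dot0v mulr0.
have vv : 0 < dotv v v by rewrite -enorm_sqr exprn_gt0// enorm_gt0.
have := dotv_ge0 (dotv v v *: u - dotv u v *: v).
rewrite !(dotvBl, dotvBr, dotvZl, dotvZr) (dotvC v u) => h.
rewrite -subr_ge0 -(pmulr_rge0 _ vv); apply: le_trans h _.
by rewrite le_eqVlt; apply/orP; left; apply/eqP; ring.
Qed.

Lemma dotv_le u v : dotv u v <= enorm u * enorm v.
Proof. exact: le_trans (ler_norm _) (CauchySchwarz u v). Qed.

Lemma ler_enormD u v : enorm (u + v) <= enorm u + enorm v.
Proof.
rewrite -(ler_pXn2r (ltn0Sn 1)) ?nnegrE ?addr_ge0 ?enorm_ge0// enorm_sqr.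
rewrite sqrrD !enorm_sqr dotvDl !dotvDr (dotvC v u).
by have := dotv_le u v; lra.
Qed.

Lemma coord_le_enorm v i : `|v i 0| <= enorm v.
Proof.
rewrite -sqrtr_sqr ler_wsqrtr// /dotv (bigD1 i)//= -expr2 lerDl sumr_ge0// => j _.
by rewrite -expr2 sqr_ge0.
Qed.

Lemma enorm_le_coord v a : 0 <= a -> (forall i, `|v i 0| <= a) ->
  enorm v <= Num.sqrt d%:R * a.
Proof.
move=> a0 h; rewrite -[X in _ * X](ger0_norm a0) -sqrtr_sqr -sqrtrM ?ler0n//.
rewrite ler_wsqrtr// -[X in X%:R]card_ord mulr_natl -sumr_const ler_sum// => i _.
by rewrite -expr2 -real_normK ?num_real// lerXn2r// nnegrE.
Qed.

Lemma enorm_le_sum v : enorm v <= \sum_i `|v i 0|.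
Proof.
have -> : v = \sum_i v i 0 *: delta_mx i 0.
  apply/colP => i; rewrite summxE (bigD1 i)//= big1 ?addr0.
    by rewrite !mxE !eqxx mulr1.
  by move=> j ji; rewrite !mxE eq_sym (negbTE ji) mulr0.
apply: (@le_trans _ _ (\sum_i enorm (v i 0 *: delta_mx i 0))).
  elim/big_ind2 : _ => [|x y z t xy zt|//]; first by rewrite enorm0.
  by apply: le_trans (ler_enormD _ _) _; exact: lerD.
apply: ler_sum => i _; rewrite enormZ.
rewrite /enorm dotv_delta mxE !eqxx sqrtr1 mulr1.
rewrite summxE (bigD1 i)//= big1 ?addr0.
  by rewrite !mxE !eqxx mulr1.
by move=> j ji; rewrite !mxE eq_sym (negbTE ji) mulr0.
Qed.

End EuclideanNorm.

Section RandomVectors.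
Context {R : realType} {dT : measure_display} {T : measurableType dT}.
Context {d : nat}.
Implicit Types (Y V : T -> 'cV[R]_d).

Lemma random_vector_cst (c : 'cV[R]_d) : random_vector (fun _ : T => c).
Proof. by move=> j. Qed.

Lemma random_vectorD Y V : random_vector Y -> random_vector V ->
  random_vector (fun w => Y w + V w).
Proof.
move=> mY mV j; under eq_fun do rewrite mxE.
by apply: measurable_funD; [exact: mY|exact: mV].
Qed.

Lemma random_vectorZ (f : T -> R) Y : measurable_fun setT f ->
  random_vector Y -> random_vector (fun w => f w *: Y w).
Proof.
move=> mf mY j; under eq_fun do rewrite mxE.
by apply: measurable_funM => //; exact: mY.
Qed.

Lemma random_vector_sum (I : Type) (s : seq I) (Y : I -> T -> 'cV[R]_d) :
  (forall i, random_vector (Y i)) -> random_vector (fun w => \sum_(i <- s) Y i w).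
Proof.
move=> mY; elim: s => [|i s ih].
  by under eq_fun do rewrite big_nil; exact: random_vector_cst.
under eq_fun do rewrite big_cons.
exact: random_vectorD.
Qed.

Lemma random_vector_mulmx k (B : 'M[R]_(d, k)) (Y : T -> 'cV[R]_k) :
  random_vector Y -> random_vector (fun w => B *m Y w).
Proof.
move=> mY j; under eq_fun do rewrite mxE.
apply: measurable_sum => i; apply: measurable_funM => //; exact: mY.
Qed.

Lemma random_vector_comp d' (T' : measurableType d') (f : T' -> T) Y :
  measurable_fun setT f -> random_vector Y -> random_vector (fun w => Y (f w)).
Proof. by move=> mf mY j; exact: (measurableT_comp (mY j) mf). Qed.

Lemma measurable_dotv Y V : random_vector Y -> random_vector V ->
  measurable_fun setT (fun w => dotv (Y w) (V w)).
Proof.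
move=> mY mV; apply: measurable_sum => i; apply: measurable_funM.
- exact: mY.
- exact: mV.
Qed.

Lemma measurable_enorm Y : random_vector Y ->
  measurable_fun setT (fun w => enorm (Y w)).
Proof.
move=> mY; have ms : measurable_fun setT (@Num.sqrt R).
  by apply: continuous_measurable_fun; exact: sqrt_continuous.
exact: (measurableT_comp ms (measurable_dotv mY mY)).
Qed.

End RandomVectors.

(* Measurability of a function on R^d, tested against all random vectors; this
   replaces a sigma-algebra on ['cV[R]_d]. *)
Definition vmeas {R : realType} {d : nat} (f : 'cV[R]_d -> \bar R) : Prop :=
  forall dT (T : measurableType dT) (Y : T -> 'cV[R]_d), random_vector Y ->
    measurable_fun [set: T] (fun w => f (Y w)).

Section VMeas.
Context {R : realType} {d : nat}.
Implicit Types (f g : 'cV[R]_d -> \bar R) (rho : 'cV[R]_d -> R).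

Lemma vmeas_shift f x : vmeas f -> vmeas (fun y => f (x + y)).
Proof.
by move=> mf dT T Y mY; apply: mf; apply: random_vectorD.
Qed.

Lemma vmeas_scale f a : vmeas f -> vmeas (fun y => f (a *: y)).
Proof. by move=> mf dT T Y mY; apply: mf; exact: random_vectorZ. Qed.

Lemma vmeas_comp_real (phi : R -> R) rho : measurable_fun setT phi ->
  vmeas (EFin \o rho) -> vmeas (EFin \o (phi \o rho)).
Proof.
move=> mphi mrho dT T Y mY; apply/measurable_EFinP.
by apply: (measurableT_comp mphi); apply/measurable_EFinP; exact: mrho.
Qed.

(** The set where [rho (Y w) < a] is the countable union, over rational points q, of the sets where
    [rho q + |Y w - q| < a]: one inclusion is the Lipschitz bound, the other the density of rational
    points. *)
Lemma vmeas_lipschitz rho :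
  (forall x y, `|rho x - rho y| <= enorm (x - y)) -> vmeas (EFin \o rho).
Proof.
move=> lip dT T Y mY; apply/measurable_EFinP.
apply: (measurability _ (RGenInftyO.measurableE R)) => //.
move=> _ [_ [a ->] <-]; rewrite setTI.
pose F (q : 'cV[rat]_d) : set T :=
  [set w | rho (map_mx ratr q) + enorm (Y w - map_mx ratr q) < a].
rewrite (_ : _ @^-1` _ = \bigcup_q F q); last first.
  apply/seteqP; split => [w /=|w [q _] /=].
    rewrite in_itv/= => wa.
    (* A rational point within [e] in each coordinate is at distance at most [d * e]. This enters
       once through [rho] and once through the norm, so that [2 * d * e] has to stay below the
       gap. *)
    pose e := (a - rho (Y w)) / (2 * d%:R + 3).
    have d0 : 0 < 2 * d%:R + 3 :> R by have := ler0n R d; lra.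
    have e0 : 0 < e by rewrite divr_gt0// subr_gt0.
    have near_q i : exists q : rat, `|Y w i 0 - ratr q| < e.
      have [q /=] := @rat_in_itvoo R (Y w i 0 - e) (Y w i 0 + e) ltac:(lra).
      rewrite in_itv/= => /andP[h1 h2]; exists q.
      by rewrite ltr_norml; apply/andP; split; lra.
    pose q : 'cV[rat]_d := \col_i projT1 (cid (near_q i)).
    exists q => //; rewrite /F/=.
    have hq : enorm (Y w - map_mx ratr q) <= d%:R * e.
      apply: le_trans (enorm_le_sum _) _.
      rewrite -[X in X%:R * _]card_ord mulr_natl -sumr_const ler_sum// => i _.
      by rewrite !mxE ltW//; case: cid.
    have := lip (Y w) (map_mx ratr q); rewrite ler_norml => /andP[h1 h2].
    have : e * (2 * d%:R + 3) = a - rho (Y w).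
      by rewrite /e divfK// gt_eqF.
    by lra.
  rewrite in_itv/=; apply: le_lt_trans.
  by have := lip (Y w) (map_mx ratr q); rewrite ler_norml => /andP[h1 h2]; lra.
apply: countable_bigcupT_measurable => [|q]; first exact: countableP.
rewrite -[F q]setTI.
have mq : measurable_fun setT (fun w => rho (map_mx ratr q) + enorm (Y w - map_mx ratr q)).
  apply: measurable_funD => //; apply: measurable_enorm; exact: random_vectorD.
rewrite (_ : setT `&` F q = setT `&` (fun w => rho (map_mx ratr q) + enorm (Y w - map_mx ratr q)) @^-1` `]-oo, a[%classic).
  exact: mq.
by apply/seteqP; split => w; rewrite /F/= in_itv.
Qed.

End VMeas.

Section Mkmfun.
Context {d1 d2} {T1 : measurableType d1} {T2 : measurableType d2}.
Variables (f : T1 -> T2) (mf : measurable_fun setT f).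
Let mixin := isMeasurableFun.Build _ _ _ _ _ mf.
Definition mkmfun : {mfun T1 >-> T2} := HB.pack f mixin.
End Mkmfun.

Section Independence.
Local Open Scope ereal_scope.
Context {R : realType} {dT : measure_display} {T : measurableType dT}.
Variable P : probability T R.
Context {dS : measure_display} {S : measurableType dS}.

(* A sub-sigma-algebra generated by [G] that is independent of [Y] lets one
   integrate out [Y] as if it lived on a second copy of the space. *)
Lemma indep_integral (G : set (set T)) (Y : T -> S) :
  G `<=` measurable -> setI_closed G -> G setT -> measurable_fun setT Y ->
  (forall A B, G A -> measurable B ->
    P (A `&` Y @^-1` B) = P A * P (Y @^-1` B)) ->
  forall Phi : g_sigma_algebraType G * S -> \bar R,
  measurable_fun setT Phi -> (forall z, 0 <= Phi z) ->
  \int[P]_w Phi (w, Y w) = \int[P]_w \int[P]_w' Phi (w, Y w').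
Proof.
move=> Gm GI GT mY ind Phi mPhi Phi0.
have ind' A B : <<s G >> A -> measurable B ->
    P (A `&` Y @^-1` B) = P A * P (Y @^-1` B).
  move=> GA mB.
  have mYB : measurable (Y @^-1` B) by rewrite -[_ @^-1` _]setTI; exact: mY.
  pose r : {nonneg R} := NngNum (fine_ge0 (measure_ge0 P (Y @^-1` B))).
  have rE : r%:num%:E = P (Y @^-1` B) by rewrite /= fineK// fin_num_measure.
  rewrite muleC -rE.
  apply: (@g_sigma_algebra_measure_unique _ _ _ G Gm (fun=> setT) (fun=> GT) _
    (mrestr P mYB) (mscale r P)) => //.
  - by rewrite bigcup_const//; exists 0%N.
  - by move=> C GC; apply: etrans (ind C B GC mB) _; rewrite muleC -rE.
  - move=> _; rewrite /mrestr (le_lt_trans (probability_le1 _ _)) ?ltry//.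
    by rewrite setTI.
have sub : <<s G >> `<=` measurable.
  by apply: smallest_sub => //; exact: sigma_algebra_measurable.
(* With [id] read as a map to the coarser space, the claim is that the joint law of [id] and [Y] is
   the product of the marginals. *)
have mid : measurable_fun setT (id : T -> g_sigma_algebraType G).
  by move=> _ A mA; rewrite setTI; exact: sub.
pose m1 := distribution P (mkmfun mid).
pose m2 := distribution P (mkmfun mY).
have mp : measurable_fun setT (fun w : T => (w : g_sigma_algebraType G, Y w)).
  exact: measurable_fun_pair.
pose m' := distribution P (mkmfun mp).
transitivity (\int[m']_z Phi z).
  by rewrite ge0_integral_distribution.
have e : forall A, measurable A -> A `<=` setT -> m' A = (m1 \x m2) A.
  move=> A mA _; apply/esym; apply: (@product_measure_unique _ _ _ _ _ m1 m2 m') => //.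

rewrite (eq_measure_integral (m1 \x m2)%E)//.
rewrite fubini_tonelli1//=.
rewrite ge0_integral_distribution//=; last 2 first.
- exact: measurable_fun_fubini_tonelli_F.
- by move=> y; exact: integral_ge0.
apply: eq_integral => w _; rewrite /fubini_F/=.
rewrite ge0_integral_distribution//=.
exact: measurableT_comp.
Qed.

End Independence.

(** * Averaging operators and independence *)

Section Operators.
Local Open Scope ereal_scope.
Context {R : realType} {d : nat}.
Implicit Types f g : 'cV[R]_d -> \bar R.

(** Nonnegativity makes every exchange of integrals an instance of Tonelli's theorem, without
    integrability conditions. *)
Definition nmeas f := vmeas f /\ forall x, 0 <= f x.

(** Convolution with the law of [V]. Sums of independent vectors become compositions of such
    operators, so that hybrids of summands and Gaussian vectors need no common probability space. *)
Definition op {dT} {T : measurableType dT} (P : probability T R)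
    (V : T -> 'cV[R]_d) f (x : 'cV[R]_d) : \bar R := \int[P]_w f (x + V w)%R.

Lemma nmeas_measurable {dT} {T : measurableType dT} (V : T -> 'cV[R]_d) f x :
  nmeas f -> random_vector V -> measurable_fun setT (fun w => f (x + V w)%R).
Proof. by move=> [mf _] mV; apply: mf; apply: random_vectorD. Qed.

Lemma nmeas_measurable2 {dT dU} {T : measurableType dT} {U : measurableType dU}
  (V : T -> 'cV[R]_d) (W : U -> 'cV[R]_d) f : nmeas f ->
  random_vector V -> random_vector W ->
  measurable_fun setT (fun z => f (V z.1 + W z.2)%R).
Proof.
move=> [mf _] mV mW; apply: mf; apply: random_vectorD.
- exact: (random_vector_comp (f := fst)).
- exact: (random_vector_comp (f := snd)).
Qed.

Lemma nmeas_shift f x : nmeas f -> nmeas (fun y => f (x + y)%R).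
Proof. by move=> [mf f0]; split=> [|y]; [exact: vmeas_shift|exact: f0]. Qed.

Lemma nmeas_cst (c : \bar R) : 0 <= c -> nmeas (fun=> c).
Proof. by move=> c0; split. Qed.

Section one.
Context {dT} {T : measurableType dT} (P : probability T R).
Variables (V : T -> 'cV[R]_d) (mV : random_vector V).

Lemma op_ge0 f x : (forall y, 0 <= f y) -> 0 <= op P V f x.
Proof. by move=> f0; exact: integral_ge0. Qed.

Lemma nmeas_op f : nmeas f -> nmeas (op P V f).
Proof.
move=> nf; split; last by move=> x; apply: op_ge0 => y; apply nf.
move=> dU U Y mY.
apply: (measurable_fun_fubini_tonelli_F (m2 := P) (fun z : U * T => f (Y z.1 + V z.2)%R)).
- exact: (nmeas_measurable2 nf mY mV).
- by move=> z; exact: nf.2.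
Qed.

Lemma op_le f g x : nmeas f -> nmeas g -> (forall y, f y <= g y) ->
  op P V f x <= op P V g x.
Proof.
move=> nf ng fg; apply: ge0_le_integral => //.
- by move=> w _; exact: nf.2.
- exact: (nmeas_measurable x nf mV).
- exact: (nmeas_measurable x ng mV).
Qed.

Lemma op_cst (c : \bar R) x : 0 <= c -> op P V (fun=> c) x = c.
Proof. by move=> c0; rewrite /op/= integral_cst//= probability_setT mule1. Qed.

Lemma op_shift f z x : op P V (fun y => f (z + y)%R) x = op P V f (z + x)%R.
Proof. by apply: eq_integral => w _; rewrite addrA. Qed.

Lemma opD f g x : nmeas f -> nmeas g ->
  op P V (fun y => f y + g y) x = op P V f x + op P V g x.
Proof.
move=> nf ng; rewrite /op ge0_integralD//.
- by move=> w _; exact: nf.2.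
- exact: (nmeas_measurable x nf mV).
- by move=> w _; exact: ng.2.
- exact: (nmeas_measurable x ng mV).
Qed.

Lemma opZ f (k : R) x : (0 <= k)%R -> nmeas f ->
  op P V (fun y => k%:E * f y) x = k%:E * op P V f x.
Proof.
move=> k0 nf; rewrite /op ge0_integralZl//.
- exact: (nmeas_measurable x nf mV).
- by move=> w _; exact: nf.2.
Qed.

End one.

Lemma op_comm {dT dU} {T : measurableType dT} {U : measurableType dU}
  (P : probability T R) (Q : probability U R)
  (V : T -> 'cV[R]_d) (W : U -> 'cV[R]_d) f x : nmeas f ->
  random_vector V -> random_vector W ->
  op P V (op Q W f) x = op Q W (op P V f) x.
Proof.
move=> nf mV mW; rewrite /op.
under eq_integral do under eq_integral do rewrite -addrA.
rewrite (fubini_tonelli (fun z : T * U => f (x + (V z.1 + W z.2))%R)).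
- apply: eq_integral => w _; apply: eq_integral => w' _ /=.
  by rewrite (addrC (V w')) addrA.
- exact: (nmeas_measurable2 (nmeas_shift x nf) mV mW).
- by move=> z; exact: nf.2.
Qed.

Lemma law_integral {dT dU dS} {T : measurableType dT} {U : measurableType dU}
    {S : measurableType dS} (P : probability T R) (Q : {measure set U -> \bar R})
    (X : T -> S) (Y : U -> S) (g : S -> \bar R) :
  measurable_fun setT X -> measurable_fun setT Y ->
  (forall B, measurable B -> P (X @^-1` B) = Q (Y @^-1` B)) ->
  measurable_fun setT g -> (forall y, 0 <= g y) ->
  \int[P]_w g (X w) = \int[Q]_w g (Y w).
Proof.
move=> mX mY h mg g0.
have := ge0_integral_pushforward mX P measurableT mg (fun y _ => g0 y).
have := ge0_integral_pushforward mY Q measurableT mg (fun y _ => g0 y).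
rewrite !preimage_setT => <- <-.
by apply: eq_measure_integral => A mA _; exact: h.
Qed.

End Operators.

Section MutualIndependence.
Local Open Scope ereal_scope.
Context {R : realType} {dT : measure_display} {T : measurableType dT}.
Variable P : probability T R.
Context {dS : measure_display} {S : measurableType dS} {I : finType}.
Variable Y : I -> T -> S.
Hypothesis mY : forall i, measurable_fun setT (Y i).

(** A pi-system that generates the sigma-algebra of all the [Y i] with [i != k]. *)
Definition others (k : I) : set (set T) :=
  [set A | exists B : I -> set S, [/\ forall i, measurable (B i), B k = setT &
    A = \bigcap_(i in [set: I]) (Y i @^-1` B i)]].

Lemma measurable_others k j : j != k ->
  measurable_fun [set: g_sigma_algebraType (others k)] (Y j).
Proof.
move=> jk _ B mB; rewrite setTI; apply: sub_sigma_algebra.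
exists (fun i => if i == j then B else setT); split.
- by move=> i; case: ifP.
- by rewrite eq_sym (negbTE jk).
- apply/seteqP; split => [w Bw i _ /=|w /(_ j Logic.I)/=]; last by rewrite eqxx.
  by case: eqP => // ->.
Qed.

Hypothesis ind : mutually_independent P Y.

Lemma others_integral k (Phi : g_sigma_algebraType (others k) * S -> \bar R) :
  measurable_fun setT Phi -> (forall z, 0 <= Phi z) ->
  \int[P]_w Phi (w, Y k w) = \int[P]_w \int[P]_w' Phi (w, Y k w').
Proof.
move=> mPhi Phi0; apply: (indep_integral (G := others k)) => //.
- move=> _ [B [mB _ ->]]; apply: fin_bigcap_measurable => // i _.
  by rewrite -[_ @^-1` _]setTI; exact: mY.
- move=> _ _ [B [mB Bk ->]] [C [mC Ck ->]]; exists (fun i => B i `&` C i); split.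
  + by move=> i; exact: measurableI.
  + by rewrite Bk Ck setIT.
  + by rewrite -bigcapI; apply: eq_bigcapr => i _; rewrite preimage_setI.
- exists (fun=> setT); split => //.
  by apply/seteqP; split => // w _ i.
- move=> _ B [C [mC Ck ->]] mB.
  have -> : \bigcap_(i in [set: I]) (Y i @^-1` C i) `&` Y k @^-1` B =
      \bigcap_(i in [set: I]) (Y i @^-1` (if i == k then B else C i)).
    apply/seteqP; split => [w [h wB] i _|w h].
      by case: eqP => [->|_] //; exact: h.
    split; last by have := h k Logic.I; rewrite eqxx.
    move=> i _; have := h i Logic.I; case: eqP => // ->; by rewrite Ck.
  rewrite !ind//; last by move=> i; case: ifP.
  rewrite (bigD1 k)//= [in RHS](bigD1 k)//= eqxx Ck preimage_setT probability_setT mul1e.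
  by rewrite muleC; congr (_ * _); apply: eq_bigr => i /negbTE ->.
Qed.

End MutualIndependence.

Section SumOfIndependent.
Local Open Scope ereal_scope.
Context {R : realType} {dT : measure_display} {T : measurableType dT}.
Variable P : probability T R.
Context {dS : measure_display} {S : measurableType dS} {I : finType}.
Variable Y : I -> T -> S.
Hypothesis mY : forall i, measurable_fun setT (Y i).
Hypothesis ind : mutually_independent P Y.
Context {d : nat}.
Variable V : I -> S -> 'cV[R]_d.
Hypothesis mV : forall i, random_vector (V i).

(** Induction on [s]: the partial sum over the tail is measurable for the sigma-algebra generated by
    [others Y k], so that the head variable can be integrated out separately. *)
Lemma op_sum_indep (f : 'cV[R]_d -> \bar R) (s : seq I) x : uniq s -> nmeas f ->
  op P (fun w => \sum_(i <- s) V i (Y i w))%R f x =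
  foldr (fun i => op P (fun w => V i (Y i w))) f s x.
Proof.
elim: s f x => [|k s ih] f x /=.
  move=> _ nf; rewrite /op; under eq_integral do rewrite big_nil addr0.
  by rewrite integral_cst//= probability_setT mule1.
move=> /andP[ks us] nf.
have mVY i : random_vector (fun w => V i (Y i w)).
  exact: (random_vector_comp (mY i) (mV i)).
pose U w := (\sum_(i <- s) V i (Y i w))%R.
have mU : @random_vector _ (g_sigma_algebraType (others Y k)) R d U.
  (* The test [i \in s] inside the sum records that the index of each nonzero term differs from
     [k]. *)
  move=> j; rewrite (_ : (fun w => _) =
    fun w => \sum_(i <- s) (if i \in s then V i (Y i w) j 0 else 0))%R; last first.
    by apply/funext => w; rewrite summxE big_seq big_mkcond.
  apply: measurable_sum => i; case is_ : (i \in s) => //.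
  have ik : i != k by apply: contraNneq ks => <-.
  exact: (measurableT_comp (mV i j) (measurable_others (Y := Y) ik)).
transitivity (\int[P]_w (fun z => f (x + (U z.1 + V k z.2))%R) (w, Y k w)).
  by apply: eq_integral => w _ /=; rewrite big_cons (addrC (V k _)).
rewrite (others_integral mY ind (k := k)
  (Phi := fun z => f (x + (U z.1 + V k z.2))%R)); last 2 first.
- exact: (nmeas_measurable2 (nmeas_shift x nf) mU (mV k)).
- by move=> z; exact: nf.2.
transitivity (op P U (op P (fun w => V k (Y k w)) f) x).
  by apply: eq_integral => w _; apply: eq_integral => w' _ /=; rewrite addrA.
rewrite op_comm//; last exact: random_vector_sum.
rewrite /op; apply: eq_integral => w _.
by rewrite -(ih f) ?andbT.
Qed.

End SumOfIndependent.

(** * Gaussian vectors *)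

Section ExpTaylor.
Context {R : realType}.
Implicit Types x y : R.

(** Each Taylor remainder of the exponential is the derivative of the next one, so that iterating
    this bound yields the three estimates below. *)
Lemma bounded_derivative_bound (g dg : R -> R) (x M : R) :
  g 0 = 0 -> (forall y, is_derive y 1 g (dg y)) ->
  (forall y, `|y| <= `|x| -> `|dg y| <= M) -> `|g x| <= `|x| * M.
Proof.
move=> g0 dgE dgM.
have cg a b : {within `[a, b], continuous g}.
  apply: derivable_within_continuous => y _.
  by have := dgE y => -[].
case: (ltgtP x 0) => x0; last by rewrite x0 g0 normr0 mul0r.
- have [c + e] := MVT x0 (fun y _ => dgE y) (cg _ _).
  rewrite in_itv/= => /andP[xc c0].
  have -> : g x = - (dg c * (0 - x)) by rewrite -e g0 sub0r opprK.
  rewrite sub0r normrN normrM normrN mulrC ler_wpM2l// dgM//.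
  by rewrite !ltr0_norm// lerN2 ltW.
- have [c + e] := MVT x0 (fun y _ => dgE y) (cg _ _).
  rewrite in_itv/= => /andP[xc c0].
  have -> : g x = dg c * (x - 0) by rewrite -e g0 subr0.
  rewrite subr0 normrM mulrC ler_wpM2l// dgM//.
  by rewrite !gtr0_norm// ltW.
Qed.

Lemma expR_norm_le x : expR `|x| <= expR x + expR (- x).
Proof.
have := expR_ge0 x; have := expR_ge0 (- x) => h1 h2.
by have [x0|x0] := leP 0 x; [rewrite ger0_norm//|rewrite ltr0_norm//]; lra.
Qed.

Lemma expR_taylor1 x : `|expR x - 1| <= `|x| * expR `|x|.
Proof.
apply: (@bounded_derivative_bound (fun x => expR x - 1) expR).
- by rewrite expR0 subrr.
- by move=> y; apply: is_derive_eq; rewrite subr0.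
- by move=> y yx; rewrite ger0_norm ?expR_ge0// ler_expR (le_trans (ler_norm _)).
Qed.

Lemma expR_taylor2 x : `|expR x - 1 - x| <= `|x| ^+ 2 * expR `|x|.
Proof.
rewrite expr2 -mulrA.
apply: (@bounded_derivative_bound (fun x => expR x - 1 - x) (fun x => expR x - 1)).
- by rewrite expR0 subrr subr0.
- by move=> y; apply: is_derive_eq; rewrite subr0.
- move=> y yx; apply: le_trans (expR_taylor1 y) _.
  by rewrite ler_pM// ?expR_ge0// ler_expR.
Qed.

Lemma expR_taylor3 x : `|expR x - 1 - x - x ^+ 2 / 2| <= `|x| ^+ 3 * expR `|x|.
Proof.
rewrite (exprS _ 2) -mulrA.
apply: (@bounded_derivative_bound (fun x => expR x - 1 - x - x ^+ 2 / 2)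
  (fun x => expR x - 1 - x)).
- by rewrite expR0 expr0n/= mul0r subrr !subr0.
- move=> y; apply: is_derive_eq. 
  by rewrite !subr0 /GRing.scale/=; field.
- move=> y yx; apply: le_trans (expR_taylor2 y) _.
  by rewrite ler_pM// ?expR_ge0 ?exprn_ge0// ?ler_expR// lerXn2r// nnegrE.
Qed.

End ExpTaylor.

Section Normal1.
Local Open Scope ereal_scope.
Context {R : realType}.
Local Notation mu := (@lebesgue_measure R).
Local Notation N := (@normal_prob R 0 1).

(** Lebesgue measure is [a] times its image under the affine map, since both measures agree on
    half-open intervals. *)
Lemma ge0_integral_affine (f : R -> \bar R) (a b : R) : (0 < a)%R ->
  measurable_fun setT f -> (forall x, 0 <= f x) ->
  \int[mu]_x f (a * x + b)%R = a^-1%:E * \int[mu]_x f x.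
Proof.
move=> a0 mf f0.
have maff : measurable_fun setT (fun x : measurableTypeR R => a * x + b : measurableTypeR R)%R.
  by apply: measurable_funD => //; exact: measurable_funM.
have a0' : (0 <= a)%R by exact: ltW.
pose r : {nonneg R} := NngNum a0'.
have e A : measurable A -> mu A = mscale r (pushforward mu (mkmfun maff)) A.
  apply: lebesgue_measure_unique => _ [[c d]] _ <-.
  have pre : mkmfun maff @^-1` `]c, d] = `]((c - b) / a)%R, ((d - b) / a)%R]%classic.
    apply/seteqP; split => x /=; rewrite !in_itv/= ltr_pdivrMr// ler_pdivlMr//;
    by rewrite ltrBlDr lerBrDr mulrC.
  transitivity (a%:E * mu `]((c - b) / a)%R, ((d - b) / a)%R]%classic); last by rewrite -pre.
  rewrite /= !lebesgue_measure_itv/= !lte_fin ltr_pM2r ?invr_gt0// ltrD2r.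
  case: ifP => _; last by rewrite mule0.
  by rewrite -!EFinD -EFinM; congr (_%:E); field; rewrite gt_eqF.
rewrite [in RHS](eq_measure_integral (mscale r (pushforward mu (mkmfun maff)))); last first.
  by move=> A mA _; exact: e.
rewrite ge0_integral_mscale//= ge0_integral_pushforward//=.
by rewrite muleA -EFinM mulVf ?gt_eqF// mul1e.
Qed.

(** The Radon-Nikodym derivative equals the density almost everywhere, because both have the same
    integral over every measurable set. *)
Lemma ge0_integral_normal (f : R -> \bar R) : measurable_fun setT f ->
  (forall x, 0 <= f x) ->
  \int[N]_x f x = \int[mu]_x (f x * (normal_pdf 0 1 x)%:E).
Proof.
move=> mf f0.
have dom := @normal_prob_dominates R 0 1.
rewrite -(Radon_Nikodym_SigmaFinite.change_of_variables dom)//.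
apply: ae_eq_integral => //.
- apply: emeasurable_funM => //; apply: (measurable_int mu).
  exact: Radon_Nikodym_SigmaFinite.f_integrable.
- apply: emeasurable_funM => //; apply/measurable_EFinP; exact: measurable_normal_pdf.
- apply: ae_eqe_mul2l => /=.
  apply: integral_ae_eq => //=.
  + exact: Radon_Nikodym_SigmaFinite.f_integrable.
  + by apply/measurable_EFinP; exact: measurable_normal_pdf.
  + by move=> E _ mE; rewrite -Radon_Nikodym_SigmaFinite.f_integral.
Qed.

End Normal1.

Section Normal2.
Local Open Scope ereal_scope.
Context {R : realType}.
Local Notation mu := (@lebesgue_measure R).
Local Notation N := (@normal_prob R 0 1).
Local Notation phi := (@normal_pdf R 0 1).

Let phiE x : phi x = (normal_peak 1 * expR (- (x ^+ 2 / 2)))%R.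
Proof. by rewrite normal_pdfE ?oner_neq0// /normal_fun subr0 expr1n mulNr. Qed.

Let mphi : measurable_fun setT (EFin \o phi).
Proof. by apply/measurable_EFinP; exact: measurable_normal_pdf. Qed.

Let maff (a b : R) : measurable_fun setT (fun x : R => a * x + b)%R.
Proof. by apply: measurable_funD => //; exact: measurable_funM. Qed.

Let phi0 x : 0 <= (phi x)%:E. Proof. by rewrite lee_fin normal_pdf_ge0. Qed.

Lemma normal_CameronMartin (f : R -> \bar R) (v : R) : measurable_fun setT f ->
  (forall x, 0 <= f x) ->
  \int[N]_x f (x + v)%R = \int[N]_x (f x * (expR (v * x - v ^+ 2 / 2))%:E).
Proof.
move=> mf f0.
have me : measurable_fun setT (fun x : R => (expR (v * x - v ^+ 2 / 2))%:E).
  apply/measurable_EFinP; apply: (measurableT_comp (@measurable_expR R)).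
  exact: maff.
rewrite !ge0_integral_normal//; last 3 first.
- exact: emeasurable_funM.
- by move=> x; rewrite mule_ge0// lee_fin expR_ge0.
- by under eq_fun do rewrite -[X in (X + _)%R]mul1r; exact: (measurableT_comp mf (maff 1 v)).
pose h s := f s * (phi (1 * s + (- v))%R)%:E.
have mh : measurable_fun setT h.
  apply: emeasurable_funM => //; exact: (measurableT_comp mphi (maff _ _)).
have h0 s : 0 <= h s by rewrite mule_ge0.
transitivity (\int[mu]_x h (1 * x + v)%R).
  by apply: eq_integral => x _; rewrite /h !mul1r addrK.
rewrite ge0_integral_affine// invr1 mul1e; apply: eq_integral => x _.
rewrite /h -muleA -EFinM; congr (_ * _%:E).
rewrite !phiE mul1r mulrCA -expRD; by congr (_ * expR _)%R; field.
Qed.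

Lemma normal_convolution (f : R -> \bar R) (s1 s2 t : R) : measurable_fun setT f ->
  (forall x, 0 <= f x) ->
  (0 <= s1)%R -> (0 <= s2)%R -> (0 <= t)%R -> (t ^+ 2 = s1 ^+ 2 + s2 ^+ 2)%R ->
  \int[N]_x \int[N]_y f (s1 * x + s2 * y)%R = \int[N]_x f (t * x)%R.
Proof.
move=> mf f0 s10 s20 t0 tE.
have [s1E|s1N] := eqVneq s1 0%R.
  have -> : t = s2 by apply/eqP; rewrite -(@eqrXn2 _ 2)// tE s1E expr0n add0r.
  transitivity (\int[N]_x \int[N]_y f (s2 * y)%R).
    by apply: eq_integral => x _; apply: eq_integral => y _; rewrite s1E mul0r add0r.
  by rewrite integral_cst//= probability_setT mule1.
have [s2E|s2N] := eqVneq s2 0%R.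
  have -> : t = s1 by apply/eqP; rewrite -(@eqrXn2 _ 2)// tE s2E expr0n addr0.
  apply: eq_integral => x _.
  transitivity (\int[N]_y f (s1 * x)%R).
    by apply: eq_integral => y _; rewrite s2E mul0r addr0.
  by rewrite integral_cst//= probability_setT mule1.
have {s10 s1N}s10 : (0 < s1)%R by rewrite lt_def s1N.
have {s20 s2N}s20 : (0 < s2)%R by rewrite lt_def s2N.
have {}t0 : (0 < t)%R.
  rewrite lt_def t0 andbT; apply/eqP => t00; move: tE; rewrite t00 expr0n/=.
  by have := exprn_gt0 2 s10; have := exprn_gt0 2 s20; lra.
pose h x y := f y * (phi (s2^-1 * y + (- (s2^-1 * s1 * x)))%R)%:E.
have mh x : measurable_fun setT (h x).
  apply: emeasurable_funM => //; exact: (measurableT_comp mphi (maff _ _)).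
have h0 x y : 0 <= h x y by rewrite mule_ge0.
have inner x : \int[N]_y f (s1 * x + s2 * y)%R = s2^-1%:E * \int[mu]_y h x y.
  rewrite ge0_integral_normal//; last first.
    by under eq_fun do rewrite addrC; exact: (measurableT_comp mf (maff _ _)).
  transitivity (\int[mu]_y h x (s2 * y + s1 * x)%R); last exact: ge0_integral_affine.
  apply: eq_integral => y _; rewrite /h addrC; congr (_ * (phi _)%:E).
  by field; rewrite gt_eqF.
have mhh : measurable_fun setT (fun z : R * R => h z.1 z.2).
  apply: emeasurable_funM; first exact: (measurableT_comp mf measurable_snd).
  apply: (measurableT_comp mphi); apply: measurable_funD.
    exact: (measurableT_comp (mulrl_measurable _) measurable_snd).
  apply: measurableT_comp => //.
  exact: (measurableT_comp (mulrl_measurable _) measurable_fst).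
have mhp : measurable_fun setT (fun z : R * R => s2^-1%:E * h z.1 z.2 * (phi z.1)%:E).
  apply: emeasurable_funM; first exact: measurable_funeM.
  exact: (measurableT_comp mphi measurable_fst).
have hp0 z : 0 <= s2^-1%:E * h z.1 z.2 * (phi z.1)%:E.
  by rewrite !mule_ge0// lee_fin invr_ge0 ltW.
have mF : measurable_fun setT (fun x => s2^-1%:E * \int[mu]_y h x y).
  apply: measurable_funeM.
  exact: (measurable_fun_fubini_tonelli_F (m2 := mu) (fun z : R * R => h z.1 z.2)).
have s2V : (0 <= s2^-1)%R by rewrite invr_ge0 ltW.
have F0 x : 0 <= s2^-1%:E * \int[mu]_y h x y by rewrite mule_ge0// integral_ge0.
under eq_integral do rewrite inner.
rewrite [LHS]ge0_integral_normal//.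
transitivity (\int[mu]_x \int[mu]_y (s2^-1%:E * h x y * (phi x)%:E)).
  apply: eq_integral => x _.
  have mh' : measurable_fun setT (fun y => s2^-1%:E * h x y) by exact: measurable_funeM.
  rewrite ge0_integralZr//; last by move=> y _; rewrite mule_ge0.
  by rewrite ge0_integralZl_EFin//; exact: mh.
rewrite [LHS](fubini_tonelli (m1 := mu) (m2 := mu)
  (fun z : R * R => s2^-1%:E * h z.1 z.2 * (phi z.1)%:E) mhp hp0)/=.
(* Up to scaling, the joint density factors into the density of the sum [y] and the conditional
   density of [x] given [y]; the latter integrates out. *)
have key x y : (phi (s2^-1 * y + (- (s2^-1 * s1 * x))) * phi x =
    phi (t^-1 * y + 0) * phi (t / s2 * x + (- (s1 * y / (s2 * t)))))%R.
  rewrite !phiE mulrACA [RHS]mulrACA -!expRD; congr (_ * expR _)%R.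
  apply/eqP; rewrite -subr_eq0; apply/eqP.
  transitivity ((t ^+ 2 - (s1 ^+ 2 + s2 ^+ 2)) *
    (x ^+ 2 / s2 ^+ 2 - y ^+ 2 / (s2 ^+ 2 * t ^+ 2)) / 2)%R.
    by field; rewrite !gt_eqF.
  by rewrite tE subrr !mul0r.
pose k y := f y * (phi (t^-1 * y + 0)%R)%:E.
have mk : measurable_fun setT k.
  apply: emeasurable_funM => //; exact: (measurableT_comp mphi (maff _ _)).
have k0 y : 0 <= k y by rewrite mule_ge0.
transitivity (t^-1%:E * \int[mu]_y k y).
  rewrite -ge0_integralZl_EFin ?invr_ge0 ?ltW//.
  apply: eq_integral => y _.
  transitivity (\int[mu]_x ((s2^-1%:E * k y) * (phi (t / s2 * x + (- (s1 * y / (s2 * t))))%R)%:E)).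
    by apply: eq_integral => x _; rewrite /h /k -!muleA -[in LHS]EFinM key EFinM.
  rewrite ge0_integralZl//=; last 2 first.
  - exact: (measurableT_comp mphi (maff _ _)).
  - by rewrite mule_ge0.
  rewrite (@ge0_integral_affine _ (EFin \o phi))//; last by rewrite divr_gt0.
  rewrite integral_normal_pdf mule1 muleAC -EFinM; congr (_%:E * _).
  by field; rewrite !gt_eqF.
transitivity (\int[mu]_y k (t * y + 0)%R); first by rewrite ge0_integral_affine.
have mft : measurable_fun setT (fun x => f (t * x)%R).
  have -> : (fun x => f (t * x)%R) = f \o (fun x => t * x + 0)%R.
    by apply/funext => x /=; rewrite addr0.
  exact: (measurableT_comp mf (maff _ _)).
rewrite [RHS](ge0_integral_normal mft (fun x => f0 _)).
by apply: eq_integral => x _; rewrite /k !addr0 mulKf// gt_eqF.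
Qed.

End Normal2.

Section GaussianVector.
Local Open Scope ereal_scope.
Context {R : realType} {d : nat} {dT : measure_display} {T : measurableType dT}.
Variables (P : probability T R) (Z : T -> 'cV[R]_d).
Hypothesis gZ : std_gaussian P Z.
Local Notation N := (@normal_prob R 0 1).
Implicit Types (f h : 'cV[R]_d -> \bar R) (u v : 'cV[R]_d).

Let mZ : random_vector Z. Proof. by case: gZ. Qed.

Lemma delta_coord (t : R) (j k : 'I_d) :
  ((t *: (delta_mx k 0 : 'cV[R]_d)) j 0 = if j == k then t else 0)%R.
Proof. by rewrite !mxE eqxx andbT; case: eqP => _; rewrite ?mulr1 ?mulr0. Qed.

Lemma random_vector_delta dS (S : measurableType dS) (k : 'I_d) (g : S -> R) :
  measurable_fun setT g -> random_vector (fun t => g t *: delta_mx k 0 : 'cV[R]_d)%R.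
Proof. by move=> mg; apply: random_vectorZ => // j. Qed.

Lemma gauss_law (k : 'I_d) (g : R -> \bar R) : measurable_fun setT g ->
  (forall x, 0 <= g x) -> \int[P]_w g (Z w k 0%R) = \int[N]_t g t.
Proof.
move=> mg g0; case: gZ => _ _ law.
apply: (@law_integral R _ _ _ T (measurableTypeR R) (measurableTypeR R) P N
  (fun w => Z w k 0%R) id) => //.
- exact: mZ.
- exact: law.
Qed.

Lemma gauss_resample (k : 'I_d) f : nmeas f ->
  \int[P]_w f (Z w) =
  \int[P]_w \int[N]_t f (Z w + (t - Z w k 0) *: delta_mx k 0)%R.
Proof.
move=> nf; case: gZ => _ ind _.
pose Y (j : 'I_d) w := Z w j 0%R.
(* Coordinate [k] of the first argument is overwritten, so that [F] depends on that argument through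
   the other coordinates alone. *)
pose F (z : T * R) := f (Z z.1 + (z.2 - Z z.1 k 0) *: delta_mx k 0)%R.
transitivity (\int[P]_w F (w, Y k w)).
  by apply: eq_integral => w _; rewrite /F /= subrr scale0r addr0.
rewrite (@others_integral _ _ _ P _ _ _ Y _ ind k F) => [|||z]; last exact: nf.2.
- apply: eq_integral => w _.
  pose G t := f (Z w + (t - Z w k 0) *: delta_mx k 0)%R.
  apply: (@gauss_law k G); last by move=> x; exact: nf.2.
  apply: nmeas_measurable => //; apply: random_vector_delta.
  exact: measurable_funB.
- by move=> j; exact: mZ.
- apply: nf.1 => j.
  have [->|jk] := eqVneq j k.
    rewrite (_ : (fun w => _) = snd); first exact: measurable_snd.
    by apply/funext => z; rewrite mxE delta_coord eqxx addrC subrK.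
  rewrite (_ : (fun w => _) = (fun w => Z w j 0%R) \o fst).
    exact: (measurableT_comp (measurable_others (Y := Y) jk) measurable_fst).
  by apply/funext => z; rewrite mxE delta_coord (negbTE jk) addr0.
Qed.

Let wt v w : R := expR (dotv v w - dotv v v / 2).

Lemma vmeas_expR_dotv v (c : R) :
  vmeas (EFin \o (fun w : 'cV[R]_d => expR (dotv v w + c))).
Proof.
move=> dU U Y mY; apply/measurable_EFinP.
apply: (measurableT_comp (@measurable_expR R)); apply: measurable_funD => //.
exact: measurable_dotv.
Qed.

Lemma nmeasM f (g : 'cV[R]_d -> R) : nmeas f -> vmeas (EFin \o g) ->
  (forall x, 0 <= g x)%R -> nmeas (fun x => f x * (g x)%:E).
Proof.
move=> nf mg g0; split=> [dU U Y mY|x]; last by rewrite mule_ge0 ?lee_fin// nf.2.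
by apply: emeasurable_funM; [exact: nf.1|exact: mg].
Qed.

Let nmeas_wt f v : nmeas f -> nmeas (fun x => f x * (wt v x)%:E).
Proof.
by move=> nf; apply: nmeasM => //; [exact: vmeas_expR_dotv|move=> x; exact: expR_ge0].
Qed.

(** The property is additive in [v], so that it suffices to shift along the axes, where resampling a
    single coordinate reduces it to dimension one. *)
Let CM v := forall f, nmeas f ->
  \int[P]_w f (Z w + v)%R = \int[P]_w (f (Z w) * (wt v (Z w))%:E).

Let CM_delta (a : R) k : CM (a *: delta_mx k 0)%R.
Proof.
move=> f nf.
rewrite (gauss_resample k (f := fun z => f (z + a *: delta_mx k 0)%R)); last first.
  split => [|x]; last exact: nf.2.
  by move=> dU U Y mY; apply: nf.1; apply: random_vectorD.
rewrite [RHS](gauss_resample k (nmeas_wt (a *: delta_mx k 0)%R nf)).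
apply: eq_integral => w _.
pose F t := f (Z w + (t - Z w k 0) *: delta_mx k 0)%R.
have mF : measurable_fun setT F.
  apply: nmeas_measurable => //; apply: random_vector_delta.
  exact: measurable_funB.
transitivity (\int[N]_t F (t + a)%R).
  apply: eq_integral => t _; rewrite /F -addrA -scalerDl; congr (f (_ + _ *: _))%R.
  ring.
rewrite (normal_CameronMartin _ mF); last by move=> x; exact: nf.2.
apply: eq_integral => t _; congr (_ * (expR _)%:E).
rewrite !dotvZl dotvZr !(dotvC (delta_mx k 0%R)) !dotv_delta mxE delta_coord eqxx.
by rewrite mxE !eqxx/=; field.
Qed.

Let CMD u v : CM u -> CM v -> CM (u + v)%R.
Proof.
move=> hu hv f nf.
have nfv x : nmeas (fun z => f (z + x)%R).
  split => [|y]; last exact: nf.2.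
  by move=> dU U Y mY; apply: nf.1; apply: random_vectorD.
transitivity (\int[P]_w (fun z => f (z + v)%R) (Z w + u)%R).
  by apply: eq_integral => w _; rewrite addrA.
apply: etrans (hu _ (nfv v)) _.
have ng : nmeas (fun z => f z * (expR (dotv u z + (- dotv u v - dotv u u / 2)))%:E).
  by apply: nmeasM => //; exact: vmeas_expR_dotv.
transitivity (\int[P]_w
    (fun z => f z * (expR (dotv u z + (- dotv u v - dotv u u / 2)))%:E) (Z w + v)%R).
  apply: eq_integral => w _; congr (_ * (expR _)%:E).
  by rewrite dotvDr; ring.
apply: etrans (hv _ ng) _; apply: eq_integral => w _.
rewrite -muleA -EFinM -expRD; congr (_ * (expR _)%:E).
by rewrite !dotvDl !dotvDr (dotvC v u); field.
Qed.

Lemma CameronMartin v f : nmeas f ->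
  \int[P]_w f (Z w + v)%R =
  \int[P]_w (f (Z w) * (expR (dotv v (Z w) - dotv v v / 2))%:E).
Proof.
suff : CM v by exact.
have -> : v = (\sum_i v i 0 *: delta_mx i 0)%R.
  apply/colP => i; rewrite summxE (bigD1 i)//= big1 ?addr0.
    by rewrite !mxE !eqxx mulr1.
  by move=> j ji; rewrite !mxE eq_sym (negbTE ji) mulr0.
elim/big_ind : _ => [|u w|i _]; [|exact: CMD|exact: CM_delta].
move=> g ng; apply: eq_integral => w _; rewrite addr0 /wt !dot0v mul0r subrr expR0.
by rewrite mule1.
Qed.

Lemma gauss_mgf v : \int[P]_w (expR (dotv v (Z w)))%:E = (expR (dotv v v / 2))%:E.
Proof.
have := CameronMartin v (nmeas_cst (c := 1) lee01).
rewrite integral_cst//= probability_setT mule1.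
under eq_integral do rewrite mul1e.
move=> /(congr1 (fun x => (expR (dotv v v / 2))%:E * x)); rewrite mule1 => ->.
rewrite -ge0_integralZl_EFin ?expR_ge0//.
- by apply: eq_integral => w _; rewrite -EFinM -expRD; congr (expR _)%:E; ring.
- exact: (vmeas_expR_dotv v (- (dotv v v / 2))%R mZ).
Qed.

Let coord s (j : 'I_d) (t : R) : 'cV[R]_d := ((s * t) *: delta_mx j 0)%R.

Let mcoord s j : random_vector (coord s j).
Proof. exact: random_vector_delta. Qed.

Let op_coord s f x : nmeas f ->
  op P (fun w => s *: Z w)%R f x =
  foldr (fun j => op N (coord s j)) f (index_enum 'I_d) x.
Proof.
move=> nf; case: gZ => _ ind _.
transitivity (op P (fun w => \sum_(j <- index_enum 'I_d) coord s j (Z w j 0%R)) f x)%R.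
  apply: eq_integral => w _; congr (f (_ + _))%R.
  apply/colP => i; rewrite summxE (bigD1 i)//= big1 ?addr0.
    by rewrite /coord delta_coord eqxx mxE.
  by move=> j ji; rewrite /coord delta_coord eq_sym (negbTE ji).
rewrite (op_sum_indep (Y := fun j w => Z w j 0%R) (V := coord s) mZ ind (@mcoord s))
  ?index_enum_uniq//.
congr (_ x); elim: (index_enum 'I_d) => //= j l ->.
apply/funext => y; set g := foldr _ _ _.
have ng : nmeas g.
  by rewrite /g; elim: l {g} => //= i l ih; apply: nmeas_op => //; exact: mcoord.
apply: (@gauss_law j (fun t => g (y + coord s j t)%R)).
  exact: nmeas_measurable.
by move=> t; exact: ng.2.
Qed.

(** Both operators factor into one-dimensional convolutions along the axes. These commute, so that
    the two factors of each axis can be brought together and merged by [normal_convolution]. *)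
Lemma gauss_semigroup (s1 s2 t : R) f x : nmeas f ->
  (0 <= s1)%R -> (0 <= s2)%R -> (0 <= t)%R -> (t ^+ 2 = s1 ^+ 2 + s2 ^+ 2)%R ->
  op P (fun w => s1 *: Z w)%R (op P (fun w => s2 *: Z w)%R f) x =
  op P (fun w => t *: Z w)%R f x.
Proof.
move=> nf s10 s20 t0 tE.
have mZs s : random_vector (fun w => s *: Z w)%R by exact: random_vectorZ.
rewrite op_coord ?op_coord//; last exact: nmeas_op.
have -> : op P (fun w => s2 *: Z w)%R f =
  foldr (fun j => op N (coord s2 j)) f (index_enum 'I_d).
  by apply/funext => y; exact: op_coord.
have nfold s g l : nmeas g -> nmeas (foldr (fun j => op N (coord s j)) g l).
  by move=> ng; elim: l => //= i l ih; apply: nmeas_op => //; exact: mcoord.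
have comm s j g l : nmeas g ->
    foldr (fun j => op N (coord s j)) (op N (coord s2 j) g) l =
    op N (coord s2 j) (foldr (fun j => op N (coord s j)) g l).
  move=> ng; elim: l => //= i l ->; apply/funext => y.
  by rewrite op_comm; [|exact: nfold|exact: mcoord|exact: mcoord].
congr (_ x); elim: (index_enum 'I_d) => //= j l <-.
rewrite comm; last exact: nfold.
set g := foldr _ _ _; have ng : nmeas g by exact: (nfold _ _ _ (nfold _ _ _ nf)).
apply/funext => y; rewrite /op.
have mF : measurable_fun setT (fun r : R => g (y + r *: delta_mx j 0)%R).
  by apply: nmeas_measurable => //; exact: random_vector_delta.
pose G (r : R) := g (y + r *: delta_mx j 0)%R.
transitivity (\int[N]_a \int[N]_b G (s1 * a + s2 * b)%R).
  apply: eq_integral => a _; apply: eq_integral => b _.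
  by rewrite /G /coord -addrA -scalerDl.
exact: (normal_convolution mF (fun r => ng.2 _) s10 s20 t0 tE).
Qed.

End GaussianVector.

(** * Integrability and Gaussian moments *)

Section Integrability.
Context {R : realType} {dT : measure_display} {T : measurableType dT}.
Variable P : probability T R.
Implicit Types f g : T -> R.

Lemma integrable_dom f g : measurable_fun setT f ->
  (forall w, `|f w| <= g w) -> P.-integrable setT (EFin \o g) ->
  P.-integrable setT (EFin \o f).
Proof.
move=> mf fg; apply: le_integrable => //; first exact/measurable_EFinP.
move=> w _ /=; rewrite lee_fin; apply: le_trans (fg w) _; exact: ler_norm.
Qed.

Lemma ge0_integrable f : measurable_fun setT f -> (forall w, 0 <= f w) ->
  (\int[P]_w (f w)%:E < +oo)%E -> P.-integrable setT (EFin \o f).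
Proof.
move=> mf f0 flty; apply/integrableP; split; first exact/measurable_EFinP.
by under eq_integral do rewrite /= ger0_norm//.
Qed.

Lemma ge0_Rintegral f (c : R) : (\int[P]_w (f w)%:E = c%:E)%E ->
  \int[P]_w f w = c.
Proof. by rewrite /Rintegral => ->. Qed.

Lemma Rintegral_EFin f : P.-integrable setT (EFin \o f) ->
  (\int[P]_w (f w)%:E)%E = (\int[P]_w f w)%:E.
Proof. by move=> fi; rewrite /Rintegral fineK//; exact: integrable_fin_num. Qed.

Lemma Rintegral_cstP (c : R) : \int[P]_w c = c.
Proof. by rewrite Rintegral_cst//= probability_setT/= mulr1. Qed.

Lemma integrable_cstP (c : R) : P.-integrable setT (EFin \o (fun _ : T => c)).
Proof. exact: finite_measure_integrable_cst. Qed.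

Lemma integrableDr f g : P.-integrable setT (EFin \o f) ->
  P.-integrable setT (EFin \o g) ->
  P.-integrable setT (EFin \o (fun w => f w + g w)).
Proof. by move=> fi gi; have := integrableD measurableT fi gi. Qed.

Lemma integrableBr f g : P.-integrable setT (EFin \o f) ->
  P.-integrable setT (EFin \o g) ->
  P.-integrable setT (EFin \o (fun w => f w - g w)).
Proof. by move=> fi gi; have := integrableB measurableT fi gi. Qed.

Lemma integrableZr (c : R) f : P.-integrable setT (EFin \o f) ->
  P.-integrable setT (EFin \o (fun w => c * f w)).
Proof. by move=> fi; have := integrableZl measurableT c fi. Qed.

Lemma integrable_sumr (I : Type) (s : seq I) (f : I -> T -> R) :
  (forall i, P.-integrable setT (EFin \o f i)) ->
  P.-integrable setT (EFin \o (fun w => \sum_(i <- s) f i w)).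
Proof.
move=> fi; elim: s => [|i s ih].
  by rewrite (_ : _ \o _ = EFin \o (fun=> 0)); [exact: integrable_cstP|
    apply/funext => w /=; rewrite big_nil].
rewrite (_ : _ \o _ = EFin \o (fun w => f i w + \sum_(i <- s) f i w)).
  exact: integrableDr.
by apply/funext => w /=; rewrite big_cons.
Qed.

Lemma Rintegral_sum (I : Type) (s : seq I) (f : I -> T -> R) :
  (forall i, P.-integrable setT (EFin \o f i)) ->
  \int[P]_w (\sum_(i <- s) f i w) = \sum_(i <- s) \int[P]_w f i w.
Proof.
move=> fi; elim: s => [|i s ih].
  by rewrite big_nil -[RHS](Rintegral_cstP 0); apply: eq_Rintegral => w _; rewrite big_nil.
rewrite big_cons -ih -RintegralD//; last exact: integrable_sumr.
by apply: eq_Rintegral => w _; rewrite big_cons.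
Qed.

Lemma measurable_integrable f : P.-integrable setT (EFin \o f) ->
  measurable_fun setT f.
Proof. by move=> /integrableP[/measurable_EFinP]. Qed.

End Integrability.

Lemma exprn_le_expR (R : realType) (x : R) k : 0 <= x -> x ^+ k <= k`!%:R * expR x.
Proof.
move=> x0; case: k => [|k].
  by rewrite expr0 mul1r -expR0 ler_expR.
have := expR_ge1Dxn k x0 => h.
have k0 : 0 < (k.+1)`!%:R :> R by rewrite ltr0n fact_gt0.
rewrite mulrC -ler_pdivrMr//; lra.
Qed.

(** Takes the place of a limit as [s] tends to 0 when moments are read off from the moment
    generating function. *)
Lemma vanishing_linear (R : realType) (x C : R) :
  (forall s, 0 < s -> s <= 1 -> `|x| <= s * C) -> x = 0.
Proof.
move=> h; apply/eqP; rewrite -normr_eq0 eq_le normr_ge0 andbT leNgt; apply/negP => x0.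
have C0 : 0 < C by have := h 1 ltr01 (lexx _); rewrite mul1r; exact: lt_le_trans.
pose s := Num.min 1 (`|x| / C / 2).
have s0 : 0 < s by rewrite lt_min ltr01 !divr_gt0.
have := h s s0; rewrite ge_min lexx => /(_ isT) h1.
have : s * C <= `|x| / C / 2 * C by rewrite ler_pM2r// ge_min lexx orbT.
rewrite mulrAC divfK ?gt_eqF// => h2; lra.
Qed.

Section Mgf.
Context {R : realType} {dT : measure_display} {T : measurableType dT}.
Variable P : probability T R.
Variables (N : T -> R) (b : R).
Hypothesis mN : measurable_fun setT N.
Hypothesis b0 : 0 <= b.
Hypothesis mgf : forall s,
  (\int[P]_w (expR (s * N w))%:E = (expR (s ^+ 2 * b / 2))%:E)%E.

Let mexp s : measurable_fun setT (fun w => expR (s * N w)).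
Proof.
apply: (measurableT_comp (@measurable_expR R)).
exact: (measurableT_comp (mulrl_measurable _) mN).
Qed.

Lemma mgf_integrable s : P.-integrable setT (EFin \o (fun w => expR (s * N w))).
Proof.
by apply: ge0_integrable => //; rewrite mgf ltry.
Qed.

Lemma mgf_integrable_norm s : 0 <= s ->
  P.-integrable setT (EFin \o (fun w => expR (s * `|N w|))).
Proof.
move=> s0; apply: (@integrable_dom _ _ _ _ _ (fun w => expR (s * N w) + expR (- s * N w))).
- apply: (measurableT_comp (@measurable_expR R)).
  apply: (measurableT_comp (mulrl_measurable _)).
  exact: measurableT_comp.
- move=> w; rewrite ger0_norm ?expR_ge0// -{1}(ger0_norm s0) -normrM mulNr.
  exact: expR_norm_le.
- by apply: integrableDr; exact: mgf_integrable.
Qed.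

Lemma mgf_integrable_pow k : P.-integrable setT (EFin \o (fun w => `|N w| ^+ k)).
Proof.
apply: (@integrable_dom _ _ _ _ _ (fun w => k`!%:R * expR (1 * `|N w|))).
- by apply: measurable_funX; exact: measurableT_comp.
- by move=> w; rewrite mul1r ger0_norm ?exprn_ge0// exprn_le_expR.
- by apply: integrableZr; exact: mgf_integrable_norm.
Qed.

Lemma mgf_pow_le k : \int[P]_w (`|N w| ^+ k) <= k`!%:R * (2 * expR (b / 2)).
Proof.
have e1 : \int[P]_w (k`!%:R * (expR (1 * N w) + expR (- 1 * N w))) =
    k`!%:R * (2 * expR (b / 2)).
  rewrite RintegralZl//; last by apply: integrableDr; exact: mgf_integrable.
  rewrite RintegralD//; [|exact: mgf_integrable..].
  by rewrite !(ge0_Rintegral (mgf _)) expr1n sqrrN expr1n mul1r; ring.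
rewrite -e1; apply: le_Rintegral => //.
- exact: mgf_integrable_pow.
- by apply: integrableZr; apply: integrableDr; exact: mgf_integrable.
- move=> w _; apply: le_trans (exprn_le_expR k (normr_ge0 _)) _.
  by rewrite ler_wpM2l// mul1r mulN1r expR_norm_le.
Qed.

Let integrable_N : P.-integrable setT (EFin \o N).
Proof.
apply: (@integrable_dom _ _ _ _ _ (fun w => `|N w| ^+ 1)) => //.
exact: mgf_integrable_pow.
Qed.

Let integrable_N2 : P.-integrable setT (EFin \o (fun w => N w ^+ 2)).
Proof.
have := mgf_integrable_pow 2; congr (P.-integrable _ _).
by apply/funext => w /=; rewrite real_normK// num_real.
Qed.

Let K := \int[P]_w (expR (2 * `|N w|)).

Let mulN_le s w : 0 < s -> s <= 1 -> `|s * N w| <= s * `|N w| /\ s * `|N w| <= `|N w|.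
Proof. by move=> s0 s1; rewrite normrM gtr0_norm// ler_piMl. Qed.

Let taylor_le k s w : 0 < s -> s <= 1 ->
  `|s * N w| ^+ k * expR `|s * N w| <= s ^+ k * k`!%:R * expR (2 * `|N w|).
Proof.
move=> s0 s1; have [_ h] := mulN_le w s0 s1.
rewrite normrM (gtr0_norm s0) exprMn -!mulrA ler_wpM2l ?exprn_ge0 ?(ltW s0)//.
have -> : 2 * `|N w| = `|N w| + `|N w| by ring.
rewrite expRD mulrA.
apply: ler_pM; rewrite ?exprn_ge0 ?expR_ge0 ?ler_expR//; exact: exprn_le_expR.
Qed.

Let K_integrable c :
  P.-integrable setT (EFin \o (fun w => c * expR (2 * `|N w|))).
Proof. by apply: integrableZr; apply: mgf_integrable_norm. Qed.

Let scaled_half s : s ^+ 2 <= 1 -> 0 <= s ^+ 2 * b / 2 /\ s ^+ 2 * b / 2 <= b / 2.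
Proof.
move=> s1; split; last by rewrite ler_pM2r// ler_piMl.
by apply: divr_ge0 => //; apply: mulr_ge0 => //; exact: sqr_ge0.
Qed.

(** Both sides of [mgf] are expanded for small [s]; the remainders are O(s^2), hence so is [s] times
    the mean. *)
Lemma mgf_mean : \int[P]_w N w = 0.
Proof.
apply: (@vanishing_linear _ _ (2 * K + b / 2 * expR (b / 2))) => s s0 s1.
have s2 : s ^+ 2 <= 1 by rewrite exprn_ile1// ltW.
have fi : P.-integrable setT (EFin \o (fun w => expR (s * N w) - 1 - s * N w)).
  apply: integrableBr; last exact: integrableZr.
  by apply: integrableBr; [exact: mgf_integrable|exact: integrable_cstP].
have : `|\int[P]_w (expR (s * N w) - 1 - s * N w)| <= s ^+ 2 * 2 * K.
  apply: le_trans (le_normr_Rintegral measurableT fi) _.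
  rewrite -RintegralZl//; last by apply: mgf_integrable_norm.
  apply: le_Rintegral => //.
  - exact: integrable_norm.
  - move=> w _; apply: le_trans (expR_taylor2 _) _.
    by have := taylor_le 2 w s0 s1.
rewrite RintegralB//; last 2 first.
- by apply: integrableBr; [exact: mgf_integrable|exact: integrable_cstP].
- exact: integrableZr.
rewrite RintegralB//; [|exact: mgf_integrable|exact: integrable_cstP].
rewrite Rintegral_cstP RintegralZl// (ge0_Rintegral (mgf _)) => h.
have h2 : `|expR (s ^+ 2 * b / 2) - 1| <= s ^+ 2 * (b / 2 * expR (b / 2)).
  have [y0 yb] := scaled_half s2.
  apply: le_trans (expR_taylor1 _) _; rewrite ger0_norm//.
  have -> : s ^+ 2 * (b / 2 * expR (b / 2)) = s ^+ 2 * b / 2 * expR (b / 2) by ring.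
  by rewrite ler_wpM2l// ler_expR.
rewrite -(ler_pM2l s0).
have -> : s * `|\int[P]_w N w| = `|s * \int[P]_w N w| by rewrite normrM (gtr0_norm s0).
have := ler_normB (expR (s ^+ 2 * b / 2) - 1)
  (expR (s ^+ 2 * b / 2) - 1 - s * \int[P]_w N w).
rewrite opprB addrCA subrr addr0; move: h h2; set X := expR (b / 2); nra.
Qed.

(** The comparison of [mgf_mean] one order further, with remainders O(s^3). *)
Lemma mgf_var : \int[P]_w (N w ^+ 2) = b.
Proof.
apply/eqP; rewrite -subr_eq0; apply/eqP.
apply: (@vanishing_linear _ _ (2 * (6 * K + (b / 2) ^+ 2 * expR (b / 2)))) => s s0 s1.
have s2 : s ^+ 2 <= 1 by rewrite exprn_ile1// ltW.
pose f w := expR (s * N w) - 1 - s * N w - s ^+ 2 / 2 * N w ^+ 2.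
have i1 : P.-integrable setT (EFin \o (fun w => expR (s * N w) - 1)).
  by apply: integrableBr; [exact: mgf_integrable|exact: integrable_cstP].
have i2 : P.-integrable setT (EFin \o (fun w => expR (s * N w) - 1 - s * N w)).
  by apply: integrableBr => //; exact: integrableZr.
have i3 : P.-integrable setT (EFin \o (fun w => s ^+ 2 / 2 * N w ^+ 2)).
  exact: integrableZr.
have fi : P.-integrable setT (EFin \o f) by exact: integrableBr.
have : `|\int[P]_w f w| <= s ^+ 3 * 6 * K.
  apply: le_trans (le_normr_Rintegral measurableT fi) _.
  rewrite -RintegralZl//; last by apply: mgf_integrable_norm.
  apply: le_Rintegral => //.
  - exact: integrable_norm.
  - move=> w _; have := expR_taylor3 (s * N w).
    have -> : (s * N w) ^+ 2 / 2 = s ^+ 2 / 2 * N w ^+ 2 by rewrite exprMn; ring.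
    by move/le_trans; apply; exact: (taylor_le 3 w s0 s1).
rewrite /f RintegralB// RintegralB//; [|exact: integrableZr].
rewrite RintegralB//; [|exact: mgf_integrable|exact: integrable_cstP].
rewrite Rintegral_cstP !RintegralZl// (ge0_Rintegral (mgf _)) mgf_mean mulr0 subr0 => h.
have h2 : `|expR (s ^+ 2 * b / 2) - 1 - s ^+ 2 * b / 2| <=
    s ^+ 3 * ((b / 2) ^+ 2 * expR (b / 2)).
  have [y0 yb] := scaled_half s2.
  apply: le_trans (expR_taylor2 _) _; rewrite ger0_norm//.
  apply: (@le_trans _ _ (s ^+ 4 * ((b / 2) ^+ 2 * expR (b / 2)))).
    have -> : s ^+ 4 * ((b / 2) ^+ 2 * expR (b / 2)) =
      (s ^+ 2 * b / 2) ^+ 2 * expR (b / 2) by ring.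
    by rewrite ler_wpM2l ?exprn_ge0// ler_expR.
  rewrite ler_wpM2r ?mulr_ge0 ?exprn_ge0 ?divr_ge0 ?expR_ge0//.
  by rewrite ler_wiXn2l// ltW.
have s3 : 0 < s ^+ 2 by rewrite exprn_gt0.
have e : s ^+ 3 = s ^+ 2 * s by ring.
rewrite e in h h2.
set V := \int[P]_w (N w ^+ 2) in h *; set X := expR (b / 2) in h2 *.
have : `|s ^+ 2 / 2 * (V - b)| <= s ^+ 2 / 2 * (s * (2 * (6 * K + (b / 2) ^+ 2 * X))).
  have -> : s ^+ 2 / 2 * (V - b) = (expR (s ^+ 2 * b / 2) - 1 - s ^+ 2 * b / 2) -
    (expR (s ^+ 2 * b / 2) - 1 - s ^+ 2 / 2 * V) by ring.
  apply: le_trans (ler_normB _ _) _; lra.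
by rewrite normrM gtr0_norm ?ler_pM2l// divr_gt0.
Qed.

End Mgf.

Section LevelSets.
Context {R : realType} {dT : measure_display} {T : measurableType dT}.
Implicit Types f : T -> R.

Lemma measurable_gt_cst f a : measurable_fun setT f -> measurable [set w | a < f w].
Proof.
move=> mf; have := mf measurableT _ (measurable_itv `]a, +oo[); rewrite setTI.
by congr (measurable _); apply/seteqP; split => w; rewrite /= in_itv/= andbT.
Qed.

Lemma measurable_le_cst f a : measurable_fun setT f -> measurable [set w | f w <= a].
Proof.
move=> mf; have := mf measurableT _ (measurable_itv `]-oo, a]); rewrite setTI.
by congr (measurable _); apply/seteqP; split => w; rewrite /= in_itv/=.
Qed.

End LevelSets.

Section Standardized.
Context {R : realType} {d : nat} {dT : measure_display} {T : measurableType dT}.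
Variables (P : probability T R) (V : T -> 'cV[R]_d).

(** What the replacement step has to know about a summand. The normalized summands and the Gaussian
    vector both satisfy it and can be treated symmetrically. *)
Definition standardized (beta : R) : Prop :=
  [/\ random_vector V,
      forall j, \int[P]_w (V w j 0) = 0,
      forall j k, \int[P]_w (V w j 0 * V w k 0) = (j == k)%:R,
      P.-integrable setT (EFin \o (fun w => enorm (V w) ^+ 3)) &
      \int[P]_w (enorm (V w) ^+ 3) <= beta].

End Standardized.

Section GaussianMoments.
Context {R : realType} {d : nat} {dT : measure_display} {T : measurableType dT}.
Variables (P : probability T R) (Z : T -> 'cV[R]_d).
Hypothesis gZ : std_gaussian P Z.
Hypothesis d0 : (0 < d)%N.
Local Notation rd := (Num.sqrt d%:R : R).

Let mZ : random_vector Z. Proof. by case: gZ. Qed.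

Let mdot v : measurable_fun setT (fun w => dotv v (Z w)).
Proof. by apply: measurable_dotv => // j. Qed.

Lemma rd_ge1 : 1 <= rd.
Proof. by rewrite -[leLHS]sqrtr1 ler_wsqrtr// ler1n. Qed.

Lemma rd_gt0 : 0 < rd. Proof. exact: lt_le_trans ltr01 rd_ge1. Qed.

Lemma rd_sqr : rd ^+ 2 = d%:R. Proof. by rewrite sqr_sqrtr// ler0n. Qed.

Let mgf_dot v s : (\int[P]_w (expR (s * dotv v (Z w)))%:E =
  (expR (s ^+ 2 * dotv v v / 2))%:E)%E.
Proof.
have := gauss_mgf gZ (s *: v); rewrite !dotvZl dotvZr => h.
under eq_integral do rewrite -dotvZl.
by rewrite h; congr (expR _)%:E; ring.
Qed.

Lemma gauss_dot_mean v : \int[P]_w dotv v (Z w) = 0.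
Proof. exact: (mgf_mean (mdot v) (dotv_ge0 v) (mgf_dot v)). Qed.

Lemma gauss_dot_var v : \int[P]_w (dotv v (Z w) ^+ 2) = dotv v v.
Proof. exact: (mgf_var (mdot v) (dotv_ge0 v) (mgf_dot v)). Qed.

Lemma gauss_dot_pow_integrable v k :
  P.-integrable setT (EFin \o (fun w => `|dotv v (Z w)| ^+ k)).
Proof. exact: (mgf_integrable_pow (mdot v) (mgf_dot v)). Qed.

Lemma gauss_dot_sqr_integrable v :
  P.-integrable setT (EFin \o (fun w => dotv v (Z w) ^+ 2)).
Proof.
have := gauss_dot_pow_integrable v 2; congr (P.-integrable _ _).
by apply/funext => w /=; rewrite real_normK// num_real.
Qed.

Let coordE j w : Z w j 0 = dotv (delta_mx j 0) (Z w).
Proof. by rewrite dotvC dotv_delta. Qed.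

Lemma gauss_enorm2_integrable : P.-integrable setT (EFin \o (fun w => enorm (Z w) ^+ 2)).
Proof.
have -> : (fun w => enorm (Z w) ^+ 2) = fun w => \sum_j (dotv (delta_mx j 0) (Z w) ^+ 2).
  by apply/funext => w; rewrite enorm_sqr; apply: eq_bigr => j _; rewrite -coordE.
by apply: integrable_sumr => j; exact: gauss_dot_sqr_integrable.
Qed.

Lemma gauss_enorm2 : \int[P]_w (enorm (Z w) ^+ 2) = d%:R.
Proof.
transitivity (\int[P]_w (\sum_j (dotv (delta_mx j 0) (Z w) ^+ 2))).
  by apply: eq_Rintegral => w _; rewrite enorm_sqr; apply: eq_bigr => j _; rewrite -coordE.
rewrite Rintegral_sum; last by move=> j; exact: gauss_dot_sqr_integrable.
rewrite -[in RHS](card_ord d) -sum1_card natr_sum; apply: eq_bigr => j _.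
by rewrite gauss_dot_var dotv_delta !mxE !eqxx.
Qed.

Lemma gauss_enorm_integrable : P.-integrable setT (EFin \o (fun w => enorm (Z w))).
Proof.
apply: (@integrable_dom _ _ _ _ _ (fun w => 1 + enorm (Z w) ^+ 2)).
- exact: measurable_enorm.
- by move=> w; rewrite ger0_norm ?enorm_ge0//; have := enorm_ge0 (Z w); nra.
- by apply: integrableDr; [exact: integrable_cstP|exact: gauss_enorm2_integrable].
Qed.

(** From [x <= x ^+ 2 / (2 * rd) + rd / 2], which is optimal at [x = rd], and the second moment. *)
Lemma gauss_enorm1 : \int[P]_w enorm (Z w) <= rd.
Proof.
have r0 := rd_gt0.
have i1 : P.-integrable setT (EFin \o (fun w => (2 * rd)^-1 * enorm (Z w) ^+ 2)).
  by apply: integrableZr; exact: gauss_enorm2_integrable.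
have e : \int[P]_w ((2 * rd)^-1 * enorm (Z w) ^+ 2 + rd / 2) = rd.
  rewrite RintegralD//; last exact: integrable_cstP.
  rewrite Rintegral_cstP RintegralZl//; last exact: gauss_enorm2_integrable.
  rewrite gauss_enorm2; move: rd_sqr r0; set r := Num.sqrt _ => <- r0.
  by field; rewrite gt_eqF.
rewrite -[leRHS]e; apply: le_Rintegral => //.
- exact: gauss_enorm_integrable.
- by apply: integrableDr => //; exact: integrable_cstP.
- move=> w _; rewrite -subr_ge0.
  have -> : (2 * rd)^-1 * enorm (Z w) ^+ 2 + rd / 2 - enorm (Z w) =
     (2 * rd)^-1 * (enorm (Z w) - rd) ^+ 2 by field; rewrite gt_eqF.
  by rewrite mulr_ge0 ?sqr_ge0// invr_ge0 mulr_ge0// ltW.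
Qed.

(** The bound of [mgf_pow_le] on the fourth moment of a standard normal variable. *)
Let c4 : R := 4`!%:R * (2 * expR (1 / 2)).

Lemma sqr_sum_le (v : 'cV[R]_d) : enorm v ^+ 4 <= d%:R * \sum_j `|v j 0| ^+ 4.
Proof.
pose u : 'cV[R]_d := \col_j (v j 0 ^+ 2); pose one : 'cV[R]_d := \col_j 1.
have e1 : dotv one u = enorm v ^+ 2.
  by rewrite enorm_sqr; apply: eq_bigr => j _; rewrite !mxE mul1r expr2.
have e2 : enorm one ^+ 2 = d%:R.
  rewrite enorm_sqr -[in RHS](card_ord d) -sum1_card natr_sum.
  by apply: eq_bigr => j _; rewrite !mxE mulr1.
have e3 : enorm u ^+ 2 = \sum_j `|v j 0| ^+ 4.
  rewrite enorm_sqr; apply: eq_bigr => j _; rewrite !mxE -exprD.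
  by rewrite -[v j 0 ^+ _](@ger0_norm _ _) ?normrX// (exprM _ 2 2) sqr_ge0.
rewrite -e2 -e3 -exprMn (exprM _ 2 2) lerXn2r ?nnegrE ?sqr_ge0//.
  by rewrite mulr_ge0 ?enorm_ge0.
by rewrite -e1 dotv_le.
Qed.

(** The third moment is interpolated between the second and the fourth by [x ^+ 3 <= rd / 2 * x ^+ 2
    + x ^+ 4 / (2 * rd)]. *)
Lemma gauss_enorm3 : P.-integrable setT (EFin \o (fun w => enorm (Z w) ^+ 3)) /\
  \int[P]_w (enorm (Z w) ^+ 3) <= (1 + c4) / 2 * rd ^+ 3.
Proof.
have r0 := rd_gt0.
pose g w := rd / 2 * enorm (Z w) ^+ 2 +
  (2 * rd)^-1 * (d%:R * \sum_j `|dotv (delta_mx j 0) (Z w)| ^+ 4).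
have is4 : P.-integrable setT (EFin \o (fun w => \sum_j `|dotv (delta_mx j 0) (Z w)| ^+ 4)).
  by apply: integrable_sumr => j; exact: gauss_dot_pow_integrable.
have ig : P.-integrable setT (EFin \o g).
  apply: integrableDr; first by apply: integrableZr; exact: gauss_enorm2_integrable.
  by do 2 apply: integrableZr.
have gle w : enorm (Z w) ^+ 3 <= g w.
  have := sqr_sum_le (Z w).
  under eq_bigr do rewrite coordE.
  rewrite /g; set S := d%:R * _; set x := enorm _ => h.
  apply: (@le_trans _ _ (rd / 2 * x ^+ 2 + (2 * rd)^-1 * x ^+ 4)); last first.
    by rewrite lerD2l ler_wpM2l// invr_ge0 mulr_ge0// ltW.
  rewrite -subr_ge0.
  have -> : rd / 2 * x ^+ 2 + (2 * rd)^-1 * x ^+ 4 - x ^+ 3 =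
    (2 * rd)^-1 * (x * (x - rd)) ^+ 2 by field; rewrite gt_eqF.
  by rewrite mulr_ge0 ?sqr_ge0// invr_ge0 mulr_ge0// ltW.
have i3 : P.-integrable setT (EFin \o (fun w => enorm (Z w) ^+ 3)).
  apply: (integrable_dom _ _ ig); first by apply: measurable_funX; exact: measurable_enorm.
  by move=> w; rewrite ger0_norm ?exprn_ge0 ?enorm_ge0.
split => //; apply: (@le_trans _ _ (\int[P]_w g w)); first exact: le_Rintegral.
rewrite RintegralD//; last 2 first.
- by apply: integrableZr; exact: gauss_enorm2_integrable.
- by do 2 apply: integrableZr.
rewrite !RintegralZl//; [|by apply: integrableZr|exact: gauss_enorm2_integrable].
rewrite gauss_enorm2 Rintegral_sum; last by move=> j; exact: gauss_dot_pow_integrable.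
have : \sum_(j < d) \int[P]_w (`|dotv (delta_mx j 0) (Z w)| ^+ 4) <= d%:R * c4.
  rewrite -[in leRHS](card_ord d) mulr_natl -sumr_const; apply: ler_sum => j _.
  have := mgf_pow_le (mdot (delta_mx j 0)) (mgf_dot (delta_mx j 0)) 4.
  by rewrite dotv_delta !mxE !eqxx.
set S := \sum_(j < d) _ => hS.
have -> : (1 + c4) / 2 * rd ^+ 3 = rd / 2 * d%:R + (2 * rd)^-1 * (d%:R * (d%:R * c4)).
  by move: rd_sqr r0; set r := Num.sqrt _ => <- r0; field; rewrite gt_eqF.
rewrite lerD2l ler_wpM2l ?invr_ge0 ?mulr_ge0 ?(ltW r0)//.
by rewrite ler_wpM2l.
Qed.

Lemma gauss_cov j k : \int[P]_w (Z w j 0 * Z w k 0) = (j == k)%:R.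
Proof.
pose u : 'cV[R]_d := delta_mx j 0; pose v : 'cV[R]_d := delta_mx k 0.
transitivity (\int[P]_w (2^-1 * (dotv (u + v) (Z w) ^+ 2 -
    (dotv u (Z w) ^+ 2 + dotv v (Z w) ^+ 2)))).
  by apply: eq_Rintegral => w _; rewrite !coordE dotvDl -/u -/v; field.
have iD : P.-integrable setT (EFin \o (fun w => dotv u (Z w) ^+ 2 + dotv v (Z w) ^+ 2)).
  by apply: integrableDr; exact: gauss_dot_sqr_integrable.
rewrite RintegralZl//; last by apply: integrableBr => //; exact: gauss_dot_sqr_integrable.
rewrite RintegralB//; last exact: gauss_dot_sqr_integrable.
rewrite RintegralD//; [|exact: gauss_dot_sqr_integrable..].
rewrite !gauss_dot_var dotvDl !dotvDr (dotvC v u) !dotv_delta !mxE !eqxx !andbT/= eq_sym.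
by field.
Qed.

Lemma gauss_standardized : standardized P Z ((1 + c4) / 2 * rd ^+ 3).
Proof.
have [i3 h3] := gauss_enorm3.
split => //; last exact: gauss_cov.
by move=> j; under eq_Rintegral do rewrite coordE; exact: gauss_dot_mean.
Qed.

(** Markov's inequality for the square. A tail [q] becomes a factor [q / (1 - q)] of the a priori
    error when the smoothing is undone, which is below 1 for [q < 1 / 2]. *)
Lemma gauss_enorm_tail : (P [set w | (2 * rd < enorm (Z w))%R] <= (1 / 4)%:E)%E.
Proof.
have r0 := rd_gt0.
have mA : measurable [set w | 2 * rd < enorm (Z w)].
  by apply: measurable_gt_cst; exact: measurable_enorm.
rewrite -[P _]mul1e -integral_cst//.
apply: (@le_trans _ _ (\int[P]_(w in [set w | (2 * rd < enorm (Z w))%R])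
   ((4 * d%:R)^-1 * enorm (Z w) ^+ 2)%:E)%E).
  apply: ge0_le_integral => //=.
  - apply: measurable_funTS; apply/measurable_EFinP; apply: measurable_funM => //.
    by apply: measurable_funX; exact: measurable_enorm.
  - move=> w hw; rewrite lee_fin; move: rd_sqr r0 hw; rewrite /=; set r := Num.sqrt _ => <- r0 hw.
    by rewrite mulrC ler_pdivlMr ?mulr_gt0 ?exprn_gt0// mul1r; nra.
apply: (@le_trans _ _ (\int[P]_w ((4 * d%:R)^-1 * enorm (Z w) ^+ 2)%:E)%E).
  apply: ge0_subset_integral => //=.
  - apply/measurable_EFinP; apply: measurable_funM => //.
    by apply: measurable_funX; exact: measurable_enorm.
  - by move=> w _; rewrite lee_fin mulr_ge0 ?invr_ge0 ?mulr_ge0 ?exprn_ge0 ?enorm_ge0.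
rewrite Rintegral_EFin; last by apply: integrableZr; exact: gauss_enorm2_integrable.
rewrite RintegralZl//; last exact: gauss_enorm2_integrable.
rewrite gauss_enorm2 lee_fin le_eqVlt; apply/orP; left; apply/eqP.
by move: rd_sqr r0; set r := Num.sqrt _ => <- r0; field; rewrite gt_eqF.
Qed.

End GaussianMoments.

(** * Third order remainder of the shifted Gaussian density *)

Section ScalarRemainder.
Context {R : realType}.
Implicit Types a k x : R.

Let rem a k : R := expR (a - k ^+ 2 / 2) - 1 - a - (a ^+ 2 - k ^+ 2) / 2.

(** Compares the expansion into Hermite polynomials with the Taylor expansion in [a - k ^+ 2 / 2];
    for [k <= 1] and [|a| = k * x] the correction is O(k^3 (x + 1)). *)
Let remE a k : rem a k = (expR (a - k ^+ 2 / 2) - 1 - (a - k ^+ 2 / 2)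
  - (a - k ^+ 2 / 2) ^+ 2 / 2) + (k ^+ 4 / 8 - a * k ^+ 2 / 2).
Proof. by rewrite /rem; field. Qed.

Lemma rem_small a k x : 0 <= k -> k <= 1 -> 0 <= x -> `|a| = k * x ->
  `|rem a k| <= 7 * expR 2 * k ^+ 3 * expR (2 * x).
Proof.
move=> k0 k1 x0 ax; rewrite remE.
have x1 : 0 <= x + 1 by lra.
have kk : k ^+ 2 <= k by rewrite expr2 ler_piMr.
have k3 : 0 <= k ^+ 3 by rewrite exprn_ge0.
have y1 : `|a - k ^+ 2 / 2| <= k * (x + 1).
  apply: le_trans (ler_normB _ _) _.
  by rewrite ax (ger0_norm (_ : 0 <= k ^+ 2 / 2)) ?divr_ge0 ?sqr_ge0//; nra.
have y2 : `|a - k ^+ 2 / 2| <= x + 1 by apply: le_trans y1 _; rewrite ler_piMl.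
have E : 7 * expR 2 * k ^+ 3 * expR (2 * x) = k ^+ 3 * (7 * (expR (x + 1) * expR (x + 1))).
  rewrite -expRD; have -> : x + 1 + (x + 1) = 2 + 2 * x by ring.
  by rewrite (expRD 2 (2 * x)); ring.
have e1 : x + 1 <= expR (x + 1) by have := expR_ge1Dx (x + 1); lra.
have e0 : 1 <= expR (x + 1) by rewrite -[leLHS]expR0 ler_expR.
have e3 : (x + 1) ^+ 3 <= 6 * expR (x + 1) by have := exprn_le_expR 3 x1.
rewrite E; apply: le_trans (ler_normD _ _) _.
have -> : k ^+ 3 * (7 * (expR (x + 1) * expR (x + 1))) =
  k ^+ 3 * (6 * expR (x + 1) * expR (x + 1)) + k ^+ 3 * (expR (x + 1) * expR (x + 1)) by ring.
apply: lerD.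
  apply: le_trans (expR_taylor3 _) _.
  apply: (@le_trans _ _ ((k * (x + 1)) ^+ 3 * expR (x + 1))).
    apply: ler_pM; rewrite ?exprn_ge0 ?expR_ge0 ?ler_expR//.
    by rewrite lerXn2r// nnegrE ?mulr_ge0.
  by rewrite exprMn -[leLHS]mulrA ler_wpM2l// ler_wpM2r ?expR_ge0.
apply: (@le_trans _ _ (k ^+ 3 * (x + 1))); last first.
  rewrite ler_wpM2l//; apply: le_trans e1 _; by rewrite ler_peMr// expR_ge0.
apply: le_trans (ler_normB _ _) _.
have k4 : 0 <= k ^+ 4 / 8 by rewrite divr_ge0 ?exprn_ge0.
have k22 : 0 <= k ^+ 2 / 2 by rewrite divr_ge0 ?sqr_ge0.
rewrite (ger0_norm k4) -mulrA (normrM a) ax (ger0_norm k22).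
have : k ^+ 4 <= k ^+ 3 by rewrite ler_wiXn2l.
have -> : k * x * (k ^+ 2 / 2) = k ^+ 3 * x / 2 by ring.
have : 0 <= k ^+ 3 * x by rewrite mulr_ge0.
lra.
Qed.

(** For [1 <= k] no cancellation has to be exploited: each polynomial term is at most [k ^+ 3] times
    a power of [x]. The exponential is kept, since it is a probability density in the
    application. *)
Lemma rem_large a k x : 1 <= k -> 0 <= x -> `|a| = k * x ->
  `|rem a k| <= expR (a - k ^+ 2 / 2) + 3 * k ^+ 3 * expR (2 * x).
Proof.
move=> k1 x0 ax; rewrite /rem.
have k0 : 0 <= k by lra.
have e1 : 1 + 2 * x <= expR (2 * x) by exact: expR_ge1Dx.
have e2 : (2 * x) ^+ 2 <= 2 * expR (2 * x) by apply: exprn_le_expR; lra.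
have e0 := expR_ge0 (a - k ^+ 2 / 2).
have a2 : a ^+ 2 = k ^+ 2 * x ^+ 2 by rewrite -real_normK ?num_real// ax exprMn.
have k2 : k <= k ^+ 2 by rewrite expr2 ler_peMr.
have k3 : k ^+ 2 <= k ^+ 3 by rewrite (exprS _ 2) ler_peMl// sqr_ge0.
have k31 : 1 <= k ^+ 3 by rewrite exprn_ege1.
have h1 : `|a| <= k ^+ 3 * x by rewrite ax ler_wpM2r//; lra.
have h2 : k ^+ 2 * x ^+ 2 <= k ^+ 3 * x ^+ 2 by rewrite ler_wpM2r// sqr_ge0.
have h3 : k ^+ 3 * (3 / 2 + x + x ^+ 2 / 2) <= k ^+ 3 * (3 * expR (2 * x)).
  by rewrite ler_wpM2l ?exprn_ge0//; nra.
have -> : 3 * k ^+ 3 * expR (2 * x) = k ^+ 3 * (3 * expR (2 * x)) by ring.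
move: h1; rewrite a2 ler_norml => /andP[h1 h1'].
have x2 : 0 <= k ^+ 2 * x ^+ 2 by rewrite mulr_ge0 ?sqr_ge0.
rewrite ler_norml; apply/andP; split; lra.
Qed.

End ScalarRemainder.

Section GaussianRemainder.
Context {R : realType} {d : nat} {dT : measure_display} {T : measurableType dT}.
Variables (P : probability T R) (Z : T -> 'cV[R]_d).
Hypothesis gZ : std_gaussian P Z.
Hypothesis d0 : (0 < d)%N.
Local Notation rd := (Num.sqrt d%:R : R).
Implicit Types u : 'cV[R]_d.

Let mZ : random_vector Z. Proof. by case: gZ. Qed.

(* Third order remainder in the expansion, in powers of [u], of the density
   of the shift by [u] of the standard Gaussian. *)
Definition rem (u z : 'cV[R]_d) : R := expR (dotv u z - dotv u u / 2) - 1 -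
  dotv u z - ((dotv u z) ^+ 2 - dotv u u) / 2.

Variables (al ga : R).
Hypotheses (al0 : 0 <= al) (ga0 : 0 <= ga).

Let wgt w : R := al * enorm (Z w) + ga.

Let wgt_ge0 w : 0 <= wgt w. Proof. by rewrite addr_ge0// mulr_ge0// enorm_ge0. Qed.

Let mwgt : measurable_fun setT wgt.
Proof.
apply: measurable_funD => //; apply: measurable_funM => //; exact: measurable_enorm.
Qed.

Let mtilt u : measurable_fun setT (fun w => expR (dotv u (Z w) - dotv u u / 2)).
Proof.
apply: (measurableT_comp (@measurable_expR R)); apply: measurable_funB => //.
by apply: measurable_dotv => // j.
Qed.

(** The exponential is the density of [Z + u] with respect to [Z], so that the left side is the mean
    of the weight at [Z + u]. *)
Lemma gauss_tilt u : (\int[P]_w (expR (dotv u (Z w) - dotv u u / 2) * wgt w)%:E <=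
  (al * (rd + enorm u) + ga)%:E)%E.
Proof.
pose f (z : 'cV[R]_d) : \bar R := (al * enorm z + ga)%:E.
have nf : nmeas f.
  split => [dU U Y mY|z]; last by rewrite lee_fin addr_ge0// mulr_ge0// enorm_ge0.
  apply/measurable_EFinP; apply: measurable_funD => //.
  by apply: measurable_funM => //; exact: measurable_enorm.
have -> : (\int[P]_w (expR (dotv u (Z w) - dotv u u / 2) * wgt w)%:E =
    \int[P]_w f (Z w + u)%R)%E.
  rewrite (CameronMartin gZ u nf); apply: eq_integral => w _.
  by rewrite /f -EFinM mulrC.
have i1 : P.-integrable setT (EFin \o (fun w => al * enorm (Z w) + (al * enorm u + ga))).
  apply: integrableDr; last exact: integrable_cstP.
  by apply: integrableZr; exact: gauss_enorm_integrable.
apply: (@le_trans _ _ (\int[P]_w (al * enorm (Z w) + (al * enorm u + ga))%:E)%E).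
  apply: ge0_le_integral => //.
  - by move=> w _; exact: nf.2.
  - by apply: nf.1; exact: random_vectorD.
  - by case/integrableP : i1.
  - move=> w _; rewrite lee_fin addrA lerD2r -mulrDr ler_wpM2l//; exact: ler_enormD.
rewrite Rintegral_EFin// lee_fin RintegralD//; last 2 first.
- by apply: integrableZr; exact: gauss_enorm_integrable.
- exact: integrable_cstP.
rewrite RintegralZl//; last exact: gauss_enorm_integrable.
rewrite Rintegral_cstP addrA lerD2r mulrDr lerD2r ler_wpM2l//.
exact: gauss_enorm1.
Qed.

(** The 2 pays for the density itself when [enorm u > 1]. In 42 the factor 7 comes from [rem_small]
    and 6 from the two tilted weights; one [expR 2] comes from [rem_small] and one from normalizing
    the tilts. *)
Definition Krem : R := 2 + 42 * expR 4.

Lemma Krem_gt0 : 0 < Krem.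
Proof. by rewrite /Krem; have := expR_gt0 (4 : R); lra. Qed.

(** With [v = u / |u|], the factor exp(2 |<v, Z>|) in the pointwise bounds is dominated by the
    densities of the shifts by [2 *: v] and [- 2 *: v], so that every term falls under
    [gauss_tilt]. *)
Lemma gauss_rem u : (\int[P]_w (`|rem u (Z w)| * wgt w)%:E <=
  (Krem * enorm u ^+ 3 * (al * rd + ga))%:E)%E.
Proof.
have rd1 : 1 <= rd by exact: rd_ge1.
have C0 : 0 <= al * rd + ga by rewrite addr_ge0 ?mulr_ge0//; lra.
have [u0|uN0] := eqVneq u 0.
  rewrite u0 enorm0 expr0n/= mulr0 mul0r (eq_integral (fun=> 0%E)) ?integral0//.
  move=> w _; rewrite /rem !dot0v mul0r subrr expR0 subrr expr0n/= !subrr mul0r subrr.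
  by rewrite normr0 mul0r.
have k0 : 0 < enorm u by exact: enorm_gt0.
set k := enorm u in k0 *.
have [v vv uv] : exists2 v, dotv v v = 1 & forall z, dotv u z = k * dotv v z.
  exists (k^-1 *: u) => [|z].
    by rewrite dotvZl dotvZr -enorm_sqr -/k; field; rewrite gt_eqF.
  by rewrite dotvZl mulVKf// gt_eqF.
have uu : dotv u u = k ^+ 2 by rewrite -enorm_sqr.
have ax z : `|dotv u z| = k * `|dotv v z| by rewrite uv normrM gtr0_norm.
pose t s w := expR (dotv (s *: v) (Z w) - dotv (s *: v) (s *: v) / 2).
have tE s w : s ^+ 2 = 4 -> t s w = expR (s * dotv v (Z w)) / expR 2.
  by move=> s4; rewrite /t !dotvZl dotvZr vv mulr1 -expr2 s4 -expRB; congr (expR (_ - _)); field.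
have t2 w : expR (2 * `|dotv v (Z w)|) <= expR 2 * (t 2 w + t (- 2) w).
  have e : t 2 w + t (- 2) w = (expR (2 * dotv v (Z w)) + expR (- 2 * dotv v (Z w))) / expR 2.
    by rewrite !tE ?mulrDl//; ring.
  rewrite e [leRHS]mulrC divfK ?gt_eqF ?expR_gt0// mulNr.
  by rewrite -{1}(ger0_norm (_ : 0 <= 2))// -normrM expR_norm_le.
pose c := if k <= 1 then 0 else 1 : R.
pose C := 7 * expR 2 * expR 2 * k ^+ 3.
have C00 : 0 <= C by rewrite !mulr_ge0 ?expR_ge0 ?exprn_ge0 ?ltW.
have k3 : 0 <= k ^+ 3 by rewrite exprn_ge0// ltW.
have c7 : 0 <= 7 * expR 2 * k ^+ 3.
  by apply: mulr_ge0 => //; apply: mulr_ge0 => //; exact: expR_ge0.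
have ge1 (a : R) : 0 <= a -> 1 <= expR a by move=> a0; rewrite -[leLHS]expR0 ler_expR.
have e2 : 1 <= expR 2 :> R by exact: ge1.
have bound w : `|rem u (Z w)| <= c * expR (dotv u (Z w) - dotv u u / 2) + C * (t 2 w + t (-2) w).
  have t2w := t2 w; rewrite /rem uu; have [k1|k1] := leP k 1.
    rewrite /c k1 mul0r add0r; apply: le_trans (rem_small (ltW k0) k1 (normr_ge0 _) (ax _)) _.
    rewrite /C; set X := expR (2 * _) in t2w *; set Y := t _ _ + _ in t2w *.
    have -> : 7 * expR 2 * expR 2 * k ^+ 3 * Y = 7 * expR 2 * k ^+ 3 * (expR 2 * Y) by ring.
    exact: ler_wpM2l.
  rewrite /c (leNgt k 1) k1/= mul1r.
  apply: le_trans (rem_large (ltW k1) (normr_ge0 _) (ax _)) _; rewrite lerD2l.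
  rewrite /C; set X := expR (2 * _) in t2w *; set Y := t _ _ + _ in t2w *.
  have -> : 7 * expR 2 * expR 2 * k ^+ 3 * Y = 7 * expR 2 * k ^+ 3 * (expR 2 * Y) by ring.
  apply: (@le_trans _ _ (7 * expR 2 * k ^+ 3 * X)).
    by rewrite ler_wpM2r ?expR_ge0// ler_wpM2r//; lra.
  exact: ler_wpM2l.
have mt s : measurable_fun setT (fun w => (t s w * wgt w)%:E).
  by apply/measurable_EFinP; apply: measurable_funM => //; exact: mtilt.
have t0 s w : (0 <= (t s w * wgt w)%:E)%E by rewrite lee_fin mulr_ge0 ?expR_ge0.
have c0 : 0 <= c by rewrite /c; case: ifP.
have m0 : measurable_fun setT (fun w => (expR (dotv u (Z w) - dotv u u / 2) * wgt w)%:E).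
  by apply/measurable_EFinP; apply: measurable_funM => //; exact: mtilt.
have t00 w : (0 <= (expR (dotv u (Z w) - dotv u u / 2) * wgt w)%:E)%E.
  by rewrite lee_fin mulr_ge0 ?expR_ge0.
apply: (@le_trans _ _ (\int[P]_w (c%:E * (expR (dotv u (Z w) - dotv u u / 2) * wgt w)%:E +
    (C%:E * ((t 2 w * wgt w)%:E + (t (- 2) w * wgt w)%:E))))%E).
  apply: ge0_le_integral => //.
  - by move=> w _; rewrite lee_fin mulr_ge0.
  - apply/measurable_EFinP; apply: measurable_funM => //; apply: measurableT_comp => //.
    have md : measurable_fun setT (fun w => dotv u (Z w)) by apply: measurable_dotv => // j.
    apply: measurable_funB; last first.
      apply: measurable_funM => //; apply: measurable_funB => //.
      exact: measurable_funX.
    apply: measurable_funB => //; apply: measurable_funB => //; exact: mtilt.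
  - apply: emeasurable_funD; apply: measurable_funeM => //; exact: emeasurable_funD.
  - move=> w _; suff : `|rem u (Z w)| * wgt w <=
      c * (expR (dotv u (Z w) - dotv u u / 2) * wgt w) +
      C * (t 2 w * wgt w + t (- 2) w * wgt w) by rewrite -lee_fin.
    have -> : c * (expR (dotv u (Z w) - dotv u u / 2) * wgt w) +
      C * (t 2 w * wgt w + t (- 2) w * wgt w) =
      (c * expR (dotv u (Z w) - dotv u u / 2) + C * (t 2 w + t (-2) w)) * wgt w by ring.
    by rewrite ler_wpM2r.
rewrite ge0_integralD//; last 4 first.
- by move=> w _; rewrite mule_ge0.
- exact: measurable_funeM.
- by move=> w _; rewrite mule_ge0// adde_ge0.
- by apply: measurable_funeM; exact: emeasurable_funD.
rewrite ge0_integralZl_EFin// ge0_integralZl_EFin//; last 2 first.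
- by move=> w _; rewrite adde_ge0.
- exact: emeasurable_funD.
rewrite ge0_integralD//.
have n2 s : `|s| = 2 -> enorm (s *: v) = 2.
  by move=> s2; rewrite enormZ s2 /enorm vv sqrtr1 mulr1.
have b1 := gauss_tilt u.
have b2 := gauss_tilt (2 *: v); rewrite n2 ?normr_nat// in b2.
have b3 := gauss_tilt (- 2 *: v); rewrite n2 ?normrN ?normr_nat// in b3.
have ik : forall x : \bar R, (x <= (al * (rd + k) + ga)%:E)%E -> (c%:E * x <= (2 * k ^+ 3 * (al * rd + ga))%:E)%E.
  move=> x hx; rewrite /c; case: (leP k 1) => k1.
    by rewrite mul0e lee_fin mulr_ge0// mulr_ge0.
  rewrite mul1e; apply: le_trans hx _; rewrite lee_fin.
  have k32 : k <= k ^+ 3 by rewrite (exprS _ 2) ler_peMr ?exprn_ege1 ?ltW.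
  apply: (@le_trans _ _ (2 * k * (al * rd + ga))); last first.
    by rewrite ler_wpM2r// ler_wpM2l.
  have k1' := ltW k1; have k0' := ltW k0.
  have rd0 : 0 <= rd by lra.
  have p0 : 0 <= al * rd by rewrite mulr_ge0.
  have p1 : 0 <= al * k by rewrite mulr_ge0.
  have p2 : al * k <= al * k * rd by rewrite ler_peMr.
  have p3 : al * rd <= k * (al * rd) by rewrite ler_peMl.
  have p4 : ga <= k * ga by rewrite ler_peMl.
  have -> : 2 * k * (al * rd + ga) = al * k * rd + k * (al * rd) + 2 * (k * ga) by ring.
  rewrite mulrDr; move: (al * k * rd) (k * (al * rd)) (k * ga) p2 p3 p4 => X1 X2 X3 p2 p3 p4.
  have -> : X1 + X2 + 2 * X3 = X2 + X1 + X3 + X3 by ring.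
  rewrite -[leLHS]addr0 lerD//; last exact: le_trans ga0 p4.
  by rewrite lerD// lerD.
apply: le_trans (leeD (ik _ b1) (lee_wpmul2l _ (leeD b2 b3))) _; first by rewrite lee_fin.
suff : 2 * k ^+ 3 * (al * rd + ga) +
    C * (al * (rd + 2) + ga + (al * (rd + 2) + ga)) <= Krem * k ^+ 3 * (al * rd + ga).
  by rewrite -lee_fin.
have e4 : expR 4 = expR 2 * expR 2 :> R by rewrite -expRD; congr expR; ring.
have h : al * (rd + 2) + ga + (al * (rd + 2) + ga) <= 6 * (al * rd + ga).
  have -> : 6 * (al * rd + ga) = 2 * (al * rd + ga) + 4 * (al * rd) + 4 * ga by ring.
  have -> : al * (rd + 2) + ga + (al * (rd + 2) + ga) =
    2 * (al * rd + ga) + 4 * al + 0 by ring.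
  by rewrite !lerD ?mulr_ge0// ler_pM2l// ler_peMr.
have := ler_wpM2l C00 h; rewrite /Krem e4 /C.
set E := expR 2; set A := al * rd + ga; set B := _ + _ => {}h.
have -> : (2 + 42 * (E * E)) * k ^+ 3 * A = 2 * k ^+ 3 * A + 7 * E * E * k ^+ 3 * (6 * A) by ring.
by rewrite lerD2l.
Qed.

End GaussianRemainder.

(** * Shells around level sets *)

Lemma Rintegral_indicP (R : realType) dT (T : measurableType dT)
    (P : probability T R) (A : set T) : measurable A ->
  \int[P]_w \1_A w = fine (P A).
Proof. by move=> mA; rewrite /Rintegral integral_indic// setIT. Qed.

Section ScalarConvex.
Context {R : realType}.
Implicit Types u y a b : R.

(** A smooth, convex, nondecreasing version of twice the positive part, with curvature bounded below
    on [-1, 1]. *)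
Definition gam u : R := Num.sqrt (1 + u ^+ 2) + u.

Let rt u : R := Num.sqrt (1 + u ^+ 2).

Let rt_sqr u : rt u ^+ 2 = 1 + u ^+ 2.
Proof. by rewrite sqr_sqrtr// addr_ge0// sqr_ge0. Qed.

Let rt_ge1 u : 1 <= rt u.
Proof. by rewrite -[leLHS]sqrtr1 ler_wsqrtr// lerDl sqr_ge0. Qed.

Let rt_norm u : `|u| <= rt u.
Proof. by rewrite -sqrtr_sqr ler_wsqrtr// lerDr. Qed.

Lemma gam_ge0 u : 0 <= gam u.
Proof. by have := rt_norm u; rewrite ler_norml /gam -/(rt u) => /andP[h _]; lra. Qed.

Let rt_lip a b : `|rt a - rt b| <= `|a - b|.
Proof.
have h : (rt a - rt b) * (rt a + rt b) = (a - b) * (a + b).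
  by have := rt_sqr a; have := rt_sqr b; nra.
have s0 : 0 < rt a + rt b by have := rt_ge1 a; have := rt_ge1 b; lra.
rewrite -(ler_pM2r s0) -{1}(gtr0_norm s0) -normrM h normrM ler_wpM2l//.
by apply: le_trans (ler_normD _ _) _; apply: lerD; exact: rt_norm.
Qed.

Lemma gam_lip a b : `|gam a - gam b| <= 2 * `|a - b|.
Proof.
have -> : gam a - gam b = (rt a - rt b) + (a - b) by rewrite /gam -!/(rt _); ring.
by apply: le_trans (ler_normD _ _) _; have := rt_lip a b; lra.
Qed.

Lemma gam_mono a b : a <= b -> gam a <= gam b.
Proof.
move=> ab; have := rt_lip a b; rewrite (ler0_norm (_ : a - b <= 0)) ?subr_le0//.
by rewrite ler_norml /gam -!/(rt _) => /andP[_ h]; lra.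
Qed.

(** [c] is the slope at [u]. For [|u| <= 1] and [|y| < 1] the excess over the tangent is at least
    [y ^+ 2 / 12]. The fourth power makes the claimed gain nonpositive for larger [y], which gives
    one inequality for all [y] that can be integrated against a normal law. *)
Lemma gam_gain u : exists c, forall y,
  gam u + c * y + (if `|u| <= 1 then 12^-1 * (y ^+ 2 - `|y| ^+ 4) else 0) <= gam (u + y).
Proof.
have A1 := rt_ge1 u; set A := rt u in A1.
have A0 : 0 < A by lra.
pose t := u / A; exists (1 + t) => y.
have tA : t * A = u by rewrite /t divfK// gt_eqF.
have A2 : A ^+ 2 = 1 + u ^+ 2 := rt_sqr u.
have B0 : 0 <= rt (u + y) by have := rt_ge1 (u + y); lra.
have B2 := rt_sqr (u + y).
rewrite /gam -!/(rt _) -/A; set B := rt (u + y) in B0 B2 *.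
have qB : B ^+ 2 - (A + t * y) ^+ 2 = y ^+ 2 * (1 - t ^+ 2).
  have -> : (A + t * y) ^+ 2 = A ^+ 2 + 2 * (t * A) * y + t ^+ 2 * y ^+ 2 by ring.
  by rewrite B2 A2 tA; ring.
have At : A ^+ 2 * (1 - t ^+ 2) = 1 by rewrite mulrBr mulr1 -exprMn (mulrC A) tA A2; ring.
have t1 : 0 < 1 - t ^+ 2 by rewrite -(pmulr_rgt0 _ (_ : 0 < A ^+ 2)) ?exprn_gt0// At.
have qle : `|A + t * y| <= B.
  rewrite -(ler_pXn2r (ltn0Sn 1)) ?nnegrE// real_normK ?num_real// -subr_ge0 qB.
  by rewrite mulr_ge0 ?sqr_ge0// ltW.
have := qle; rewrite ler_norml => /andP[q1 q2].
have [u1|_] := boolP (`|u| <= 1); last by rewrite addr0; lra.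
have u2 : u ^+ 2 <= 1 by rewrite -real_normK ?num_real// exprn_ile1.
have t2 : 2^-1 <= 1 - t ^+ 2.
  by rewrite -(ler_pM2l (_ : 0 < A ^+ 2)) ?exprn_gt0// At A2; lra.
have y4 : `|y| ^+ 4 = (y ^+ 2) ^+ 2 by rewrite -(real_normK (num_real y)) -exprM.
have [y1|y1] := leP 1 `|y|.
  have : 1 <= y ^+ 2 by rewrite -real_normK ?num_real// exprn_ege1.
  rewrite y4; set Y := y ^+ 2 => Y1.
  have Y2 : Y <= Y ^+ 2 by rewrite expr2 ler_peMr// sqr_ge0.
  lra.
have B3 : B <= 3.
  rewrite -(ler_pXn2r (ltn0Sn 1)) ?nnegrE// B2.
  have : `|u + y| <= 2 by apply: le_trans (ler_normD _ _) _; lra.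
  by rewrite -[(u + y) ^+ 2]real_normK ?num_real//; have := normr_ge0 (u + y); nra.
have hD : (B - (A + t * y)) * (B + (A + t * y)) = y ^+ 2 * (1 - t ^+ 2) by rewrite -qB; ring.
have h1 : y ^+ 2 * 2^-1 <= y ^+ 2 * (1 - t ^+ 2) by rewrite ler_wpM2l// sqr_ge0.
have h2 : (B - (A + t * y)) * (B + (A + t * y)) <= (B - (A + t * y)) * 6.
  by rewrite ler_wpM2l//; lra.
have y40 : 0 <= `|y| ^+ 4 by rewrite exprn_ge0.
lra.
Qed.

End ScalarConvex.

Section UnitConvex.
Context {R : realType} {d : nat}.
Implicit Types (rho : 'cV[R]_d -> R) (v : 'cV[R]_d).

(* Suprema of families of affine functions with unit gradient, such as signed
   distances to convex sets. *)
Definition unit_convex rho : Prop :=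
  (forall x y, `|rho x - rho y| <= enorm (x - y)) /\
  forall x e, 0 < e -> exists2 p, enorm p = 1 &
    forall y, rho x + dotv p (y - x) - e <= rho y.

Lemma unit_convex_shift rho v : unit_convex rho -> unit_convex (fun x => rho (v + x)).
Proof.
move=> [lip sup]; split=> [x y|x e e0].
  by apply: le_trans (lip _ _) _; rewrite opprD addrACA subrr add0r.
have [p p1 h] := sup (v + x) e e0; exists p => // y.
by have := h (v + y); rewrite opprD addrACA subrr add0r.
Qed.

Lemma unit_convexB rho c : unit_convex rho -> unit_convex (fun x => rho x - c).
Proof.
move=> [lip sup]; split=> [x y|x e e0].
  by rewrite opprB addrA subrK; exact: lip.
have [p p1 h] := sup x e e0; exists p => // y; have := h y; lra.
Qed.

Lemma unit_convex_scale rho a : 0 < a -> unit_convex rho ->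
  unit_convex (fun x => a * rho (a^-1 *: x)).
Proof.
move=> a0 [lip sup]; have aV : 0 < a^-1 by rewrite invr_gt0.
split=> [x y|x e e0].
  rewrite -mulrBr normrM (gtr0_norm a0); apply: le_trans (ler_wpM2l (ltW a0) (lip _ _)) _.
  by rewrite -scalerBr enormZ (gtr0_norm aV) mulrA mulfV ?gt_eqF// mul1r.
have [p p1 h] := sup (a^-1 *: x) (e / a) ltac:(by rewrite divr_gt0).
exists p => // y; have := ler_wpM2l (ltW a0) (h (a^-1 *: y)).
rewrite -scalerBr dotvZr mulrBr mulrDr !mulrA mulfV ?gt_eqF// mul1r.
by rewrite mulrAC mulfV ?gt_eqF// mul1r.
Qed.

Lemma unit_convex_vmeas rho : unit_convex rho -> vmeas (EFin \o rho).
Proof. by move=> [lip _]; exact: vmeas_lipschitz. Qed.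

End UnitConvex.

Section Shell.
Context {R : realType} {d : nat} {dT : measure_display} {T : measurableType dT}.
Variables (P : probability T R) (Z : T -> 'cV[R]_d).
Hypothesis gZ : std_gaussian P Z.
Hypothesis d0 : (0 < d)%N.
Local Notation rd := (Num.sqrt d%:R : R).

Let mZ : random_vector Z. Proof. by case: gZ. Qed.

Let c4 : R := 4`!%:R * (2 * expR (1 / 2)).

Let c4_ge1 : 1 <= c4.
Proof.
have : 1 <= expR (1 / 2) :> R by rewrite -[leLHS]expR0 ler_expR.
by rewrite /c4 (_ : 4`! = 24)%N//; lra.
Qed.

Let F (rho : 'cV[R]_d -> R) r x : \bar R := (gam (r^-1 * rho x))%:E.

Let nF rho r : unit_convex rho -> nmeas (F rho r).
Proof.
move=> ur; split=> [|x]; last by rewrite lee_fin gam_ge0.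
have mg : measurable_fun setT (fun t => gam (r^-1 * t)).
  have m1 : measurable_fun setT (fun t : R => r^-1 * t) by exact: mulrl_measurable.
  apply: measurable_funD => //.
  have ms : measurable_fun setT (@Num.sqrt R).
    by apply: continuous_measurable_fun; exact: sqrt_continuous.
  apply: (measurableT_comp ms); apply: measurable_funD => //.
  exact: measurable_funX.
exact: (vmeas_comp_real mg (unit_convex_vmeas ur)).
Qed.

(** With an approximate subgradient [p] of [rho] at [x], [gam_gain] is integrated at
    [y = s / r * <p, Z>]. The linear term has mean 0; since [p] is a unit vector, the quadratic one
    has mean [(s / r) ^+ 2 / 12], and the fourth moment costs at most half of it. *)
Let smooth_gain rho r s x : unit_convex rho -> 0 < r -> 0 < s ->
  (s / r) ^+ 2 * c4 <= 1 / 2 ->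
  ((gam (r^-1 * rho x) + (if `|r^-1 * rho x| <= 1 then (s / r) ^+ 2 / 24 else 0))%:E <=
    \int[P]_w F rho r (x + s *: Z w)%R)%E.
Proof.
move=> ur r0 s0 hs; have rV : 0 < r^-1 by rewrite invr_gt0.
have [lip sup] := ur.
set u := r^-1 * rho x; have [c hc] := gam_gain u.
have sr0 : 0 < s / r by rewrite divr_gt0.
have mG : measurable_fun setT (fun w => gam (r^-1 * rho (x + s *: Z w))).
  by apply/measurable_EFinP; apply: (nF r ur).1; apply: random_vectorD => //; exact: random_vectorZ.
have iG : P.-integrable setT (EFin \o (fun w => gam (r^-1 * rho (x + s *: Z w)))).
  apply: (@integrable_dom _ _ _ _ _ (fun w => gam u + 2 * r^-1 * s * enorm (Z w))) => //.
    move=> w; rewrite ger0_norm ?gam_ge0//.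
    have := gam_lip (r^-1 * rho (x + s *: Z w)) u.
    rewrite ler_norml => /andP[_ h]; rewrite -lerBlDl; apply: le_trans h _.
    rewrite -!mulrA ler_pM2l// -mulrBr normrM (gtr0_norm rV) ler_pM2l//.
    by apply: le_trans (lip _ _) _; rewrite addrC addKr enormZ gtr0_norm.
  apply: integrableDr; first exact: integrable_cstP.
  by apply: integrableZr; exact: gauss_enorm_integrable.
rewrite Rintegral_EFin// lee_fin.
apply/ler_addgt0Pr => e e0.
(* Divided by [r] and passed through [gam], which is 2-Lipschitz, this error becomes [e]. *)
have [p p1 hp] := sup x (r * e / 2) ltac:(by rewrite divr_gt0// mulr_gt0).
pose N w := dotv p (Z w).
have pp : dotv p p = 1 by rewrite -enorm_sqr p1 expr1n.
have iN : P.-integrable setT (EFin \o N).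
  have := gauss_dot_pow_integrable gZ p 1 => h.
  by apply: (integrable_dom _ _ h) => //; apply: measurable_dotv => // j.
have iN2 := gauss_dot_sqr_integrable gZ p.
have iN4 := gauss_dot_pow_integrable gZ p 4.
pose k : R := if `|u| <= 1 then 12^-1 else 0.
have k0 : 0 <= k by rewrite /k; case: ifP.
pose g w := (gam u - e) + c * (s / r) * N w +
  ((k * (s / r) ^+ 2) * (N w ^+ 2) - (k * (s / r) ^+ 4) * `|N w| ^+ 4).
have i1 : P.-integrable setT (EFin \o (fun w => (gam u - e) + c * (s / r) * N w)).
  by apply: integrableDr; [exact: integrable_cstP|exact: integrableZr].
have i2 : P.-integrable setT (EFin \o (fun w =>
   (k * (s / r) ^+ 2) * (N w ^+ 2) - (k * (s / r) ^+ 4) * `|N w| ^+ 4)).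
  by apply: integrableBr; exact: integrableZr.
have gE : \int[P]_w g w = gam u - e + (k * (s / r) ^+ 2 -
    (k * (s / r) ^+ 4) * \int[P]_w (`|N w| ^+ 4)).
  rewrite RintegralD// RintegralD//; [|exact: integrable_cstP|exact: integrableZr].
  rewrite Rintegral_cstP RintegralZl// gauss_dot_mean// mulr0 addr0.
  rewrite RintegralB//; [|exact: integrableZr|exact: integrableZr].
  by rewrite !RintegralZl// gauss_dot_var// pp mulr1.
have N4 : \int[P]_w (`|N w| ^+ 4) <= c4.
  have mgf s' : (\int[P]_w (expR (s' * N w))%:E = (expR (s' ^+ 2 * 1 / 2))%:E)%E.
    have := gauss_mgf gZ (s' *: p); rewrite !dotvZl dotvZr pp => h.
    under eq_integral do rewrite -dotvZl.
    by rewrite h; congr (expR _)%:E; ring.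
  have mN : measurable_fun setT N by apply: measurable_dotv => // j.
  exact: (mgf_pow_le mN mgf 4).
have gle : \int[P]_w g w <= \int[P]_w gam (r^-1 * rho (x + s *: Z w)).
  apply: le_Rintegral => //; first exact: integrableDr.
  move=> w _; rewrite /g.
  have h1 : u + s / r * N w - e / 2 <= r^-1 * rho (x + s *: Z w).
    have := hp (x + s *: Z w); rewrite [x + _]addrC addrK dotvZr -/(N w) => h.
    have := ler_wpM2l (ltW rV) h; apply: le_trans.
    rewrite /u le_eqVlt; apply/orP; left; apply/eqP.
    by field; rewrite gt_eqF.
  have := gam_mono h1; apply: le_trans.
  have := gam_lip (u + s / r * N w) (u + s / r * N w - e / 2).
  have -> : u + s / r * N w - (u + s / r * N w - e / 2) = e / 2 by ring.
  rewrite (gtr0_norm (_ : 0 < e / 2)) ?divr_gt0//.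
  rewrite ler_norml => /andP[_ h2].
  have := hc (s / r * N w).
  have -> : (if `|u| <= 1 then 12^-1 * ((s / r * N w) ^+ 2 - `|s / r * N w| ^+ 4) else 0) =
     (k * (s / r) ^+ 2) * (N w ^+ 2) - (k * (s / r) ^+ 4) * `|N w| ^+ 4.
    rewrite /k; case: ifP => _; last by rewrite !mul0r subrr.
    by rewrite normrM (gtr0_norm sr0) !exprMn; ring.
  lra.
apply: (@le_trans _ _ (\int[P]_w g w + e)); last by rewrite lerD2r.
rewrite gE.
have -> : (if `|u| <= 1 then (s / r) ^+ 2 / 24 else 0) = k * (s / r) ^+ 2 / 2.
  by rewrite /k; move: ((s / r) ^+ 2) => q; case: ifP => _; [field|rewrite !mul0r].
have h4 : (k * (s / r) ^+ 4) * \int[P]_w (`|N w| ^+ 4) <= k * (s / r) ^+ 2 / 2.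
  apply: (@le_trans _ _ ((k * (s / r) ^+ 4) * c4)).
    by rewrite ler_wpM2l// mulr_ge0// exprn_ge0// ltW.
  have -> : k * (s / r) ^+ 4 * c4 = k * (s / r) ^+ 2 * ((s / r) ^+ 2 * c4) by ring.
  have -> : k * (s / r) ^+ 2 / 2 = k * (s / r) ^+ 2 * (1 / 2) by ring.
  by rewrite ler_wpM2l// mulr_ge0// sqr_ge0.
lra.
Qed.

(* Trading a small part of the variance of [Z] for an independent copy leaves
   the mean of [gam (rho Z / r)] unchanged up to the Lipschitz error, while the
   curvature of [gam] on [-1, 1] makes it grow by a multiple of the probability
   of the shell. *)
Lemma gauss_shell rho r : unit_convex rho -> 0 < r ->
  (P [set w | (`|rho (Z w)| <= r)%R] <= (48 * rd * r)%:E)%E.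
Proof.
move=> ur r0; have rd1 : 1 <= rd by exact: rd_ge1.
have mA : measurable [set w | (`|rho (Z w)| <= r)%R].
  apply: measurable_le_cst; apply: measurableT_comp => //.
  by apply/measurable_EFinP; exact: (unit_convex_vmeas ur).
have [r1|r1] := leP 1 r.
  apply: le_trans (probability_le1 _ mA) _; rewrite lee_fin.
  have h : 1 <= rd * r by rewrite mulr_ege1.
  have -> : 48 * rd * r = 48 * (rd * r) by ring.
  lra.
(* The largest [s] that [smooth_gain] admits: [(s / r) ^+ 2 * c4 = 1 / 2]. *)
pose s := Num.sqrt (r ^+ 2 / (2 * c4)).
have c40 : 0 < 2 * c4 by have := c4_ge1; lra.
have s2 : s ^+ 2 = r ^+ 2 / (2 * c4) by rewrite sqr_sqrtr// divr_ge0 ?sqr_ge0// ltW.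
have s0 : 0 < s by rewrite sqrtr_gt0 divr_gt0// exprn_gt0.
have s1 : s ^+ 2 <= 1 / 2.
  have r2 : r ^+ 2 <= 1 by rewrite exprn_ile1// ltW.
  by rewrite s2 ler_pdivrMr//; have := c4_ge1; lra.
pose c := Num.sqrt (1 - s ^+ 2).
have c2 : c ^+ 2 = 1 - s ^+ 2 by rewrite sqr_sqrtr//; lra.
have c0 : 0 < c by rewrite sqrtr_gt0; lra.
have c1 : c <= 1.
  by rewrite -(ler_pXn2r (ltn0Sn 1)) ?nnegrE ?(ltW c0)// c2 expr1n lerBlDr lerDl sqr_ge0.
have cs : 1 - c <= s ^+ 2.
  have -> : s ^+ 2 = 1 - c ^+ 2 by rewrite c2; ring.
  have -> : 1 - c ^+ 2 = (1 - c) * (1 + c) by ring.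
  by rewrite ler_peMr ?subr_ge0// lerDl ltW.
have hs : (s / r) ^+ 2 * c4 <= 1 / 2.
  by rewrite exprMn s2 le_eqVlt; apply/orP; left; apply/eqP; field; rewrite !gt_eqF//; lra.
(* Rescaled so that [c *: Z] lies in the shell of [rho'] whenever [Z] lies in that of [rho]. *)
pose rho' x := c * rho (c^-1 *: x).
have ur' : unit_convex rho' by exact: unit_convex_scale.
have rho'E w : rho' (c *: Z w) = c * rho (Z w).
  by rewrite /rho' scalerA mulVf ?gt_eqF// scale1r.
have [lip _] := ur'.
pose k := (s / r) ^+ 2 / 24.
have k0 : 0 < k by rewrite divr_gt0// exprn_gt0// divr_gt0.
pose A := [set w | (`|rho (Z w)| <= r)%R].
have rV : 0 < r^-1 by rewrite invr_gt0.
have low : (\int[P]_w (F rho' r (c *: Z w) + (k * \1_A w)%:E) <=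
    \int[P]_w F rho' r (Z w))%E.
  have := gauss_semigroup gZ 0 (nF r ur') (ltW c0) (ltW s0) ler01.
  rewrite c2 subrK expr1n => /(_ erefl); rewrite /op.
  under [RHS]eq_integral do rewrite add0r scale1r.
  move=> <-; apply: ge0_le_integral => //.
  - move=> w _; apply: adde_ge0; first exact: (nF r ur').2.
    by rewrite lee_fin mulr_ge0 ?(ltW k0).
  - apply: emeasurable_funD; first by apply: (nF r ur').1; exact: random_vectorZ.
    by apply/measurable_EFinP; apply: measurable_funM => //; exact: measurable_indic.
  - have nop : nmeas (op P (fun w => s *: Z w) (F rho' r)).
      by apply: nmeas_op; [exact: random_vectorZ|exact: nF].
    by apply: (nmeas_measurable 0 nop); exact: random_vectorZ.
  - move=> w _; rewrite add0r; apply: le_trans (smooth_gain (c *: Z w) ur' r0 s0 hs).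
    rewrite -EFinD lee_fin lerD2l rho'E indicE.
    have [|_] := boolP (w \in A); last by rewrite mulr0; case: ifP => // _; rewrite ltW.
    rewrite inE mulr1 => wA; rewrite ifT// !normrM (gtr0_norm rV) (gtr0_norm c0).
    apply: (@le_trans _ _ (r^-1 * (1 * r))); last by rewrite mul1r mulVf// gt_eqF.
    by rewrite ler_pM2l// ler_pM// ltW.
have gl a b : gam (r^-1 * rho' a) <= gam (r^-1 * rho' b) + 2 * r^-1 * enorm (a - b).
  have := gam_lip (r^-1 * rho' a) (r^-1 * rho' b).
  rewrite -mulrBr normrM (gtr0_norm rV) ler_norml => /andP[_ h].
  rewrite -lerBlDl; apply: le_trans h _; rewrite mulrA ler_wpM2l ?mulr_ge0 ?(ltW rV)//.
pose f w := gam (r^-1 * rho' (c *: Z w)).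
have mf : measurable_fun setT f.
  by apply/measurable_EFinP; apply: (nF r ur').1; exact: random_vectorZ.
have fi : P.-integrable setT (EFin \o f).
  apply: (@integrable_dom _ _ _ _ _
    (fun w => gam (r^-1 * rho' 0) + 2 * r^-1 * c * enorm (Z w))) => //.
    move=> w; rewrite ger0_norm ?gam_ge0//.
    apply: le_trans (gl _ 0) _; rewrite subr0 enormZ (gtr0_norm c0) !mulrA//.
  apply: integrableDr; first exact: integrable_cstP.
  by apply: integrableZr; exact: gauss_enorm_integrable.
have iA : P.-integrable setT (EFin \o (fun w => k * \1_A w)).
  by apply: integrableZr; exact: integrable_indic.
have iZ : P.-integrable setT (EFin \o (fun w => 2 * r^-1 * (1 - c) * enorm (Z w))).
  by apply: integrableZr; exact: gauss_enorm_integrable.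
have : (\int[P]_w (f w + k * \1_A w)%:E <=
    \int[P]_w (f w + 2 * r^-1 * (1 - c) * enorm (Z w))%:E)%E.
  apply: (le_trans low); apply: ge0_le_integral => //.
  - by move=> w _; rewrite lee_fin gam_ge0.
  - by apply: (nF r ur').1.
  - by case/integrableP : (integrableDr fi iZ).
  - move=> w _; rewrite lee_fin; apply: le_trans (gl _ (c *: Z w)) _.
    rewrite lerD2l -{1}[Z w]scale1r -scalerBl enormZ ger0_norm ?subr_ge0//.
    by rewrite mulrA.
rewrite !Rintegral_EFin; [|exact: integrableDr|exact: integrableDr].
rewrite lee_fin RintegralD// RintegralD// lerD2l RintegralZl//; last exact: integrable_indic.
rewrite RintegralZl//; last exact: gauss_enorm_integrable.
rewrite Rintegral_indicP// => h.
rewrite -(fineK (fin_num_measure P A mA)) lee_fin.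
have k1 := ler_wpM2l (_ : 0 <= 2 * r^-1 * (1 - c)) (gauss_enorm1 gZ d0).
have {}h := le_trans h (k1 ltac:(by rewrite !mulr_ge0 ?subr_ge0// ltW)).
have h2 : 2 * r^-1 * (1 - c) * rd <= 2 * r^-1 * s ^+ 2 * rd.
  by rewrite ler_wpM2r// ler_wpM2l// mulr_ge0// ltW.
(* The gain is [(s / r) ^+ 2 / 24] times the probability and the Lipschitz error at most
   [2 * s ^+ 2 * rd / r], whence 48. *)
rewrite -(ler_pM2l k0); apply: le_trans h _; apply: le_trans h2 _.
by rewrite le_eqVlt; apply/orP; left; apply/eqP; rewrite /k; field; rewrite gt_eqF.
Qed.

End Shell.

(** * Lindeberg replacement *)

Section OneStep.
Context {R : realType} {d : nat} {dT : measure_display} {T : measurableType dT}.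
Variables (P : probability T R) (Z : T -> 'cV[R]_d).
Hypothesis gZ : std_gaussian P Z.
Hypothesis d0 : (0 < d)%N.
Local Notation rd := (Num.sqrt d%:R : R).
Variables (psi : 'cV[R]_d -> R) (tau al ga : R).
Hypothesis psi_meas : vmeas (EFin \o psi).
Hypothesis psi01 : forall x, 0 <= psi x <= 1.
Hypothesis tau0 : 0 < tau.
Hypotheses (al0 : 0 <= al) (ga0 : 0 <= ga).
Hypothesis psi_near : forall z, `|psi (tau *: z) - psi 0| <= al * enorm z + ga.

Let mZ : random_vector Z. Proof. by case: gZ. Qed.

Let psi_norm x : `|psi x| <= 1.
Proof. by have /andP[h1 h2] := psi01 x; rewrite ger0_norm. Qed.

Let pZ w := psi (tau *: Z w).

Let mpZ : measurable_fun setT pZ.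
Proof. by apply/measurable_EFinP; apply: psi_meas; exact: random_vectorZ. Qed.

Let ipZ (g : T -> R) : P.-integrable setT (EFin \o g) ->
  P.-integrable setT (EFin \o (fun w => pZ w * g w)).
Proof.
move=> ig; apply: (@integrable_dom _ _ _ _ _ (fun w => `|g w|)).
- by apply: measurable_funM => //; exact: measurable_integrable ig.
- by move=> w; rewrite normrM ler_piMl//; exact: psi_norm.
- exact: integrable_norm.
Qed.

Definition smoothed (v : 'cV[R]_d) : R := \int[P]_w psi (v + tau *: Z w).

Let idot u : P.-integrable setT (EFin \o (fun w => dotv u (Z w))).
Proof.
have := gauss_dot_pow_integrable gZ u 1; apply: integrable_dom.
- by apply: measurable_dotv => // j.
- by move=> w; rewrite expr1.
Qed.

Let iexp u : P.-integrable setT (EFin \o (fun w => expR (dotv u (Z w) - dotv u u / 2))) /\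
  \int[P]_w expR (dotv u (Z w) - dotv u u / 2) = 1.
Proof.
have h := CameronMartin gZ u (nmeas_cst (c := 1%E) lee01).
have {}h : (\int[P]_w (expR (dotv u (Z w) - dotv u u / 2))%:E = 1%:E)%E.
  transitivity (\int[P]_w (1%E * (expR (dotv u (Z w) - dotv u u / 2))%:E))%E.
    by apply: eq_integral => w _; rewrite mul1e.
  by rewrite -h integral_cst//= probability_setT mule1.
split; last exact: ge0_Rintegral.
apply: ge0_integrable => //; last by rewrite h ltry.
apply: (measurableT_comp (@measurable_expR R)); apply: measurable_funB => //.
by apply: measurable_dotv => // j.
Qed.

(** The density integrates to 1 and the subtracted Hermite polynomials of positive degree to 0. A
    constant may thus be subtracted from [psi] before the remainder is estimated, so that the
    oscillation of [psi] is what enters. *)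
Let irem u : P.-integrable setT (EFin \o (fun w => rem u (Z w))) /\
  \int[P]_w rem u (Z w) = 0.
Proof.
have [ie e1] := iexp u.
have i1 : P.-integrable setT (EFin \o (fun w => expR (dotv u (Z w) - dotv u u / 2) - 1)).
  by apply: integrableBr => //; exact: integrable_cstP.
have i2 : P.-integrable setT (EFin \o (fun w => 2^-1 * (dotv u (Z w) ^+ 2 - dotv u u))).
  apply: integrableZr; apply: integrableBr; last exact: integrable_cstP.
  exact: gauss_dot_sqr_integrable.
have remE : (fun w => rem u (Z w)) = fun w =>
    expR (dotv u (Z w) - dotv u u / 2) - 1 - dotv u (Z w) -
    2^-1 * (dotv u (Z w) ^+ 2 - dotv u u).
  by apply/funext => w; rewrite /rem (mulrC 2^-1).
have i3 := integrableBr i1 (idot u).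
rewrite remE; split; first exact: integrableBr.
rewrite RintegralB// RintegralB// RintegralB//; last exact: integrable_cstP.
rewrite e1 Rintegral_cstP gauss_dot_mean// RintegralZl//; last first.
  by apply: integrableBr; [exact: gauss_dot_sqr_integrable|exact: integrable_cstP].
rewrite RintegralB//; [|exact: gauss_dot_sqr_integrable|exact: integrable_cstP].
by rewrite gauss_dot_var// Rintegral_cstP subrr mulr0 !subr0 subrr.
Qed.

Let smoothedE v : smoothed v =
  \int[P]_w (pZ w * expR (dotv (tau^-1 *: v) (Z w) - dotv (tau^-1 *: v) (tau^-1 *: v) / 2)).
Proof.
pose f x : \bar R := (psi (tau *: x))%:E.
have nf : nmeas f.
  split => [|x]; last by have /andP[] := psi01 (tau *: x).
  exact: (vmeas_scale tau psi_meas).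
rewrite /smoothed /Rintegral; congr fine.
transitivity (\int[P]_w f (Z w + tau^-1 *: v)%R)%E.
  apply: eq_integral => w _; rewrite /f scalerDr scalerA mulfV ?gt_eqF// scale1r.
  by rewrite addrC.
by rewrite (CameronMartin gZ _ nf).
Qed.

(** Together with [smoothed 0], these moments encode the derivatives of [smoothed] at 0: the
    gradient is [l j / tau] and the Hessian is [(q j k - (j == k)%:R * smoothed 0) / tau ^+ 2]. *)
Let l j := \int[P]_w (pZ w * Z w j 0).
Let q j k := \int[P]_w (pZ w * (Z w j 0 * Z w k 0)).

Let iZ j : P.-integrable setT (EFin \o (fun w => Z w j 0)).
Proof.
have := idot (delta_mx j 0); congr (P.-integrable _ _).
by apply/funext => w /=; rewrite dotvC dotv_delta.
Qed.

Let iZZ j k : P.-integrable setT (EFin \o (fun w => Z w j 0 * Z w k 0)).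
Proof.
apply: (@integrable_dom _ _ _ _ _ (fun w => enorm (Z w) ^+ 2)).
- by apply: measurable_funM; exact: mZ.
- by move=> w; rewrite normrM expr2 ler_pM// coord_le_enorm.
- exact: gauss_enorm2_integrable.
Qed.

Let expand v u : u = tau^-1 *: v ->
  `|smoothed v - (smoothed 0 + \sum_j u j 0 * l j +
    2^-1 * ((\sum_j \sum_k u j 0 * u k 0 * q j k) - enorm u ^+ 2 * smoothed 0))|
  <= Krem * enorm u ^+ 3 * (al * rd + ga).
Proof.
move=> uE; have [ir r0] := irem u.
have s0 : smoothed 0 = \int[P]_w pZ w.
  by apply: eq_Rintegral => w _; rewrite add0r.
have ip : P.-integrable setT (EFin \o pZ).
  have := ipZ (integrable_cstP P 1); congr (P.-integrable _ _).
  by apply/funext => w /=; rewrite mulr1.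
pose lin w := \sum_j u j 0 * (pZ w * Z w j 0).
pose quad w := \sum_j \sum_k u j 0 * u k 0 * (pZ w * (Z w j 0 * Z w k 0)).
have ilin : P.-integrable setT (EFin \o lin).
  by apply: integrable_sumr => j; apply: integrableZr; exact: ipZ.
have iquad : P.-integrable setT (EFin \o quad).
  by apply: integrable_sumr => j; apply: integrable_sumr => k; apply: integrableZr; exact: ipZ.
have lE : \sum_j u j 0 * l j = \int[P]_w lin w.
  rewrite Rintegral_sum; last by move=> j; apply: integrableZr; exact: ipZ.
  by apply: eq_bigr => j _; rewrite RintegralZl//; exact: ipZ.
have qE : \sum_j \sum_k u j 0 * u k 0 * q j k = \int[P]_w quad w.
  rewrite Rintegral_sum; last first.
    by move=> j; apply: integrable_sumr => k; apply: integrableZr; exact: ipZ.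
  apply: eq_bigr => j _; rewrite Rintegral_sum; last first.
    by move=> k; apply: integrableZr; exact: ipZ.
  by apply: eq_bigr => k _; rewrite RintegralZl//; exact: ipZ.
have dlin w : dotv u (Z w) * pZ w = lin w.
  by rewrite /lin /dotv mulr_suml; apply: eq_bigr => j _; ring.
have dquad w : dotv u (Z w) ^+ 2 * pZ w = quad w.
  rewrite expr2 /dotv big_distrlr/= mulr_suml; apply: eq_bigr => j _.
  by rewrite mulr_suml; apply: eq_bigr => k _; ring.
pose base w := pZ w + lin w + 2^-1 * (quad w - enorm u ^+ 2 * pZ w).
have i4 : P.-integrable setT (EFin \o (fun w => quad w - enorm u ^+ 2 * pZ w)).
  by apply: integrableBr => //; exact: integrableZr.
have i5 : P.-integrable setT (EFin \o (fun w => pZ w + lin w)) by exact: integrableDr.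
have ibase : P.-integrable setT (EFin \o base).
  by apply: integrableDr => //; exact: integrableZr.
rewrite lE qE s0.
have -> : \int[P]_w pZ w + \int[P]_w lin w + 2^-1 * (\int[P]_w quad w -
    enorm u ^+ 2 * \int[P]_w pZ w) = \int[P]_w base w.
  rewrite RintegralD//; last exact: integrableZr.
  rewrite RintegralD// RintegralZl// RintegralB//; last exact: integrableZr.
  by rewrite RintegralZl.
have [ie _] := iexp u.
rewrite smoothedE -uE -RintegralB//; last exact: ipZ.
have -> : \int[P]_w (pZ w * expR (dotv u (Z w) - dotv u u / 2) - base w) =
    \int[P]_w (pZ w * rem u (Z w)).
  apply: eq_Rintegral => w _; rewrite /base -dquad -dlin /rem -enorm_sqr.
  by field.
have -> : \int[P]_w (pZ w * rem u (Z w)) = \int[P]_w ((pZ w - psi 0) * rem u (Z w)).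
  transitivity (\int[P]_w (pZ w * rem u (Z w) - psi 0 * rem u (Z w))).
    rewrite RintegralB//; [|exact: ipZ|exact: integrableZr].
    by rewrite RintegralZl// r0 mulr0 subr0.
  by apply: eq_Rintegral => w _; rewrite mulrBl.
have ifin : P.-integrable setT (EFin \o (fun w => (pZ w - psi 0) * rem u (Z w))).
  apply: (@integrable_dom _ _ _ _ _ (fun w => 2 * `|rem u (Z w)|)).
  - apply: measurable_funM; last exact: measurable_integrable ir.
    exact: measurable_funB.
  - move=> w; rewrite normrM ler_wpM2r//; apply: le_trans (ler_normB _ _) _.
    by have := psi_norm (tau *: Z w); have := psi_norm 0; rewrite /pZ; lra.
  - by apply: integrableZr; exact: integrable_norm.
apply: le_trans (le_normr_Rintegral measurableT ifin) _.
rewrite -lee_fin -Rintegral_EFin; last exact: integrable_norm.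
apply: le_trans (gauss_rem gZ d0 al0 ga0 u).
apply: ge0_le_integral => //.
- have /integrableP[h _] := integrable_norm ifin; exact: h.
- apply/measurable_EFinP; apply: measurable_funM.
    by apply: measurableT_comp => //; exact: measurable_integrable ir.
  by apply: measurable_funD => //; apply: measurable_funM => //; exact: measurable_enorm.
- by move=> w _; rewrite lee_fin normrM mulrC ler_wpM2l// psi_near.
Qed.

(** The mean of the second order expansion at [h *: V]. It depends on [V] through mean and
    covariance alone, hence is common to all standardized vectors. *)
Let cst_step (h : R) : R :=
  smoothed 0 + 2^-1 * (h / tau) ^+ 2 * (\sum_j q j j - d%:R * smoothed 0).

Lemma smoothed_bound v : 0 <= smoothed v <= 1.
Proof.
have mv : measurable_fun setT (fun w => psi (v + tau *: Z w)).
  by apply/measurable_EFinP; apply: psi_meas; apply: random_vectorD => //; exact: random_vectorZ.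
have i0 : P.-integrable setT (EFin \o (fun w => psi (v + tau *: Z w))).
  by apply: (integrable_dom mv _ (integrable_cstP P 1)) => w.
apply/andP; split.
  by apply: Rintegral_ge0 => w _; have /andP[] := psi01 (v + tau *: Z w).
rewrite -[leRHS](Rintegral_cstP P 1); apply: le_Rintegral => //.
  exact: integrable_cstP.
by move=> w _; have /andP[] := psi01 (v + tau *: Z w).
Qed.

Lemma vmeas_smoothed : vmeas (EFin \o smoothed).
Proof.
have nf : nmeas (EFin \o psi).
  by split => // x; have /andP[] := psi01 x.
have no : nmeas (op P (fun w => tau *: Z w) (EFin \o psi)).
  by apply: nmeas_op => //; exact: random_vectorZ.
move=> dU U Y mY; apply/measurable_EFinP.
exact: (measurableT_comp (fine_measurable measurableT) (no.1 _ _ _ mY)).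
Qed.

Section swap.
Context {dS : measure_display} {S : measurableType dS}.
Variables (Q : probability S R) (V : S -> 'cV[R]_d) (beta h : R).
Hypothesis sV : standardized Q V beta.
Hypothesis h0 : 0 < h.

Lemma smoothed_taylor : `|\int[Q]_s smoothed (h *: V s) - cst_step h| <=
  Krem * (h / tau) ^+ 3 * beta * (al * rd + ga).
Proof.
case: sV => mV m1 m2 iV bV.
have iVV j k : Q.-integrable setT (EFin \o (fun s => V s j 0 * V s k 0)).
  apply: (@integrable_dom _ _ _ _ _ (fun s => 1 + enorm (V s) ^+ 3)).
  - by apply: measurable_funM; exact: mV.
  - move=> s; rewrite normrM.
    have := ler_pM (normr_ge0 _) (normr_ge0 _) (coord_le_enorm (V s) j) (coord_le_enorm (V s) k).
    move=> /le_trans; apply; set x := enorm _; have x0 : 0 <= x by exact: enorm_ge0.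
    have [x1|x1] := leP x 1; first by have : 0 <= x ^+ 3; [rewrite exprn_ge0|nra].
    by rewrite (exprS _ 2) expr2; have : x * x <= x * (x * x); [rewrite ler_peMl//; nra|lra].
  - by apply: integrableDr => //; exact: integrable_cstP.
have iV1 j : Q.-integrable setT (EFin \o (fun s => V s j 0)).
  apply: (@integrable_dom _ _ _ _ _ (fun s => 1 + V s j 0 * V s j 0)).
  - exact: mV.
  - by move=> s; rewrite ler_norml; apply/andP; split; nra.
  - by apply: integrableDr => //; exact: integrable_cstP.
have [r rE] : exists r, r = h / tau by exists (h / tau).
have r0 : 0 < r by rewrite rE divr_gt0.
pose main s := smoothed 0 + \sum_j r * l j * V s j 0 +
  2^-1 * (\sum_j \sum_k r ^+ 2 * q j k * (V s j 0 * V s k 0) -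
    r ^+ 2 * smoothed 0 * \sum_j V s j 0 * V s j 0).
have is1 : Q.-integrable setT (EFin \o (fun s => \sum_j r * l j * V s j 0)).
  by apply: integrable_sumr => j; exact: integrableZr.
have is2 : Q.-integrable setT (EFin \o (fun s =>
    \sum_j \sum_k r ^+ 2 * q j k * (V s j 0 * V s k 0))).
  by do 2 apply: integrable_sumr => ?; exact: integrableZr.
have is3 : Q.-integrable setT (EFin \o (fun s => \sum_j V s j 0 * V s j 0)).
  exact: integrable_sumr.
have i4 := integrableBr is2 (integrableZr (r ^+ 2 * smoothed 0) is3).
have i5 := integrableDr (integrable_cstP Q (smoothed 0)) is1.
have imain : Q.-integrable setT (EFin \o main).
  by apply: integrableDr => //; exact: integrableZr.
have mainE : \int[Q]_s main s = cst_step h.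
  rewrite RintegralD//; last exact: integrableZr.
  rewrite RintegralD//; last exact: integrable_cstP.
  rewrite Rintegral_cstP Rintegral_sum; last by move=> j; exact: integrableZr.
  rewrite big1 ?addr0; last by move=> j _; rewrite RintegralZl// m1 mulr0.
  rewrite RintegralZl// RintegralB//; last exact: integrableZr.
  rewrite RintegralZl// !Rintegral_sum//; last first.
    by move=> j; apply: integrable_sumr => k; exact: integrableZr.
  have -> : \sum_j \int[Q]_s (V s j 0 * V s j 0) = d%:R.
    rewrite -[in RHS](card_ord d) -sum1_card natr_sum.
    by apply: eq_bigr => j _; rewrite m2 eqxx.
  have -> : \sum_j \int[Q]_s (\sum_k r ^+ 2 * q j k * (V s j 0 * V s k 0)) =
      r ^+ 2 * \sum_j q j j.
    rewrite mulr_sumr; apply: eq_bigr => j _.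
    rewrite Rintegral_sum; last by move=> k; exact: integrableZr.
    rewrite (bigD1 j)//= big1 ?addr0.
      by rewrite RintegralZl// m2 eqxx mulr1.
    by move=> k kj; rewrite RintegralZl// m2 eq_sym (negbTE kj) mulr0.
  by rewrite /cst_step -rE; ring.
have msm : measurable_fun setT (fun s => smoothed (h *: V s)).
  by apply/measurable_EFinP; apply: vmeas_smoothed; exact: random_vectorZ.
have ism : Q.-integrable setT (EFin \o (fun s => smoothed (h *: V s))).
  apply: (integrable_dom msm _ (integrable_cstP Q 1)) => s.
  by have /andP[h1 h2] := smoothed_bound (h *: V s); rewrite ger0_norm.
rewrite -mainE -RintegralB//.
have idiff : Q.-integrable setT (EFin \o (fun s => smoothed (h *: V s) - main s)).
  exact: integrableBr.
have C0 : 0 <= al * rd + ga by rewrite addr_ge0// mulr_ge0// sqrtr_ge0.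
apply: le_trans (le_normr_Rintegral measurableT idiff) _.
apply: (@le_trans _ _ (\int[Q]_s (Krem * r ^+ 3 * (al * rd + ga) * enorm (V s) ^+ 3))).
  apply: le_Rintegral => //; [exact: integrable_norm|exact: integrableZr|].
  move=> s _; have := expand (erefl (tau^-1 *: (h *: V s))).
  rewrite scalerA (mulrC tau^-1) -rE enormZ (gtr0_norm r0) => /le_trans.
  have -> : main s = smoothed 0 + \sum_j (r *: V s) j 0 * l j +
    2^-1 * ((\sum_j \sum_k (r *: V s) j 0 * (r *: V s) k 0 * q j k) -
      (r * enorm (V s)) ^+ 2 * smoothed 0).
    rewrite /main exprMn enorm_sqr /dotv; congr (_ + _ + 2^-1 * (_ - _)).
    - by apply: eq_bigr => j _; rewrite mxE; ring.
    - by apply: eq_bigr => j _; apply: eq_bigr => k _; rewrite !mxE; ring.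
    - ring.
  apply; rewrite le_eqVlt; apply/orP; left; apply/eqP; ring.
rewrite RintegralZl// -rE.
have -> : Krem * r ^+ 3 * beta * (al * rd + ga) = Krem * r ^+ 3 * (al * rd + ga) * beta by ring.
by rewrite ler_wpM2l// mulr_ge0// mulr_ge0 ?exprn_ge0 ?(ltW r0)// ltW// Krem_gt0.
Qed.

End swap.

Lemma smoothed_compare {dS dU} {S : measurableType dS} {U : measurableType dU}
    (Q : probability S R) (V : S -> 'cV[R]_d)
    (Q' : probability U R) (V' : U -> 'cV[R]_d) (beta beta' h : R) :
  standardized Q V beta -> standardized Q' V' beta' -> 0 < h ->
  `|\int[Q]_s smoothed (h *: V s) - \int[Q']_s smoothed (h *: V' s)| <=
  Krem * (h / tau) ^+ 3 * (beta + beta') * (al * rd + ga).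
Proof.
move=> sV sV' h0; have a := smoothed_taylor sV h0; have b := smoothed_taylor sV' h0.
have -> : \int[Q]_s smoothed (h *: V s) - \int[Q']_s smoothed (h *: V' s) =
  (\int[Q]_s smoothed (h *: V s) - cst_step h) -
  (\int[Q']_s smoothed (h *: V' s) - cst_step h) by ring.
apply: le_trans (ler_normB _ _) _.
by apply: le_trans (lerD a b) _; rewrite le_eqVlt; apply/orP; left; apply/eqP; ring.
Qed.

End OneStep.

Section UnitBounded.
Local Open Scope ereal_scope.
Context {R : realType} {d : nat}.
Implicit Types (f g : 'cV[R]_d -> \bar R) (rho : 'cV[R]_d -> R).

Definition ubmeas f := nmeas f /\ forall x, f x <= 1.

Lemma ubmeas_fin f x : ubmeas f -> f x \is a fin_num.
Proof.
move=> [nf f1]; rewrite ge0_fin_numE; last exact: nf.2.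
by apply: le_lt_trans (f1 x) _; rewrite ltry.
Qed.

Lemma ubmeas_op {dT} {T : measurableType dT} (P : probability T R)
    (V : T -> 'cV[R]_d) f : random_vector V -> ubmeas f -> ubmeas (op P V f).
Proof.
move=> mV [nf f1]; split; first exact: nmeas_op.
move=> x; rewrite -(op_cst P V x lee01); apply: op_le => //.
exact: nmeas_cst.
Qed.

Definition ind rho x : \bar R := ((rho x <= 0)%R)%:R%:E.

Definition shl rho (q : R) x : \bar R := ((`|rho x| <= q)%R)%:R%:E.

Lemma ubmeas_bool (b : R -> bool) rho : measurable_fun setT b ->
  unit_convex rho -> ubmeas (fun x => (b (rho x))%:R%:E).
Proof.
move=> mb ur; split; last by move=> x; rewrite lee_fin lern1 leq_b1.
split; last by move=> x; rewrite lee_fin.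
have mb' : measurable_fun setT (fun t => (b t)%:R : R).
  rewrite (_ : (fun _ => _) = (fun t => if b t then 1%R else 0%R)).
    exact: measurable_fun_ifT.
  by apply/funext => t; case: (b t).
exact: (vmeas_comp_real mb' (unit_convex_vmeas ur)).
Qed.

Lemma ubmeas_ind rho : unit_convex rho -> ubmeas (ind rho).
Proof.
move=> ur; apply: (@ubmeas_bool (fun t => t <= 0)%R) => //.
exact: measurable_fun_ler.
Qed.

Lemma ubmeas_shl rho q : unit_convex rho -> ubmeas (shl rho q).
Proof.
move=> ur; apply: (@ubmeas_bool (fun t => `|t| <= q)%R) => //.
exact: measurable_fun_ler.
Qed.

End UnitBounded.

Section Hybrids.
Local Open Scope ereal_scope.
Context {R : realType} {d : nat} {dT : measure_display} {T : measurableType dT}.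
Variables (P : probability T R) (Z : T -> 'cV[R]_d).
Hypothesis gZ : std_gaussian P Z.
Hypothesis d0 : (0 < d)%N.
Local Notation rd := (Num.sqrt d%:R : R).
Context {dS : measure_display} {S : measurableType dS}.
Variables (Q : probability S R) (V : S -> 'cV[R]_d).
Hypothesis mV : random_vector V.
Variable n : nat.
Hypothesis n0 : (0 < n)%N.
Implicit Types (f g : 'cV[R]_d -> \bar R) (rho : 'cV[R]_d -> R).

Let mZ : random_vector Z. Proof. by case: gZ. Qed.

Definition hstep : R := (Num.sqrt n%:R)^-1.
Definition opA f := op Q (fun s => hstep *: V s)%R f.
Definition opG (s : R) f := op P (fun w => s *: Z w)%R f.
Definition itA k f := iter k opA f.
(** Standard deviation, in each coordinate, of the sum of the [n - k] steps that are still
    Gaussian. *)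
Definition sg k : R := (Num.sqrt (n - k)%:R * hstep)%R.
(* [hyb k f x] is the mean of [f] at [x] plus [k] steps [hstep *: V] plus an
   independent Gaussian vector that completes the covariance to the identity. *)
Definition hyb k f := itA k (opG (sg k) f).

Let rn_gt0 : (0 < Num.sqrt n%:R :> R)%R. Proof. by rewrite sqrtr_gt0 ltr0n. Qed.

Lemma hstep_gt0 : (0 < hstep)%R. Proof. by rewrite invr_gt0. Qed.

Lemma hstep_sqr : (hstep ^+ 2 = n%:R^-1)%R.
Proof. by rewrite exprVn sqr_sqrtr// ler0n. Qed.

Lemma sg_ge0 k : (0 <= sg k)%R.
Proof. by rewrite mulr_ge0 ?sqrtr_ge0// ltW// hstep_gt0. Qed.

Lemma sg_sqr k : (sg k ^+ 2 = (n - k)%:R / n%:R)%R.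
Proof. by rewrite exprMn sqr_sqrtr ?ler0n// hstep_sqr. Qed.

Lemma sg_step k : (k < n)%N -> (sg k ^+ 2 = hstep ^+ 2 + sg k.+1 ^+ 2)%R.
Proof.
move=> kn; rewrite !sg_sqr hstep_sqr -[X in (X + _)%R]mul1r -mulrDl.
have -> : (n - k = (n - k.+1).+1)%N by rewrite -subSn// subSS.
by rewrite -natr1 addrC.
Qed.

Lemma sg0 : sg 0 = 1%R.
Proof. by rewrite /sg subn0 mulfV// gt_eqF. Qed.

Lemma sgn : sg n = 0%R.
Proof. by rewrite /sg subnn sqrtr0 mul0r. Qed.

Lemma sg_gt0 k : (k < n)%N -> (0 < sg k)%R.
Proof. by move=> kn; rewrite mulr_gt0 ?hstep_gt0// sqrtr_gt0 ltr0n subn_gt0. Qed.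

Let mA : random_vector (fun s => hstep *: V s)%R. Proof. exact: random_vectorZ. Qed.
Let mG s : random_vector (fun w => s *: Z w)%R. Proof. exact: random_vectorZ. Qed.

Lemma nmeas_A f : nmeas f -> nmeas (opA f). Proof. exact: nmeas_op. Qed.
Lemma nmeas_G s f : nmeas f -> nmeas (opG s f). Proof. exact: nmeas_op. Qed.

Lemma nmeas_it k f : nmeas f -> nmeas (itA k f).
Proof. by move=> nf; elim: k => //= k; exact: nmeas_A. Qed.

Lemma ubmeas_G s f : ubmeas f -> ubmeas (opG s f). Proof. exact: ubmeas_op. Qed.

Lemma ubmeas_it k f : ubmeas f -> ubmeas (itA k f).
Proof. by move=> uf; elim: k => //= k; exact: ubmeas_op. Qed.

Lemma ubmeas_hyb k f : ubmeas f -> ubmeas (hyb k f).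
Proof. by move=> uf; apply: ubmeas_it; exact: ubmeas_G. Qed.

Lemma itA_shift k f x y : itA k f (x + y)%R = itA k (fun z => f (x + z)%R) y.
Proof.
elim: k f y => //= k ih f y; rewrite /opA -op_shift.
by apply: eq_integral => s _; rewrite ih.
Qed.

Lemma hyb_shift k f x y : hyb k f (x + y)%R = hyb k (fun z => f (x + z)%R) y.
Proof.
rewrite /hyb itA_shift; congr (itA _ _ _); apply/funext => z.
by rewrite /opG op_shift.
Qed.

Lemma itA_le k f g x : nmeas f -> nmeas g -> (forall y, f y <= g y) ->
  itA k f x <= itA k g x.
Proof.
move=> nf ng fg; elim: k x => //= k ih x.
by apply: op_le => //; exact: nmeas_it.
Qed.

Lemma hyb_le k f g x : nmeas f -> nmeas g -> (forall y, f y <= g y) ->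
  hyb k f x <= hyb k g x.
Proof.
move=> nf ng fg; apply: itA_le; [exact: nmeas_G|exact: nmeas_G|].
by move=> y; exact: op_le.
Qed.

Lemma itAD k f g x : nmeas f -> nmeas g ->
  itA k (fun y => f y + g y) x = itA k f x + itA k g x.
Proof.
move=> nf ng; elim: k x => //= k ih x.
rewrite /opA -opD//; [|exact: nmeas_it|exact: nmeas_it].
by apply: eq_integral => s _; rewrite ih.
Qed.

Lemma itAZ k (c : R) f x : (0 <= c)%R -> nmeas f ->
  itA k (fun y => c%:E * f y) x = c%:E * itA k f x.
Proof.
move=> c0 nf; elim: k x => //= k ih x.
rewrite /opA -opZ//; last exact: nmeas_it.
by apply: eq_integral => s _; rewrite ih.
Qed.

Lemma hybD k f g x : nmeas f -> nmeas g ->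
  hyb k (fun y => f y + g y) x = hyb k f x + hyb k g x.
Proof.
move=> nf ng; rewrite /hyb -itAD; [|exact: nmeas_G|exact: nmeas_G].
by congr (itA _ _ _); apply/funext => y; rewrite /opG opD.
Qed.

Lemma itA_G k s f : nmeas f -> itA k (opG s f) = opG s (itA k f).
Proof.
move=> nf; elim: k => //= k ->; apply/funext => x.
by rewrite /opA /opG op_comm//; exact: nmeas_it.
Qed.

Lemma G_semigroup s1 s2 t f : nmeas f -> (0 <= s1)%R -> (0 <= s2)%R -> (0 <= t)%R ->
  (t ^+ 2 = s1 ^+ 2 + s2 ^+ 2)%R -> opG s1 (opG s2 f) = opG t f.
Proof. by move=> nf h1 h2 h3 e; apply/funext => x; exact: gauss_semigroup. Qed.

Lemma G_comm s1 s2 f : nmeas f -> opG s1 (opG s2 f) = opG s2 (opG s1 f).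
Proof. by move=> nf; apply/funext => x; rewrite /opG op_comm. Qed.

Lemma hyb_G k s f : nmeas f -> hyb k (opG s f) = opG s (hyb k f).
Proof. by move=> nf; rewrite /hyb G_comm// itA_G//; exact: nmeas_G. Qed.

Lemma hyb0 f : hyb 0 f = opG 1 f.
Proof. by rewrite /hyb sg0. Qed.

Lemma hybn f : hyb n f = itA n f.
Proof.
rewrite /hyb sgn; congr (itA _ _); apply/funext => x.
rewrite /opG /op; under eq_integral do rewrite scale0r addr0.
by rewrite integral_cst//= probability_setT mule1.
Qed.

Lemma opG1_shell rho q x : unit_convex rho -> (0 < q)%R ->
  opG 1 (shl rho q) x <= (48 * rd * q)%:E.
Proof.
move=> ur q0; have ur' := unit_convex_shift x ur.
apply: le_trans (gauss_shell gZ d0 ur' q0).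
rewrite -[leRHS]mul1e -integral_cst//; last first.
  apply: measurable_le_cst; apply: measurableT_comp => //.
  by apply/measurable_EFinP; exact: (unit_convex_vmeas ur' mZ).
rewrite [leRHS]integral_mkcond/= /opG /op.
apply: ge0_le_integral => //.
- by move=> w _; exact: (ubmeas_shl q ur).1.2.
- exact: (nmeas_measurable x (ubmeas_shl q ur).1 (mG 1)).
- apply/(measurable_restrictT _ _).1 => //.
  apply: measurable_le_cst; apply: measurableT_comp => //.
  by apply/measurable_EFinP; exact: (unit_convex_vmeas ur' mZ).
- move=> w _; rewrite scale1r /shl patchE.
  case: ifPn => [|/negP]; rewrite inE/=; first by move=> ->.
  by move=> /negP/negbTE ->.
Qed.

(** The hypothesis of the recursion. It covers every hybrid because the shells of the intermediate
    sums are estimated from it; evaluation at 0 is enough since the class of [rho] is closed under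
    shifts. *)
Definition close (dl : R) := forall rho k, unit_convex rho -> (k <= n)%N ->
  hyb k (ind rho) 0 <= opG 1 (ind rho) 0 + dl%:E /\
  opG 1 (ind rho) 0 <= hyb k (ind rho) 0 + dl%:E.

Section with_close.
Variable dl : R.
Hypothesis cl : close dl.

Lemma close_shift rho k x : unit_convex rho -> (k <= n)%N ->
  hyb k (ind rho) x <= opG 1 (ind rho) x + dl%:E /\
  opG 1 (ind rho) x <= hyb k (ind rho) x + dl%:E.
Proof.
move=> ur kn; have := cl (unit_convex_shift x ur) kn.
have -> : ind (fun y => rho (x + y)%R) = (fun y => ind rho (x + y)%R) by [].
by rewrite -hyb_shift -hyb0 -hyb_shift addr0 hyb0.
Qed.

(** The shell is contained in {rho <= q} minus {rho <= - 2 q}, where [- (2 * q)] instead of [- q]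
    keeps the shell disjoint from the set removed. Passing to the Gaussian costs [dl] twice, and
    there the difference lies in a shell of half-width [3 / 2 * q] around level [- (q / 2)], whence
    72. *)
Lemma hyb_shell rho k q x : unit_convex rho -> (k <= n)%N -> (0 < q)%R ->
  hyb k (shl rho q) x <= (72 * rd * q + 2 * dl)%:E.
Proof.
move=> ur kn q0.
pose r1 y := (rho y - q)%R; pose r2 y := (rho y - - (2 * q))%R.
pose r3 y := (rho y - - (q / 2))%R.
have u1 : unit_convex r1 by exact: unit_convexB.
have u2 : unit_convex r2 by exact: unit_convexB.
have u3 : unit_convex r3 by exact: unit_convexB.
have ui r : unit_convex r -> nmeas (ind r) by move=> /ubmeas_ind[].
have us : nmeas (shl rho q) by case: (ubmeas_shl q ur).
have us3 : nmeas (shl r3 (3 / 2 * q)%R) by case: (ubmeas_shl (3 / 2 * q)%R u3).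
have h1 : hyb k (shl rho q) x + hyb k (ind r2) x <= hyb k (ind r1) x.
  rewrite -hybD//; [|exact: ui]; apply: hyb_le; [|exact: ui|].
    split => [dU U Y mY|y]; last by apply: adde_ge0; [exact: us.2|exact: (ubmeas_ind u2).1.2].
    by apply: emeasurable_funD; [exact: us.1|exact: (ubmeas_ind u2).1.1].
  move=> y; rewrite /shl /ind /r1 /r2 opprK lee_fin subr_le0 -natrD ler_nat ler_norml.
  case: (leP (rho y) q) => h; last by rewrite andbF; case: leP => //; lra.
  by case: (leP (- q)%R (rho y)) => h' /=; case: leP => //; lra.
have h2 : opG 1 (ind r1) x <= opG 1 (ind r2) x + opG 1 (shl r3 (3 / 2 * q)%R) x.
  rewrite /opG -opD//; [|exact: ui]; apply: op_le => //; [exact: ui| |].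
    split => [dU U Y mY|y]; last by apply: adde_ge0; [exact: (ubmeas_ind u2).1.2|exact: us3.2].
    by apply: emeasurable_funD; [exact: (ubmeas_ind u2).1.1|exact: us3.1].
  move=> y; rewrite /shl /ind /r1 /r2 /r3 !opprK lee_fin subr_le0 -natrD ler_nat ler_norml.
  case: (leP (rho y) q) => // h; case: (leP (rho y + 2 * q)%R 0%R) => //= h'.
  by rewrite add0n; have -> : (- (3 / 2 * q) <= rho y + q / 2 <= 3 / 2 * q)%R by lra.
have h3 : opG 1 (shl r3 (3 / 2 * q)%R) x <= (72 * rd * q)%:E.
  have -> : (72 * rd * q = 48 * rd * (3 / 2 * q))%R by field.
  by apply: opG1_shell => //; rewrite mulr_gt0.
have [h4 _] := close_shift x u1 kn.
have [_ h5] := close_shift x u2 kn.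
have fin1 : hyb k (ind r2) x \is a fin_num by apply: ubmeas_fin; apply: ubmeas_hyb; exact: ubmeas_ind.
rewrite -(leeD2rE _ _ fin1).
apply: le_trans h1 _; apply: le_trans h4 _; apply: le_trans (leeD2r _ h2) _.
apply: le_trans (leeD2r _ (leeD h5 h3)) _.
rewrite -(fineK fin1) lee_fin; lra.
Qed.

(** Noise of norm at most [2 * rd * s], which has probability at least 3/4, cannot leave the wider
    shell. This reduces shells of sums without noise to shells of hybrids. *)
Lemma G_shell_ge rho q s y : unit_convex rho -> (0 <= s)%R ->
  (3 / 4)%:E * shl rho q y <= opG s (shl rho (q + 2 * rd * s)%R) y.
Proof.
move=> ur s0; rewrite /shl; case: (leP `|rho y| q)%R => h; last first.
  by rewrite mule0; exact: (ubmeas_G s (ubmeas_shl (q + 2 * rd * s)%R ur)).1.2.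
rewrite mule1.
pose B := ~` [set w | (2 * rd < enorm (Z w))%R].
have mB' : measurable [set w | (2 * rd < enorm (Z w))%R].
  by apply: measurable_gt_cst; exact: measurable_enorm.
have mB : measurable B by exact: measurableC.
have PB : (3 / 4)%:E <= P B.
  rewrite probability_setC// leeBrDr ?fin_num_measure//.
  apply: le_trans (leeD2l _ (gauss_enorm_tail gZ d0)) _.
  by rewrite -EFinD lee_fin; lra.
apply: (le_trans PB); rewrite -[P B]mul1e -integral_cst// integral_mkcond/= /opG /op.
have us := (ubmeas_shl (q + 2 * rd * s)%R ur).1.
apply: ge0_le_integral => //.
- by move=> w _; apply: erestrict_ge0.
- exact/(measurable_restrictT _ _).1.
- exact: (nmeas_measurable y us (mG s)).
- move=> w _; rewrite patchE; case: ifPn => [|_]; last exact: us.2.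
  rewrite inE /B/= => /negP; rewrite -leNgt => zw.
  suff : (`|rho (y + s *: Z w)| <= q + 2 * rd * s)%R by rewrite /shl => ->.
  have [lip _] := ur; have := lip (y + s *: Z w)%R y.
  have -> : (y + s *: Z w - y = s *: Z w)%R by rewrite addrC addKr.
  rewrite enormZ (ger0_norm s0) => l1.
  have l2 : (s * enorm (Z w) <= 2 * rd * s)%R by rewrite mulrC ler_wpM2r.
  have l3 := le_trans l1 l2.
  rewrite -(subrK (rho y) (rho (y + s *: Z w)%R)).
  apply: le_trans (ler_normD _ _) _; rewrite addrC; exact: lerD.
Qed.

(** [G_shell_ge] supplies the missing Gaussian part for a wider shell and a factor 4/3, which turns
    72 into 96 and 2 into 8/3. *)
Lemma itA_shell rho k q x : unit_convex rho -> (k < n)%N -> (0 <= q)%R ->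
  itA k (shl rho q) x <= (96 * rd * (q + 2 * rd * sg k) + 8 / 3 * dl)%:E.
Proof.
move=> ur kn q0; have us q' := (ubmeas_shl q' ur).1.
have := hyb_shell (q := (q + 2 * rd * sg k)%R) x ur (ltnW kn).
have rd0 : (0 < rd)%R by exact: rd_gt0.
have q0' : (0 < q + 2 * rd * sg k)%R.
  by rewrite ltr_wpDl// mulr_gt0 ?sg_gt0// mulr_gt0.
move=> /(_ q0') h.
have : (3 / 4)%:E * itA k (shl rho q) x <= (72 * rd * (q + 2 * rd * sg k) + 2 * dl)%:E.
  apply: le_trans h; rewrite /hyb -itAZ ?divr_ge0//.
  apply: itA_le; [|exact: nmeas_G|].
    split => [dU U Y mY|y]; last by apply: mule_ge0; [rewrite lee_fin divr_ge0|exact: (us q).2].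
    by apply: measurable_funeM; exact: (us q).1.
  by move=> y; apply: G_shell_ge => //; exact: sg_ge0.
have fin1 : itA k (shl rho q) x \is a fin_num.
  by apply: ubmeas_fin; apply: ubmeas_it; exact: ubmeas_shl.
rewrite -(fineK fin1) -EFinM !lee_fin; lra.
Qed.

End with_close.

End Hybrids.

(** * Berry-Esseen bound by recursion on the error *)

Section BerryEsseen.
Local Open Scope ereal_scope.
Context {R : realType} {d : nat} {dT : measure_display} {T : measurableType dT}.
Variables (P : probability T R) (Z : T -> 'cV[R]_d).
Hypothesis gZ : std_gaussian P Z.
Hypothesis d0 : (0 < d)%N.
Local Notation rd := (Num.sqrt d%:R : R).
Context {dS : measure_display} {S : measurableType dS}.
Variables (Q : probability S R) (V : S -> 'cV[R]_d) (beta : R).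
Hypothesis sV : standardized Q V beta.
Variable n : nat.
Hypothesis n0 : (0 < n)%N.
Implicit Types (rho : 'cV[R]_d -> R).

Local Notation h := (@hstep R n).
Local Notation opA := (opA Q V n).
Local Notation opG := (opG P Z).
Local Notation itA := (itA Q V n).
Local Notation sg := (@sg R n).
Local Notation hyb := (hyb P Z Q V n).
Local Notation close := (close P Z Q V n).

Let mZ : random_vector Z. Proof. by case: gZ. Qed.
Let mV : random_vector V. Proof. by case: sV. Qed.

Definition gauss_beta : R := ((1 + 4`!%:R * (2 * expR (1 / 2))) / 2 * rd ^+ 3)%R.

Lemma gauss_beta_ge1 : (1 <= gauss_beta)%R.
Proof.
have e1 : (1 <= expR (1 / 2) :> R)%R by rewrite -[leLHS]expR0 ler_expR.
have r1 : (1 <= rd ^+ 3)%R by rewrite exprn_ege1// rd_ge1.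
rewrite /gauss_beta mulr_ege1// (_ : 4`! = 24)%N//; lra.
Qed.

Let beta_ge0 : (0 <= beta)%R.
Proof.
case: sV => _ _ _ _; apply: le_trans; apply: Rintegral_ge0 => s _.
by rewrite exprn_ge0// enorm_ge0.
Qed.

Let KB_ge0 : (0 <= Krem * (beta + gauss_beta))%R.
Proof.
apply: mulr_ge0; first exact/ltW/Krem_gt0.
by apply: addr_ge0; [exact: beta_ge0|exact: le_trans ler01 gauss_beta_ge1].
Qed.

Section swap.
Variables (dl : R) (dl0 : (0 <= dl)%R).
Hypothesis cl : close dl.
Variables (rho : 'cV[R]_d -> R) (k : nat) (tau : R).
Hypotheses (ur : unit_convex rho) (kn : (k < n)%N) (tau0 : (0 < tau)%R).
Hypothesis sg_tau : (sg k <= tau)%R.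

Let psi x : R := fine (itA k (ind rho) x).

Let ui : ubmeas (ind rho). Proof. exact: ubmeas_ind. Qed.
Let uit : ubmeas (itA k (ind rho)). Proof. exact: ubmeas_it. Qed.

Let psiE x : (psi x)%:E = itA k (ind rho) x.
Proof. by rewrite fineK//; exact: ubmeas_fin. Qed.

Let psi_meas : vmeas (EFin \o psi).
Proof.
move=> dU U Y mY; apply/measurable_EFinP.
exact: (measurableT_comp (fine_measurable measurableT) (uit.1.1 _ _ _ mY)).
Qed.

Let psi01 x : (0 <= psi x <= 1)%R.
Proof. by rewrite -!lee_fin psiE uit.1.2 uit.2. Qed.

(** A shift by [tau *: z] changes the indicator on a shell of half-width [tau * enorm z] at most;
    [sg k <= tau] then expresses the bound of [itA_shell] through [tau]. *)
Let psi_near z : (`|psi (tau *: z) - psi 0| <=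
  96 * rd * tau * enorm z + (192 * rd ^+ 2 * tau + 3 * dl))%R.
Proof.
have q0 : (0 <= tau * enorm z)%R by rewrite mulr_ge0 ?enorm_ge0// ltW.
have us := (ubmeas_shl (tau * enorm z) ur).1.
have := itA_shell gZ d0 mV n0 cl 0%R ur kn q0.
have us' : ubmeas (itA k (shl rho (tau * enorm z))) by apply: ubmeas_it => //; exact: ubmeas_shl.
set s := itA k _ _ => hs.
have lip y : (`|rho (tau *: z + y) - rho y| <= tau * enorm z)%R.
  have [l _] := ur; apply: le_trans (l _ _) _.
  by rewrite addrK enormZ gtr0_norm.
have niz : nmeas (fun y => ind rho (tau *: z + y)) by apply: nmeas_shift; exact: ui.1.
have nsum f g : nmeas f -> nmeas g -> nmeas (fun y : 'cV[R]_d => f y + g y).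
  move=> nf ng; split => [dU U Y mY|y]; last by apply: adde_ge0; [exact: nf.2|exact: ng.2].
  by apply: emeasurable_funD; [exact: nf.1|exact: ng.1].
have e0 : itA k (ind rho) (tau *: z) = itA k (fun y => ind rho (tau *: z + y)) 0.
  by rewrite -itA_shift addr0.
have h1 : itA k (ind rho) (tau *: z) <= itA k (ind rho) 0 + s.
  rewrite e0 /s -itAD//; last exact: ui.1.
  apply: itA_le => //; first by apply: nsum => //; exact: ui.1.
  move=> y; rewrite /ind /shl -EFinD lee_fin -natrD ler_nat.
  have := lip y; rewrite ler_norml => /andP[l1 l2].
  case: leP => //= a; case: leP => //= b.
  by rewrite add0n lt0b ler_norml; apply/andP; split; lra.
have h2 : itA k (ind rho) 0 <= itA k (ind rho) (tau *: z) + s.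
  rewrite e0 /s -itAD//; apply: itA_le => //; [exact: ui.1|exact: nsum|].
  move=> y; rewrite /ind /shl -EFinD lee_fin -natrD ler_nat.
  have := lip y; rewrite ler_norml => /andP[l1 l2].
  case: leP => //= a; case: leP => //= b.
  by rewrite add0n lt0b ler_norml; apply/andP; split; lra.
have sfin : s \is a fin_num by exact: ubmeas_fin.
move: hs h1 h2; rewrite -!psiE -(fineK sfin) -!EFinD !lee_fin => hs h1 h2.
have rd0 : (0 < rd)%R by exact: rd_gt0.
have : (rd ^+ 2 * sg k <= rd ^+ 2 * tau)%R by rewrite ler_wpM2l// sqr_ge0.
have hsE : (96 * rd * (tau * enorm z + 2 * rd * sg k) + 8 / 3 * dl =
  96 * rd * tau * enorm z + 192 * (rd ^+ 2 * sg k) + 8 / 3 * dl)%R by ring.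
have e3 : (192 * rd ^+ 2 * tau = 192 * (rd ^+ 2 * tau))%R by ring.
have := dl0; move: hs; rewrite hsE e3 => hs dl0' h3.
by rewrite ler_norml; apply/andP; split; lra.
Qed.

(** One step is exchanged for a Gaussian one, with the same noise [tau] on both sides. In 288 = 96 +
    192 the first part comes from the mean of [enorm (Z w)], the second from the constant in
    [psi_near]. *)
Lemma swap_step : (`|fine (itA k.+1 (opG tau (ind rho)) 0) -
    fine (itA k (opG h (opG tau (ind rho))) 0)| <=
  Krem * (h / tau) ^+ 3 * (beta + gauss_beta) * (288 * rd ^+ 2 * tau + 3 * dl))%R.
Proof.
have rd0 : (0 < rd)%R by exact: rd_gt0.
have al0 : (0 <= 96 * rd * tau)%R by rewrite !mulr_ge0 ?(ltW rd0) ?(ltW tau0).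
have ga0 : (0 <= 192 * rd ^+ 2 * tau + 3 * dl)%R.
  apply: addr_ge0; last by rewrite mulr_ge0.
  by apply: mulr_ge0; [apply: mulr_ge0; [exact: ler0n|exact: sqr_ge0]|exact: ltW].
have := smoothed_compare gZ d0 psi_meas psi01 tau0 al0 ga0 psi_near sV
  (gauss_standardized gZ d0) (@hstep_gt0 R n n0).
have smE v : smoothed P Z psi tau v = fine (opG tau (itA k (ind rho)) v).
  rewrite /smoothed /Rintegral; congr fine; apply: eq_integral => w _.
  exact: psiE.
have uG : ubmeas (opG tau (itA k (ind rho))) by exact: ubmeas_G.
have -> : (\int[Q]_s smoothed P Z psi tau (h *: V s))%R =
    fine (itA k.+1 (opG tau (ind rho)) 0).
  rewrite /Rintegral; congr fine; rewrite /= itA_G//; last exact: ui.1.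
  apply: eq_integral => s _; rewrite smE fineK ?add0r//; exact: ubmeas_fin.
have -> : (\int[P]_s smoothed P Z psi tau (h *: Z s))%R =
    fine (itA k (opG h (opG tau (ind rho))) 0).
  rewrite /Rintegral; congr fine; rewrite itA_G//; last by apply: nmeas_G => //; exact: ui.1.
  rewrite itA_G//; last exact: ui.1.
  apply: eq_integral => s _; rewrite smE fineK ?add0r//; exact: ubmeas_fin.
move=> /le_trans; apply; rewrite le_eqVlt; apply/orP; left; apply/eqP.
rewrite /gauss_beta; ring.
Qed.

End swap.

Definition harm (m : nat) : R := (\sum_(j < m) (j.+1%:R)^-1)%R.

Lemma harm_ge1 m : (0 < m)%N -> (1 <= harm m)%R.
Proof.
by case: m => // m _; rewrite /harm big_ord_recl/= invr1 lerDl sumr_ge0.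
Qed.

Lemma harm_rev m : (m <= n)%N -> (\sum_(k < m) ((n - k)%:R)^-1 <= harm n)%R.
Proof.
move=> mn; apply: (@le_trans _ _ (\sum_(k < n) ((n - k)%:R)^-1)%R).
  rewrite -(big_mkord xpredT (fun k => ((n - k)%:R)^-1)%R).
  rewrite -(big_mkord xpredT (fun k => ((n - k)%:R)^-1)%R).
  by rewrite [leRHS](big_cat_nat (n := m))//= lerDl sumr_ge0.
rewrite (reindex_inj rev_ord_inj)/=; apply: ler_sum => j _.
by rewrite subKn.
Qed.

Section smoothing.
Variables (dl e1 : R) (dl0 : (0 <= dl)%R) (e11 : (1 <= e1)%R).
Hypothesis cl : close dl.

Let eps : R := (e1 * h)%R.
Let h0 : (0 < h)%R. Proof. exact: hstep_gt0. Qed.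
Let e10 : (0 < e1)%R. Proof. by have := e11; lra. Qed.
Let eps0 : (0 < eps)%R. Proof. by rewrite mulr_gt0//; exact: e10. Qed.

(** Scale of all the Gaussian noise present in hybrid [k]: initial smoothing and remaining Gaussian
    steps. It never falls below [h]. *)
Let tau k : R := Num.sqrt (eps ^+ 2 + sg k ^+ 2).

Let tau_sqr k : (tau k ^+ 2 = eps ^+ 2 + sg k ^+ 2)%R.
Proof. by rewrite sqr_sqrtr// addr_ge0// sqr_ge0. Qed.

Let tau_gt0 k : (0 < tau k)%R.
Proof. by rewrite sqrtr_gt0 ltr_pwDl ?sqr_ge0// exprn_gt0. Qed.

(** In the cost of a swap, [(h / t) ^+ 3 * t] is [h * (h / t) ^+ 2] and [(h / t) ^+ 3] is at most
    [(h / t) ^+ 2 / e1]; the common factor [(h / t) ^+ 2] is summed separately. *)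
Let K : R := (Krem * (beta + gauss_beta) * (288 * rd ^+ 2 * h + 3 * dl / e1))%R.

Let K_ge0 : (0 <= K)%R.
Proof.
rewrite /K; apply: mulr_ge0; first exact: KB_ge0.
apply: addr_ge0.
  by apply: mulr_ge0; [apply: mulr_ge0; [exact: ler0n|exact: sqr_ge0]|exact: ltW].
by rewrite divr_ge0 ?(ltW e10)// mulr_ge0// dl0.
Qed.

Let tele rho m : unit_convex rho -> (m <= n)%N ->
  (`|fine (itA m (opG (tau m) (ind rho)) 0) - fine (opG (tau 0) (ind rho) 0)| <=
   \sum_(k < m) K / (n - k)%:R)%R.
Proof.
move=> ur; elim: m => [|m ih] mn; first by rewrite subrr normr0 big_ord0.
have ni := (ubmeas_ind ur).1.
have hh : (h ^+ 2 <= eps ^+ 2)%R.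
  by rewrite lerXn2r ?nnegrE ?(ltW h0) ?(ltW eps0)// ler_peMl// ltW.
(* Since [h <= eps], the initial smoothing makes up for the Gaussian step that [tau m.+1] lacks. *)
have sgt : (sg m <= tau m.+1)%R.
  rewrite -(ler_pXn2r (ltn0Sn 1)) ?nnegrE ?sg_ge0 ?(ltW (tau_gt0 _))//.
  by rewrite tau_sqr (@sg_step R n m mn) lerD2r.
have := swap_step dl0 cl ur mn (tau_gt0 m.+1) sgt.
have -> : opG h (opG (tau m.+1) (ind rho)) = opG (tau m) (ind rho).
  apply: G_semigroup => //; rewrite ?(ltW h0) ?(ltW (tau_gt0 _))//.
  by rewrite !tau_sqr (@sg_step R n m mn) addrCA addrA.
rewrite big_ord_recr/=; have := ih (ltnW mn).
set a := fine (itA m.+1 _ _); set b := fine (itA m _ _); set c := fine _ => h1 h2.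
have -> : (a - c = (b - c) + (a - b))%R by ring.
apply: le_trans (ler_normD _ _) _; apply: lerD => //; apply: le_trans h2 _.
set t := tau m.+1; have t0 : (0 < t)%R := tau_gt0 m.+1.
have t2 : (t ^+ 2 = eps ^+ 2 + sg m.+1 ^+ 2)%R := tau_sqr m.+1.
have nm : (0 < (n - m)%:R :> R)%R by rewrite ltr0n subn_gt0.
have nn0 : (0 < n%:R :> R)%R by rewrite ltr0n.
have r2 : ((h / t) ^+ 2 <= ((n - m)%:R)^-1)%R.
  rewrite exprMn (exprVn t) t2 ler_pdivrMr ?ltr_pwDl ?sqr_ge0 ?exprn_gt0//.
  rewrite mulrC ler_pdivlMr// -[leLHS]mulrC.
  have -> : ((n - m)%:R = 1 + (n - m.+1)%:R :> R)%R.
    have -> : (n - m = (n - m.+1).+1)%N by rewrite -subSn// subSS.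
    by rewrite -natr1 addrC.
  rewrite mulrDl mul1r lerD// sg_sqr hstep_sqr//.
have r1 : (h / t <= e1^-1)%R.
  rewrite ler_pdivrMr// mulrC ler_pdivlMr; last exact: e10.
  rewrite -(ler_pXn2r (ltn0Sn 1)) ?nnegrE ?(ltW t0)//; last by rewrite mulr_ge0 ?(ltW h0)// ltW// e10.
  by rewrite t2 (mulrC h) lerDl sqr_ge0.
have ht0 : (0 <= h / t)%R by rewrite divr_ge0 ?(ltW h0) ?(ltW t0).
have -> : (Krem * (h / t) ^+ 3 * (beta + gauss_beta) * (288 * rd ^+ 2 * t + 3 * dl) =
  Krem * (beta + gauss_beta) * ((288 * rd ^+ 2 * h + 3 * dl * (h / t)) * (h / t) ^+ 2))%R.
  by field; rewrite gt_eqF.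
rewrite /K -[leRHS]mulrA; apply: ler_wpM2l; first exact: KB_ge0.
apply: ler_pM.
- apply: addr_ge0.
    by apply: mulr_ge0; [apply: mulr_ge0; [exact: ler0n|exact: sqr_ge0]|exact: ltW].
  by rewrite mulr_ge0// mulr_ge0// dl0.
- exact: sqr_ge0.
- by rewrite lerD2l; apply: ler_wpM2l => //; rewrite mulr_ge0// dl0.
- exact: r2.
Qed.

Let smooth_close rho m : unit_convex rho -> (m <= n)%N ->
  (`|fine (hyb m (opG eps (ind rho)) 0) - fine (opG 1 (opG eps (ind rho)) 0)| <=
   K * harm n)%R.
Proof.
move=> ur mn; have ni := (ubmeas_ind ur).1.
have e k : opG (sg k) (opG eps (ind rho)) = opG (tau k) (ind rho).
  by apply: G_semigroup => //; rewrite ?sg_ge0 ?(ltW eps0) ?(ltW (tau_gt0 _))// tau_sqr addrC.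
have := tele ur mn; rewrite /hyb e -[in opG 1 _](@sg0 R n n0) e => /le_trans; apply.
by rewrite -mulr_sumr ler_wpM2l// harm_rev.
Qed.

Let r : R := (2 * rd * eps)%R.

(* If [X] is at least [t] on the event that the smoothing noise is moderate,
   whose probability is at least 3/4, and at least [- dl] elsewhere, then a
   bound on its mean is a bound on [t]. *)
Let recover (X : T -> R) (t E : R) : P.-integrable setT (EFin \o X) ->
  (0 <= E)%R ->
  (forall w, (enorm (Z w) <= 2 * rd)%R -> (t <= X w)%R) ->
  (forall w, (- dl <= X w)%R) -> (\int[P]_w X w <= E)%R ->
  (t <= 4 / 3 * E + dl / 3)%R.
Proof.
move=> iX E0 Xt Xdl XE; have [t0|t0] := leP t 0%R; first by have := dl0; lra.
pose B := [set w | (2 * rd < enorm (Z w))%R].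
have mB : measurable B by apply: measurable_gt_cst; exact: measurable_enorm.
have PB : (fine (P B) <= 1 / 4)%R.
  rewrite -lee_fin fineK ?fin_num_measure//; exact: gauss_enorm_tail.
have iB : P.-integrable setT (EFin \o (fun w => (t + dl) * \1_B w))%R.
  by apply: integrableZr; exact: integrable_indic.
have : (\int[P]_w (t - (t + dl) * \1_B w) <= \int[P]_w X w)%R.
  apply: le_Rintegral => //.
    by apply: integrableBr => //; exact: integrable_cstP.
  move=> w _; rewrite indicE; have [|/negP] := boolP (w \in B); rewrite inE /B/=.
    by move=> _; have := Xdl w; lra.
  by move=> /negP; rewrite -leNgt => /Xt; lra.
rewrite RintegralB//; last exact: integrable_cstP.
rewrite Rintegral_cstP RintegralZl//; last exact: integrable_indic.
rewrite Rintegral_indicP// => hX.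
have := fine_ge0 (measure_ge0 P B); have := dl0; nra.
Qed.

(* Swapping the steps one by one costs [K / (n - k)] at step [k], because the
   Taylor remainder only matters where the hybrid lies in a shell around the
   zero set of [rho], whose probability is controlled through [dl]. *)
Lemma smoothing_step rho m : unit_convex rho -> (m <= n)%N ->
  (`|fine (hyb m (ind rho) 0) - fine (opG 1 (ind rho) 0)| <=
   4 / 3 * (K * harm n) + dl / 3 + 48 * rd * r)%R.
Proof.
move=> ur mn.
have rd0 : (0 < rd)%R by exact: rd_gt0.
have r0 : (0 < r)%R by rewrite !mulr_gt0.
have KH0 : (0 <= K * harm n)%R by rewrite mulr_ge0//; have := harm_ge1 n0; lra.
have mid (f : 'cV[R]_d -> \bar R) (nf : nmeas f) : vmeas (EFin \o (fine \o f)).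
  move=> dU U Y mY; apply/measurable_EFinP.
  exact: (measurableT_comp (fine_measurable measurableT) (nf.1 _ _ _ mY)).
have uH f : ubmeas f -> ubmeas (hyb m f) by move=> uf; exact: ubmeas_hyb.
have uM f : ubmeas f -> ubmeas (opG 1 f) by move=> uf; exact: ubmeas_G.
have int_ub f : ubmeas f ->
    P.-integrable setT (EFin \o (fun w => fine (f (eps *: Z w)%R))).
  move=> uf; apply: (integrable_dom _ _ (integrable_cstP P 1%R)).
    by apply/measurable_EFinP; apply: (mid f uf.1); exact: random_vectorZ.
  move=> w; have ff := ubmeas_fin (eps *: Z w)%R uf.
  by rewrite ger0_norm -lee_fin fineK//; [exact: uf.2|exact: uf.1.2].
pose X rho' w := (fine (hyb m (ind rho') (eps *: Z w)) - fine (opG 1 (ind rho') (eps *: Z w)))%R.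
have iX rho' : unit_convex rho' -> P.-integrable setT (EFin \o X rho').
  by move=> ur'; apply: integrableBr; apply: int_ub; [apply: uH|apply: uM]; exact: ubmeas_ind.
have XE rho' : unit_convex rho' -> (`|\int[P]_w X rho' w| <= K * harm n)%R.
  move=> ur'; have ui := ubmeas_ind ur'.
  have := smooth_close ur' mn; rewrite hyb_G//; last exact: ui.1.
  rewrite (G_comm gZ 1%R eps ui.1).
  have opE f : ubmeas f -> fine (opG eps f 0%R) = (\int[P]_w fine (f (eps *: Z w)))%R.
    move=> uf; rewrite /Rintegral; congr fine; apply: eq_integral => w _.
    by rewrite add0r fineK//; exact: ubmeas_fin.
  rewrite !opE; [|exact: uM|exact: uH].
  by rewrite /X RintegralB//; apply: int_ub; [exact: uH|exact: uM].
have Xdl rho' w : unit_convex rho' -> (`|X rho' w| <= dl)%R.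
  move=> ur'; have ui := ubmeas_ind ur'.
  have [] := close_shift n0 cl (eps *: Z w)%R ur' mn.
  rewrite -(fineK (ubmeas_fin (eps *: Z w)%R (uH _ ui))).
  rewrite -(fineK (ubmeas_fin (eps *: Z w)%R (uM _ ui))) -!EFinD !lee_fin /X.
  by move=> l1 l2; rewrite ler_norml; apply/andP; split; lra.
pose a := fine (hyb m (ind rho) 0%R); pose b := fine (opG 1 (ind rho) 0%R).
have aE : a%:E = hyb m (ind rho) 0%R.
  by rewrite fineK//; apply: ubmeas_fin; apply: uH; exact: ubmeas_ind.
have bE : b%:E = opG 1 (ind rho) 0%R.
  by rewrite fineK//; apply: ubmeas_fin; apply: uM; exact: ubmeas_ind.
have lip w y : (enorm (Z w) <= 2 * rd)%R -> (`|rho (eps *: Z w + y) - rho y| <= r)%R.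
  move=> zw; have [l _] := ur; apply: le_trans (l _ _) _.
  by rewrite addrK enormZ (gtr0_norm eps0) /r mulrC ler_wpM2r// ltW.
(* A moderate smoothing displacement changes [rho] by at most [r], so that moving the level by [r]
   makes smoothed and unsmoothed indicators comparable. On the Gaussian side the change of level
   costs a shell of half-width [r]. *)
pose rp y := (rho y - r)%R; pose rm y := (rho y - - r)%R.
have up : unit_convex rp by exact: unit_convexB.
have um : unit_convex rm by exact: unit_convexB.
have ni rho' : unit_convex rho' -> nmeas (ind rho') by move=> /ubmeas_ind[].
have nsh rho' x : unit_convex rho' -> nmeas (fun y => ind rho' (x + y)%R).
  by move=> /ni; exact: nmeas_shift.
have Gsh f x : opG 1 f x = opG 1 (fun y => f (x + y)%R) 0%R.
  by rewrite /opG op_shift addr0.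
have Hsh f x : hyb m f x = hyb m (fun y => f (x + y)%R) 0%R.
  by rewrite -hyb_shift addr0.
have shell (c : R) : opG 1 (shl (fun y => rho y - c)%R r) 0 <= (48 * rd * r)%:E.
  by apply: (opG1_shell gZ d0 0%R (unit_convexB c ur) r0).
have nsh2 c : nmeas (fun y => ind rho y + shl (fun y => rho y - c)%R r y).
  have n1 := (ni rho ur); have n2 := (ubmeas_shl r (unit_convexB c ur)).1.
  split => [dU U Y mY|y]; last by apply: adde_ge0; [exact: n1.2|exact: n2.2].
  by apply: emeasurable_funD; [exact: n1.1|exact: n2.1].
have fG rho' x : unit_convex rho' -> (fine (opG 1 (ind rho') x))%:E = opG 1 (ind rho') x.
  by move=> ur'; rewrite fineK//; apply: ubmeas_fin; apply: uM; exact: ubmeas_ind.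
have fH rho' x : unit_convex rho' -> (fine (hyb m (ind rho') x))%:E = hyb m (ind rho') x.
  by move=> ur'; rewrite fineK//; apply: ubmeas_fin; apply: uH; exact: ubmeas_ind.
have up1 : (a - b - 48 * rd * r <= 4 / 3 * (K * harm n) + dl / 3)%R.
  apply: (recover (iX _ up) KH0) => [w zw|w|]; last 2 first.
  - by have := Xdl rp w up; rewrite ler_norml => /andP[].
  - exact: le_trans (ler_norm _) (XE _ up).
  have ha : (a <= fine (hyb m (ind rp) (eps *: Z w)))%R.
    rewrite -lee_fin aE fH// [leRHS]Hsh; apply: (hyb_le gZ Q mV) => //; [exact: ni|exact: nsh|].
    move=> y; rewrite /ind /rp lee_fin ler_nat.
    have := lip w y zw; rewrite ler_norml => /andP[l1 l2].
    by case: leP => //= a1; case: leP => //= b1; lra.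
  have hb : (fine (opG 1 (ind rp) (eps *: Z w)) <= b + 48 * rd * r)%R.
    rewrite -lee_fin fG// Gsh EFinD bE.
    apply: (@le_trans _ _ (opG 1 (fun y => ind rho y + shl (fun y => rho y - r)%R r y) 0%R)).
      apply: op_le => //; [exact: random_vectorZ|exact: nsh|].
      move=> y; rewrite /ind /shl /rp -EFinD lee_fin -natrD ler_nat.
      have := lip w y zw; rewrite ler_norml => /andP[l1 l2].
      case: leP => //= a1; case: leP => //= b1.
      by rewrite add0n lt0b ler_norml; apply/andP; split; lra.
    rewrite /opG opD//; [|exact: random_vectorZ|exact: ni|exact: (ubmeas_shl r (unit_convexB r ur)).1].
    by rewrite leeD2l//; exact: shell.
  by rewrite /X; lra.
have um1 : (b - a - 48 * rd * r <= 4 / 3 * (K * harm n) + dl / 3)%R.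
  have iN : P.-integrable setT (EFin \o (fun w => - X rm w)%R).
    have := integrableZr (-1)%R (iX _ um); congr (P.-integrable _ _).
    by apply/funext => w /=; rewrite mulN1r.
  apply: (recover iN KH0) => [w zw|w|]; last 2 first.
  - by have := Xdl rm w um; rewrite ler_norml => /andP[_ h1]; lra.
  - have -> : (\int[P]_w (- X rm w) = - \int[P]_w X rm w)%R.
      rewrite -mulN1r -RintegralZl//; last exact: iX.
      by apply: eq_Rintegral => w _; rewrite mulN1r.
    by apply: le_trans (ler_norm _) _; rewrite normrN; exact: XE.
  have ha : (fine (hyb m (ind rm) (eps *: Z w)) <= a)%R.
    rewrite -lee_fin aE fH// Hsh; apply: (hyb_le gZ Q mV) => //; [exact: nsh|exact: ni|].
    move=> y; rewrite /ind /rm lee_fin ler_nat.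
    have := lip w y zw; rewrite ler_norml => /andP[l1 l2].
    by case: leP => //= a1; case: leP => //= b1; lra.
  have hb : (b <= fine (opG 1 (ind rm) (eps *: Z w)) + 48 * rd * r)%R.
    have n1 : nmeas (fun y => ind rm (eps *: Z w + y)) by exact: nsh.
    have n2 := (ubmeas_shl r (unit_convexB (- r)%R ur)).1.
    rewrite -lee_fin bE EFinD fG// [X in _ <= X + _]Gsh.
    apply: (@le_trans _ _ (opG 1 (fun y => ind rm (eps *: Z w + y) +
        shl (fun y => rho y - - r)%R r y) 0%R)).
      apply: op_le => //; [exact: random_vectorZ|exact: ni| |].
        split => [dU U Y mY|y]; last by apply: adde_ge0; [exact: n1.2|exact: n2.2].
        by apply: emeasurable_funD; [exact: n1.1|exact: n2.1].
      move=> y; rewrite /ind /shl /rm -EFinD lee_fin -natrD ler_nat.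
      have := lip w y zw; rewrite ler_norml => /andP[l1 l2].
      case: leP => //= a1; case: leP => //= b1.
      by rewrite add0n lt0b ler_norml; apply/andP; split; lra.
    rewrite /opG opD//; last exact: random_vectorZ.
    by rewrite leeD2l//; exact: shell.
  by rewrite /X; lra.
by rewrite -/a -/b ler_norml; apply/andP; split; lra.
Qed.

End smoothing.

End BerryEsseen.

Section BerryEsseenBound.
Local Open Scope ereal_scope.
Context {R : realType} {d : nat} {dT : measure_display} {T : measurableType dT}.
Variables (P : probability T R) (Z : T -> 'cV[R]_d).
Hypothesis gZ : std_gaussian P Z.
Hypothesis d0 : (0 < d)%N.
Local Notation rd := (Num.sqrt d%:R : R).
Context {dS : measure_display} {S : measurableType dS}.
Variables (Q : probability S R) (V : S -> 'cV[R]_d) (beta : R).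
Hypothesis sV : standardized Q V beta.
Variable n : nat.
Hypothesis n0 : (0 < n)%N.

Local Notation h := (@hstep R n).
Local Notation close := (close P Z Q V n).
Local Notation bG := (beta + @gauss_beta R d)%R.
Local Notation H := (@harm R n).

Let mZ : random_vector Z. Proof. by case: gZ. Qed.
Let mV : random_vector V. Proof. by case: sV. Qed.

Let beta_ge0 : (0 <= beta)%R.
Proof.
case: sV => _ _ _ _; apply: le_trans; apply: Rintegral_ge0 => s _.
by rewrite exprn_ge0// enorm_ge0.
Qed.

Let bG_ge1 : (1 <= bG)%R.
Proof. by have := beta_ge0; have := @gauss_beta_ge1 R d d0; lra. Qed.

Let H_ge1 : (1 <= H)%R. Proof. exact: harm_ge1. Qed.

(** Here 2688 = 4/3 * 288 + 48 * 2 * 24: the swaps, and the removal of a smoothing of scale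
    [24 * (Krem * bG * H) * h]. *)
Let a : R := (2688 * Krem * bG * H * rd ^+ 2 * h)%R.

Let close1 : close 1.
Proof.
move=> rho k ur kn; have ui := ubmeas_ind ur.
have u1 : ubmeas (hyb P Z Q V n k (ind rho)) by exact: ubmeas_hyb.
have u2 : ubmeas (opG P Z 1 (ind rho)) by exact: ubmeas_G.
split; apply: (@le_trans _ _ 1); first exact: u1.2.
- by rewrite leeDr// u2.1.2.
- exact: u2.2.
- by rewrite leeDr// u1.1.2.
Qed.

Let close_improve dl : (0 <= dl)%R -> close dl -> close (a + dl / 2)%R.
Proof.
move=> dl0 cl rho k ur kn; have ui := ubmeas_ind ur.
have fk : hyb P Z Q V n k (ind rho) 0%R \is a fin_num.
  by apply: ubmeas_fin; exact: ubmeas_hyb.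
have fg : opG P Z 1 (ind rho) 0%R \is a fin_num.
  by apply: ubmeas_fin; exact: ubmeas_G.
(* With [e1 = 24 * B] the a priori error enters with the coefficient 4/3 * 3/24 + 1/3 = 1/2. *)
pose B : R := (Krem * bG * H)%R.
have B1 : (1 / 24 <= B)%R.
  have k1 : (1 <= Krem :> R)%R by rewrite /Krem; have := expR_gt0 (4 : R); lra.
  have := bG_ge1; have := H_ge1 => h1 b1.
  have : (1 <= Krem * bG :> R)%R by exact: mulr_ege1.
  by move=> h2; have := mulr_ege1 h2 h1; rewrite -/B; lra.
have e11 : (1 <= 24 * B)%R by lra.
have := smoothing_step gZ d0 sV n0 dl0 e11 cl ur kn.
have -> : (4 / 3 * (Krem * bG * (288 * rd ^+ 2 * h + 3 * dl / (24 * B)) * H) + dl / 3 +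
    48 * rd * (2 * rd * (24 * B * h)) = a + dl / 2)%R.
  have -> : (Krem * bG * (288 * rd ^+ 2 * h + 3 * dl / (24 * B)) * H =
     B * (288 * rd ^+ 2 * h + 3 * dl / (24 * B)))%R by rewrite /B; ring.
  have -> : (a = 2688 * B * rd ^+ 2 * h)%R by rewrite /a /B; ring.
  by field; lra.
move=> hh; rewrite -(fineK fk) -(fineK fg) -!EFinD !lee_fin.
by move: hh; rewrite ler_norml => /andP[]; split; lra.
Qed.

Let a_ge0 : (0 <= a)%R.
Proof.
have b1 := bG_ge1; have h1 := H_ge1; have k1 := @Krem_gt0 R.
rewrite /a -2!(mulrA 2688%R).
apply: mulr_ge0; last exact/ltW/hstep_gt0.
apply: mulr_ge0; last exact: sqr_ge0.
by apply: mulr_ge0; [exact: ler0n|rewrite !mulr_ge0//; lra].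
Qed.

(** [2 * a] is the fixed point of the map from [dl] to [a + dl / 2], and each improvement halves the
    distance to it. *)
Let close_iter j : close (2 * a + (2^-1) ^+ j)%R.
Proof.
elim: j => [|j ih].
  have := a_ge0 => a0 rho k ur kn; have [h1 h2] := close1 ur kn.
  rewrite expr0; split; [apply: le_trans h1 _|apply: le_trans h2 _];
    by apply: leeD2l; rewrite lee_fin; lra.
have -> : (2 * a + 2^-1 ^+ j.+1 = a + (2 * a + 2^-1 ^+ j) / 2)%R.
  by rewrite exprS; field.
apply: close_improve => //; apply: addr_ge0; last exact: exprn_ge0.
by have := a_ge0; lra.
Qed.

Lemma BerryEsseen_op rho : unit_convex rho ->
  (`|fine (itA Q V n n (ind rho) 0) - fine (opG P Z 1 (ind rho) 0)| <=
   5376 * Krem * bG * H * rd ^+ 2 * h)%R.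
Proof.
move=> ur; have ui := ubmeas_ind ur.
have fk : itA Q V n n (ind rho) 0%R \is a fin_num.
  by apply: ubmeas_fin; exact: ubmeas_it.
have fg : opG P Z 1 (ind rho) 0%R \is a fin_num.
  by apply: ubmeas_fin; exact: ubmeas_G.
have -> : (5376 * Krem * bG * H * rd ^+ 2 * h = 2 * a)%R by rewrite /a; ring.
have lim : forall e : R, (0 < e)%R -> exists j, ((2^-1) ^+ j <= e)%R.
  move=> e e0; exists (Num.bound (e^-1)).
  have e1 : (0 <= e^-1)%R by rewrite invr_ge0 ltW.
  have := archi_boundP e1; move: (Num.bound _) => j ej.
  have j2 : (j%:R <= 2 ^+ j :> R)%R by rewrite -natrX ler_nat ltnW// ltn_expl.
  rewrite exprVn -[leRHS]invrK lef_pV2 ?posrE ?invr_gt0 ?exprn_gt0//.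
  exact: le_trans (ltW ej) j2.
apply/ler_addgt0Pr => e e0; have [j je] := lim e e0.
have [h1 h2] := close_iter j ur (leqnn n).
move: h1 h2; rewrite hybn// -(fineK fk) -(fineK fg) -!EFinD !lee_fin => h1 h2.
by rewrite ler_norml; apply/andP; split; lra.
Qed.

End BerryEsseenBound.

Section BerryEsseenProbability.
Local Open Scope ereal_scope.
Context {R : realType} {d : nat}.
Implicit Types (rho : 'cV[R]_d -> R).

Lemma prob_ind {dT} {T : measurableType dT} (P : probability T R)
    (Y : T -> 'cV[R]_d) rho : random_vector Y -> unit_convex rho ->
  P [set w | (rho (Y w) <= 0)%R] = op P Y (ind rho) 0%R.
Proof.
move=> mY ur; have mA : measurable [set w | (rho (Y w) <= 0)%R].
  apply: measurable_le_cst; apply/measurable_EFinP.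
  exact: (unit_convex_vmeas ur mY).
rewrite -[P _]mul1e -integral_cst// integral_mkcond; apply: eq_integral => w _.
rewrite patchE /ind add0r; case: ifPn => [|/negP]; rewrite inE/=; first by move=> ->.
by move=> /negP/negbTE ->.
Qed.

Context {dT dS dU : measure_display} {T : measurableType dT}
  {S : measurableType dS} {U : measurableType dU}.
Variables (P : probability T R) (P' : probability U R) (Z : U -> 'cV[R]_d).
Hypothesis gZ : std_gaussian P' Z.
Hypothesis d0 : (0 < d)%N.
Variable n : nat.
Hypothesis n0 : (0 < n)%N.
Variables (X : T -> S) (Y : 'I_n -> T -> S).
Hypothesis mX : measurable_fun setT X.
Hypothesis mY : forall i, measurable_fun setT (Y i).
Hypothesis ind_Y : mutually_independent P Y.
Hypothesis law_Y : forall i B, measurable B -> P (Y i @^-1` B) = P (X @^-1` B).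
Variables (V : S -> 'cV[R]_d) (beta : R).
Hypothesis mV : random_vector V.
Hypothesis sV : standardized P (V \o X) beta.

Local Notation h := (@hstep R n).

Let mVX : random_vector (V \o X). Proof. by case: sV. Qed.

Let foldr_itA (f : 'cV[R]_d -> \bar R) (s : seq 'I_n) : nmeas f ->
  foldr (fun i => op P (fun w => h *: V (Y i w))%R) f s =
  itA P (V \o X) n (size s) f.
Proof.
move=> nf; elim: s => //= i s ->.
have nA : nmeas (itA P (V \o X) n (size s) f) by exact: nmeas_it.
apply/funext => x; rewrite /opA /op.
apply: (law_integral (g := fun s => itA P (V \o X) n _ f (x + h *: V s)%R)) => //.
- by move=> B; exact: law_Y.
- by apply: nmeas_measurable => //; exact: random_vectorZ.
- by move=> y; exact: nA.2.
Qed.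

Theorem BerryEsseen rho : unit_convex rho ->
  (`|fine (P [set w | rho (\sum_(i < n) h *: V (Y i w)) <= 0]) -
     fine (P' [set w | rho (Z w) <= 0])| <=
   5376 * Krem * (beta + @gauss_beta R d) * @harm R n * d%:R * h)%R.
Proof.
move=> ur; have ui := ubmeas_ind ur.
have mZ : random_vector Z by case: gZ.
have mhV : forall i : 'I_n, random_vector (fun s => h *: V s)%R.
  by move=> i; exact: random_vectorZ.
rewrite (prob_ind P' mZ ur) prob_ind//; last first.
  apply: random_vector_sum => i; exact: (random_vector_comp (mY i) (mhV i)).
rewrite (op_sum_indep mY ind_Y mhV 0%R (index_enum_uniq _) ui.1).
rewrite foldr_itA; last exact: ui.1.
have -> : size (index_enum 'I_n) = n by rewrite -[RHS](size_enum_ord n) enumT.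
have := BerryEsseen_op gZ d0 sV n0 ur; rewrite sqr_sqrtr ?ler0n//.
rewrite /opG (_ : (fun w : U => 1 *: Z w)%R = Z)//.
by apply/funext => w; rewrite scale1r.
Qed.

End BerryEsseenProbability.

Lemma harm_le {R : realType} n : (0 < n)%N -> @harm R n <= 1 + ln n%:R.
Proof.
case: n => // n _; elim: n => [|n ih].
  by rewrite /harm big_ord1 invr1 ln1 addr0.
rewrite /harm big_ord_recr/=; apply: le_trans (lerD ih (lexx _)) _.
rewrite -addrA lerD2l.
have n2 : 0 < n.+2%:R :> R by rewrite ltr0n.
have n1 : 0 < n.+1%:R :> R by rewrite ltr0n.
have : ln (n.+1%:R / n.+2%:R : R) <= n.+1%:R / n.+2%:R - 1.
  rewrite [X in ln X](_ : _ = 1 + (n.+1%:R / n.+2%:R - 1)); last by ring.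
  by apply: le_ln1Dx; rewrite -subr_gt0 opprK subrK divr_gt0.
rewrite ln_div ?posrE//.
have -> : n.+1%:R / n.+2%:R - 1 = - (n.+2%:R)^-1 :> R.
  rewrite -[X in _ - X](divff (_ : n.+2%:R != 0 :> R)) ?gt_eqF//.
  by rewrite -mulrBl -[n.+2%:R in X in X / _]natr1 opprD addNKr mulN1r.
by move=> hh; rewrite -lerBrDl -lerN2 opprB.
Qed.

(** * Symmetric matrices *)

Section Interpolation.
Context {F : fieldType}.

Lemma interpolation (g : F -> F) (s : seq F) :
  exists p : {poly F}, forall a, a \in s -> p.[a] = g a.
Proof.
elim: s => [|x s [p ih]]; first by exists 0.
have [xs|xs] := boolP (x \in s).
  by exists p => a; rewrite inE => /predU1P[->|]; exact: ih.
pose w := \prod_(a <- s) ('X - a%:P).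
have wx : w.[x] != 0 by rewrite -[_ == 0]/(root w x) root_prod_XsubC.
exists (p + ((g x - p.[x]) / w.[x])%:P * w) => a.
rewrite !hornerE inE => /predU1P[->|as_]; first by rewrite divfK// addrC subrK.
have /rootP -> : root w a by rewrite root_prod_XsubC.
by rewrite mulr0 addr0 ih.
Qed.

End Interpolation.

Section RealSpectral.
Context {R : rcfType} {d : nat}.
Local Notation toC := (real_complex R).

(* A real symmetric matrix is diagonalizable with real eigenvalues; this is
   the only consequence that is needed. *)
Lemma symmetric_horner_mx (A : 'M[R]_d.+1) : A^T = A ->
  exists2 s : seq R, (forall a, a \in s -> eigenvalue A a) &
    forall r : {poly R}, (forall a, a \in s -> r.[a] = 0) -> horner_mx A r = 0.
Proof.
move=> sA; pose AC := map_mx toC A.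
have hA : AC \is hermsymmx.
  apply: realsym_hermsym; first by apply/is_hermitianmxP; rewrite expr0 scale1r map_mx_id// map_trmx sA.
  by apply/mxOverP => i j; rewrite mxE; apply/complex_realP; exists (A i j).
pose D := spectral_diag AC.
have AE := orthomx_spectralP (hermitian_normalmx hA).
have Dreal j : exists x, D 0 j = toC x.
  by apply/complex_realP; have /mxOverP := hermitian_spectral_diag_real hA; apply.
pose x j := projT1 (cid (Dreal j)).
have xE j : D 0 j = toC (x j) by rewrite /x; case: cid.
pose U := spectralmx AC; have uU : U \in unitmx := spectral_unit AC.
exists [seq x j | j <- enum 'I_d.+1] => [a /mapP[j _ ->]|r hr].
  (* Being an eigenvalue is a root condition on the characteristic polynomial, hence can be checked
     over the complex numbers. *)
  rewrite eigenvalue_root_char -(fmorph_root toC) map_char_poly.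
  rewrite -eigenvalue_root_char; apply/eigenvalueP; exists (row j U).
    rewrite -[map_mx _ A]/AC AE -/U -/D rowE !mulmxA mulmxK// -!mulmxA.
    by rewrite (mulmxA (delta_mx 0 j)) -rowE row_diag_mx -scalemxAl xE.
  apply/negP => /eqP r0; have : delta_mx 0 j = 0 :> 'rV[R[i]]_d.+1.
    by rewrite -(mulmxK uU (delta_mx 0 j)) -rowE r0 mul0mx.
  by move=> /rowP/(_ j); rewrite !mxE !eqxx => /eqP; rewrite oner_eq0.
apply: (@map_mx_inj _ _ toC); rewrite map_horner_mx map_mx0 -/AC AE.
rewrite (horner_mx_uconjC _ _ uU) horner_mx_diag.
rewrite (_ : map_mx _ _ = 0) ?linear0 ?mulmx0 ?mul0mx//.
by apply/rowP => j; rewrite !mxE xE horner_map/= hr ?rmorph0// map_f// mem_enum.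
Qed.

End RealSpectral.

Lemma dotv_mulmx {R : realType} {d : nat} (A : 'M[R]_d) (u v : 'cV[R]_d) :
  dotv u (A *m v) = dotv (A^T *m u) v.
Proof.
rewrite /dotv; under eq_bigr do rewrite mxE mulr_sumr.
rewrite exchange_big; apply: eq_bigr => j _; rewrite mxE mulr_suml.
by apply: eq_bigr => i _; rewrite mxE; ring.
Qed.

Section PositiveDefinite.
Context {R : realType} {d : nat}.
Implicit Types (A B S : 'M[R]_d) (v : 'cV[R]_d).

(* Both parts use polynomials in [S], interpolated on its spectrum: a square
   root of [S - lam] and a fourth root of the inverse of [S]. *)
Lemma lambda_min_sqrt S (lam : R) : S^T = S -> (forall v, 0 <= dotv v (S *m v)) ->
  0 < lam -> lam <= lambda_min S ->
  (forall v, lam * dotv v v <= dotv v (S *m v)) /\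
  exists2 B, posdefmx B & B *m B *m S = 1%:M.
Proof.
case: d S => [|d'] S sS pS lam0 lamS.
  split => [v|]; first by rewrite /dotv !big_ord0 mulr0.
  exists 0; last by apply/matrixP => -[].
  split => [|v]; first by rewrite trmx0.
  by move=> /eqP[]; apply/matrixP => -[].
have ev a : eigenvalue S a -> lam <= a.
  (* The infimum in [lambda_min] bounds the eigenvalues from below once their set has a lower bound;
     semidefiniteness gives 0. *)
  move=> Sa; apply: le_trans lamS _; apply: ge_inf => //; exists 0 => b /=.
  move=> /eigenvalueP[u ub u0]; have u0' : u^T != 0 by rewrite trmx_eq0.
  have := pS u^T; rewrite -[X in X *m _]sS -trmx_mul ub linearZ/= dotvZr.
  rewrite pmulr_lge0// lt_neqAle dotv_ge0 andbT eq_sym.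
  by apply/negP => /eqP /dotv_eq0 /eqP; apply/negP.
have [s sev vanish] := symmetric_horner_mx sS.
have trh (q : {poly R}) : (horner_mx S q)^T = horner_mx S q.
  elim/poly_ind: q => [|q c ih]; first by rewrite rmorph0 trmx0.
  rewrite rmorphD rmorphM/= horner_mx_X horner_mx_C linearD/= tr_scalar_mx.
  by rewrite trmx_mul ih sS; congr (_ + _); exact: comm_mx_horner.
have sqh (q : {poly R}) (v : 'cV_d'.+1) : dotv v (horner_mx S (q ^+ 2) *m v) =
    dotv (horner_mx S q *m v) (horner_mx S q *m v).
  by rewrite rmorphXn/= expr2 -[_ * _]/(_ *m _) -mulmxA dotv_mulmx trh.
split.
  have [p pE] := interpolation (fun a => Num.sqrt (a - lam)) s.
  have : horner_mx S (p ^+ 2 - ('X - lam%:P)) = 0.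
    apply: vanish => a as_; rewrite !hornerE pE// sqr_sqrtr ?subrr//.
    by rewrite subr_ge0 ev// sev.
  rewrite !rmorphB/= horner_mx_X horner_mx_C => /eqP; rewrite subr_eq0 => /eqP e v.
  have : dotv v ((S - lam%:M) *m v) >= 0 by rewrite -e sqh dotv_ge0.
  by rewrite mulmxBl mul_scalar_mx dotvBr dotvZr subr_ge0.
have [q qE] := interpolation (fun a => (Num.sqrt (Num.sqrt a))^-1) s.
have q4 : horner_mx S (q ^+ 2) *m horner_mx S (q ^+ 2) *m S = 1%:M.
  have : horner_mx S (q ^+ 2 * q ^+ 2 * 'X - 1%:P) = 0.
    apply: vanish => a as_; have a0 : 0 < a by apply: lt_le_trans lam0 _; rewrite ev// sev.
    rewrite hornerD hornerN !hornerM hornerX hornerC qE// -!expr2 -exprM exprVn.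
    rewrite exprM !sqr_sqrtr ?sqrtr_ge0 ?(ltW a0)//.
    by rewrite mulVf ?subrr// gt_eqF.
  rewrite rmorphB !rmorphM/= horner_mx_X horner_mx_C => /eqP; rewrite subr_eq0 => /eqP e.
  exact: e.
exists (horner_mx S (q ^+ 2)) => //; split => [|v v0]; first exact: trh.
rewrite sqh lt_neqAle dotv_ge0 andbT eq_sym; apply/negP => /eqP /dotv_eq0 h0.
move/eqP: v0; apply; have /mulmx1C e := q4.
rewrite -[v]mul1mx -e -!mulmxA.
have -> : horner_mx S (q ^+ 2) *m v = 0.
  by rewrite rmorphXn/= expr2 -[_ * _]/(_ *m _) -mulmxA h0 mulmx0.
by rewrite !mulmx0.
Qed.

End PositiveDefinite.

(** For the norm bound, [enorm (B *m v) ^+ 2] is the product of [v] with [u = S^-1 v], and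
    [lam * enorm u <= enorm v] by Cauchy-Schwarz. *)
Lemma invsqrtmxP {R : realType} {d : nat} (S : 'M[R]_d) lam (B := invsqrtmx S) :
  S^T = S -> (forall v, 0 <= dotv v (S *m v)) -> 0 < lam -> lam <= lambda_min S ->
  [/\ B^T = B, B *m S *m B = 1%:M &
      forall v, enorm (B *m v) <= (Num.sqrt lam)^-1 * enorm v].
Proof.
move=> sS pS lam0 lamS; have [hS [B0 pB0 B0S]] := lambda_min_sqrt sS pS lam0 lamS.
have [_ uS] := mulmx1_unit B0S.
have : [set B | posdefmx B /\ B *m B = invmx S] B.
  apply: xgetPex; exists B0; split=> //.
  by rewrite -[LHS](mulmxK uS) B0S mul1mx.
move=> [[sB _] BB]; split => // [|v].
  apply: mulmx1C; rewrite mulmxA BB; exact: mulVmx.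
have e : enorm (B *m v) ^+ 2 = dotv v (invmx S *m v).
  by rewrite enorm_sqr dotv_mulmx sB mulmxA BB dotvC.
set u := invmx S *m v in e.
have Su : S *m u = v by rewrite mulmxA mulmxV// mul1mx.
have h1 : lam * enorm u ^+ 2 <= enorm u * enorm v.
  by rewrite enorm_sqr; apply: le_trans (hS u) _; rewrite Su dotv_le.
have h2 : lam * enorm u <= enorm v.
  have := enorm_ge0 u; rewrite le_eqVlt => /predU1P[<-|u0].
    by rewrite mulr0 enorm_ge0.
  by move: h1; rewrite expr2 mulrCA ler_pM2l.
have h3 : enorm (B *m v) ^+ 2 <= enorm v * enorm u by rewrite e dotv_le.
have s0 : 0 < Num.sqrt lam by rewrite sqrtr_gt0.
rewrite mulrC ler_pdivlMr// -(ler_pXn2r (ltn0Sn 1)) ?nnegrE ?enorm_ge0//; last first.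
  by rewrite mulr_ge0 ?enorm_ge0 ?(ltW s0).
rewrite exprMn (sqr_sqrtr (ltW lam0)).
have := ler_wpM2l (enorm_ge0 v) h2; have := ler_wpM2l (ltW lam0) h3; lra.
Qed.

(** * Convex sets *)

Section ConvexSets.
Context {R : realType} {d : nat}.
Implicit Types (A : set 'cV[R]_d) (x y z p : 'cV[R]_d).

Definition convex_comb_closed A :=
  forall x y (t : R), 0 <= t <= 1 -> A x -> A y -> A (t *: x + (1 - t) *: y).

Lemma convex_setE A : convex_set A -> convex_comb_closed A.
Proof.
move=> cA x y t /andP[t0 t1] Ax Ay.
have := cA x y (Itv01 t0 t1); rewrite !inE; exact.
Qed.

Lemma convex_comb_closed_ball A M : convex_comb_closed A ->
  convex_comb_closed (A `&` [set x | enorm x <= M]).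
Proof.
move=> cA x y t t01 [Ax xM] [Ay yM]; split; first exact: cA.
have /andP[t0 t1] := t01; have s0 : 0 <= 1 - t by rewrite subr_ge0.
rewrite /=; apply: le_trans (ler_enormD _ _) _.
rewrite !enormZ (ger0_norm t0) (ger0_norm s0).
have := ler_wpM2l t0 xM; have := ler_wpM2l s0 yM; lra.
Qed.

Lemma enorm_sqrD x y : enorm (x + y) ^+ 2 = enorm x ^+ 2 + 2 * dotv x y + enorm y ^+ 2.
Proof. by rewrite !enorm_sqr dotvDl !dotvDr (dotvC y x); ring. Qed.

(* Finite dimension enters here: the coordinates of an approximating point
   are adjusted one after the other, by mixing two points of [A] that lie on
   both sides of the corresponding hyperplane. *)
Lemma interior_closure A x r : convex_comb_closed A -> 0 < r ->
  (forall z, (forall i, `|z i 0 - x i 0| <= r) -> forall e, 0 < e ->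
    exists2 a, A a & forall i, `|a i 0 - z i 0| <= e) -> A x.
Proof.
move=> cA r0 near.
have slice k : (k <= d)%N -> forall z, (forall i : 'I_d, (i < k)%N -> z i 0 = x i 0) ->
    (forall i, `|z i 0 - x i 0| <= r) -> forall e, 0 < e -> exists a, [/\ A a,
      forall i : 'I_d, (i < k)%N -> a i 0 = x i 0 & forall i, `|a i 0 - z i 0| <= e].
  elim: k => [_ z _ zr e e0|k ih kd z zk zr e e0].
    by have [a Aa az] := near z zr e e0; exists a.
  pose ik := Ordinal kd.
  (* Coordinate [ik] of [w 1] and of [w (-1)] is off the target by [r] in opposite directions;
     approximations within [r / 2] stay on opposite sides. *)
  pose w (s : R) : 'cV[R]_d := z + (s * r) *: delta_mx ik 0.
  have wE s i : w s i 0 = z i 0 + (s * r) * (i == ik)%:R.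
    by rewrite !mxE eqxx andbT.
  have e'0 : 0 < Num.min e (r / 2) by rewrite lt_min e0 divr_gt0.
  have zik : z ik 0 = x ik 0 by apply: zk => /=.
  have hw s : `|s| = 1 -> exists a, [/\ A a,
      forall i : 'I_d, (i < k)%N -> a i 0 = x i 0 &
      forall i, `|a i 0 - w s i 0| <= Num.min e (r / 2)].
    move=> s1; apply: ih => //; first exact: ltnW.
    - move=> i ik'; rewrite wE (negbTE (_ : i != ik)) ?mulr0 ?addr0 ?zk// 1?ltnW//.
      by apply/eqP => ii; rewrite ii ltnn in ik'.
    - move=> i; rewrite wE; have [->|_] := eqVneq i ik; last by rewrite mulr0 addr0.
      by rewrite zik mulr1 addrC addKr normrM s1 mul1r gtr0_norm.
  have [a [Aa ax aw]] := hw 1 (normr1 _).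
  have [b [Ab bx bw]] := hw (-1) ltac:(by rewrite normrN1).
  have ale i s (c : 'cV[R]_d) : `|c i 0 - w s i 0| <= Num.min e (r / 2) ->
      `|c i 0 - w s i 0| <= e /\ `|c i 0 - w s i 0| <= r / 2.
    by rewrite le_min => /andP[].
  have [_ a1] := ale _ _ _ (aw ik); have [_ b1] := ale _ _ _ (bw ik).
  move: a1 b1; rewrite !wE eqxx zik !mulr1 mul1r mulN1r !ler_norml.
  move=> /andP[a1 a2] /andP[b1 b2].
  pose t := (x ik 0 - b ik 0) / (a ik 0 - b ik 0).
  have ab : 0 < a ik 0 - b ik 0 by lra.
  have t01 : 0 <= t <= 1.
    by rewrite divr_ge0//= ?ler_pdivrMr ?mul1r ?(ltW ab)//; lra.
  have tE : t * a ik 0 + (1 - t) * b ik 0 = x ik 0.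
    have := divfK (lt0r_neq0 ab) (x ik 0 - b ik 0); rewrite -/t; lra.
  have cE i : (t *: a + (1 - t) *: b) i 0 = t * a i 0 + (1 - t) * b i 0 by rewrite !mxE.
  exists (t *: a + (1 - t) *: b); split; first exact: cA.
  - move=> i; rewrite ltnS leq_eqVlt => /predU1P[ei|ik'].
      by rewrite (_ : i = ik) ?cE//; exact: val_inj.
    by rewrite cE ax// bx//; ring.
  - move=> i; rewrite cE; have [->|iik] := eqVneq i ik; first by rewrite tE zik subrr normr0 ltW.
    have [a3 _] := ale _ _ _ (aw i); have [b3 _] := ale _ _ _ (bw i).
    move: a3 b3; rewrite !wE (negbTE iik) !mulr0 !addr0 => a3 b3.
    have -> : t * a i 0 + (1 - t) * b i 0 - z i 0 =
      t * (a i 0 - z i 0) + (1 - t) * (b i 0 - z i 0) by ring.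
    have /andP[t0 t1] := t01; have s0 : 0 <= 1 - t by rewrite subr_ge0.
    apply: (le_trans (ler_normD (t * (a i 0 - z i 0)) _)).
    rewrite (normrM t) (normrM (1 - t)) (ger0_norm t0) (ger0_norm s0).
    have := ler_wpM2l t0 a3; have := ler_wpM2l s0 b3; lra.
have [a [Aa ax _]] := slice d (leqnn d) x (fun _ _ => erefl)
  ltac:(by move=> i; rewrite subrr normr0 ltW) r r0.
by rewrite (_ : x = a)//; apply/matrixP => i j; rewrite ord1 ax.
Qed.

(** [A] need not be closed, so that a near-minimizer [y0] of the distance to [z] replaces the
    projection, and the first order condition holds up to the error [e]. *)
Lemma separation_far A z M del e : convex_comb_closed A ->
  (forall y, A y -> enorm y <= M) -> A !=set0 -> 0 < del ->
  (forall y, A y -> del <= enorm (y - z)) -> 0 < e ->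
  exists2 p, enorm p = 1 & forall y, A y -> dotv p y <= dotv p z + e.
Proof.
move=> cA AM A0 del0 far e0.
pose D := [set enorm (y - z) ^+ 2 | y in A].
have infD : has_inf D.
  split; first by have [y Ay] := A0; exists (enorm (y - z) ^+ 2), y.
  by exists 0 => _ [y _ <-]; exact: sqr_ge0.
have M2 : 0 < 4 * M ^+ 2 + 1 by have := sqr_ge0 M; lra.
(* Moving from [y0] by [t] towards [y] gains at most [t * (e * del)] in squared distance. After
   division by [t] the quadratic term is at most [t * (4 * M ^+ 2)], which this choice bounds by
   [e * del]. *)
pose t := Num.min 1 (e * del / (4 * M ^+ 2 + 1)).
have ed : 0 < e * del by exact: mulr_gt0.
have t0 : 0 < t by rewrite lt_min ltr01/= divr_gt0.
have t1 : t <= 1 by rewrite ge_min lexx.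
have tM : t * (4 * M ^+ 2 + 1) <= e * del by rewrite -ler_pdivlMr// ge_min lexx orbT.
have [_ [y0 Ay0 <-] hy0] := inf_adherent (mulr_gt0 t0 ed) infD.
pose a := y0 - z.
have aN : enorm (z - y0) = enorm a by exact: enormC.
have N0 : del <= enorm a by exact: far.
have N1 : 0 < enorm a by exact: lt_le_trans N0.
exists ((enorm a)^-1 *: (z - y0)).
  by rewrite enormZ gtr0_norm ?invr_gt0// aN mulVf// gt_eqF.
move=> y Ay; pose b := y - y0.
have bM : enorm b ^+ 2 <= 4 * M ^+ 2.
  have bb : enorm b <= 2 * M.
    apply: le_trans (ler_enormD _ _) _; rewrite enormN.
    by have := AM _ Ay; have := AM _ Ay0; lra.
  have -> : 4 * M ^+ 2 = (2 * M) ^+ 2 by ring.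
  by rewrite lerXn2r ?nnegrE ?enorm_ge0//; apply: le_trans bb; exact: enorm_ge0.
have : inf D <= enorm (a + t *: b) ^+ 2.
  apply: ge_inf; first exact: infD.2.
  exists (t *: y + (1 - t) *: y0); first by apply: cA => //; rewrite (ltW t0).
  congr (enorm _ ^+ 2); apply/matrixP => i j.
  by rewrite /a /b !mxE; ring.
rewrite enorm_sqrD enormZ (gtr0_norm t0) exprMn dotvZr => hinf.
rewrite !dotvZl -lerBlDl -mulrBr -dotvBr.
have -> : dotv (z - y0) (y - z) = - dotv a b - enorm a ^+ 2.
  have -> : z - y0 = - a by rewrite opprB.
  have -> : y - z = b + a by rewrite /a /b addrA subrK.
  by rewrite dotvNl dotvDr enorm_sqr; ring.
have key : - dotv a b <= e * del.
  rewrite -(ler_pM2l t0); have tt := ltW t0.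
  have := ler_wpM2l tt tM; have := ler_wpM2l (mulr_ge0 tt tt) bM.
  move: hy0 hinf; rewrite -/a; have := sqr_ge0 t; lra.
rewrite ler_pdivrMl//; have := ler_wpM2l (ltW e0) N0; have := sqr_ge0 (enorm a); lra.
Qed.

(** [x] may lie in the closure of [A]. By contraposition of [interior_closure], some [z] with
    coordinates within [r] of those of [x] has positive distance to [A]; separating [z] costs
    [e / 2], and so does returning to [x]. *)
Lemma separation A x M e : convex_comb_closed A ->
  (forall y, A y -> enorm y <= M) -> A !=set0 -> ~ A x -> 0 < e ->
  exists2 p, enorm p = 1 & forall y, A y -> dotv p y <= dotv p x + e.
Proof.
move=> cA AM A0 nAx e0.
pose r := e / 2 / (Num.sqrt d%:R + 1).
have sd0 : 0 < Num.sqrt d%:R + 1 :> R by rewrite ltr_wpDl// sqrtr_ge0.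
have r0 : 0 < r by rewrite !divr_gt0.
have : ~ (forall z, (forall i, `|z i 0 - x i 0| <= r) -> forall e, 0 < e ->
    exists2 a, A a & forall i, `|a i 0 - z i 0| <= e).
  by move=> h; apply: nAx; exact: interior_closure h.
move=> /existsNP[z /not_implyP[zx /existsNP[del /not_implyP[del0 far]]]].
have far' y : A y -> del <= enorm (y - z).
  move=> Ay; rewrite leNgt; apply/negP => lt; apply: far; exists y => // i.
  have := coord_le_enorm (y - z) i; rewrite !mxE => h; apply: le_trans h _; exact: ltW.
have e20 : 0 < e / 2 by exact: divr_gt0.
have [p p1 hp] := separation_far cA AM A0 del0 far' e20.
exists p => // y Ay; apply: le_trans (hp y Ay) _.
have h1 : dotv p (z - x) <= enorm (z - x) by apply: le_trans (dotv_le _ _) _; rewrite p1 mul1r.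
have h2 : enorm (z - x) <= Num.sqrt d%:R * r.
  by apply: enorm_le_coord; [exact: ltW|move=> i; rewrite !mxE].
have h3 : Num.sqrt d%:R * r <= e / 2.
  have := divfK (lt0r_neq0 sd0) (e / 2); rewrite -/r; have := r0; lra.
move: h1; rewrite dotvBr; lra.
Qed.

(* The function is the supremum of the signed distances to the half-spaces
   that contain [A]. *)
Lemma convex_unit_convex A M : (0 < d)%N -> convex_comb_closed A ->
  (forall y, A y -> enorm y <= M) -> A !=set0 ->
  exists rho : 'cV[R]_d -> R, [/\ unit_convex rho,
    forall x, A x -> rho x <= 0 & forall x, rho x < 0 -> A x].
Proof.
move=> d0 cA AM A0.
pose H := [set q : 'cV[R]_d * R | enorm q.1 = 1 /\ forall y, A y -> dotv q.1 y <= q.2].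
pose F x := [set dotv q.1 x - q.2 | q in H].
have [y0 Ay0] := A0.
have p1E : enorm (delta_mx (Ordinal d0) 0 : 'cV[R]_d) = 1.
  by rewrite /enorm dotv_delta mxE !eqxx sqrtr1.
have H0 : H (delta_mx (Ordinal d0) 0, M).
  split => //= y Ay; apply: le_trans (dotv_le _ _) _.
  by rewrite p1E mul1r; exact: AM.
have supF x : has_sup (F x).
  split; first by eexists; exists (delta_mx (Ordinal d0) 0, M).
  exists (enorm (x - y0)) => _ [[p b] [/= p1 hb] <-].
  have := hb _ Ay0; have := dotv_le p (x - y0); rewrite p1 mul1r dotvBr; lra.
have le_rho x q : H q -> dotv q.1 x - q.2 <= sup (F x).
  by move=> Hq; apply: ub_le_sup; [exact: (supF x).2|exists q].
have adh x e : 0 < e -> exists2 q, H q & sup (F x) - e < dotv q.1 x - q.2.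
  by move=> e0; have [_ [q Hq <-] h] := sup_adherent e0 (supF x); exists q.
have lip1 x y : sup (F x) - sup (F y) <= enorm (x - y).
  rewrite lerBlDl; apply: ge_sup; first exact: (supF x).1.
  move=> _ [q Hq <-]; have := le_rho y q Hq; have := dotv_le q.1 (x - y).
  rewrite Hq.1 mul1r dotvBr; lra.
exists (fun x => sup (F x)); split.
- split => [x y|x e e0].
    by rewrite ler_norml lip1 andbT; have := lip1 y x; rewrite enormC; lra.
  have [q Hq hq] := adh x e e0; exists q.1; first exact: Hq.1.
  by move=> y; have := le_rho y q Hq; rewrite dotvBr; lra.
- move=> x Ax; apply: ge_sup; first exact: (supF x).1.
  by move=> _ [q Hq <-]; have := Hq.2 x Ax; lra.
- move=> x sx; apply: contrapT => nAx.
  (* A half-space containing [A], found with this error, would have the signed distance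
     [sup (F x) / 2] at [x], above the supremum. *)
  have e0 : 0 < - sup (F x) / 2 by rewrite divr_gt0 ?oppr_gt0.
  have [p p1 hp] := separation cA AM A0 nAx e0.
  have := le_rho x (p, dotv p x + - sup (F x) / 2) (conj p1 hp) => /=; lra.
Qed.

End ConvexSets.

(** * From level sets to convex sets *)

Section ConvexTransfer.
Context {R : realType} {d : nat}.
Context {dT dU : measure_display} {T : measurableType dT} {U : measurableType dU}.
Variables (P : probability T R) (P' : probability U R) (Z : U -> 'cV[R]_d).
Hypothesis gZ : std_gaussian P' Z.
Hypothesis d0 : (0 < d)%N.
Local Notation rd := (Num.sqrt d%:R : R).
Variables (Y W : T -> 'cV[R]_d) (G : set T) (b g r : R).
Hypotheses (mY : random_vector Y) (mW : random_vector W) (mG : measurable G).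
Hypothesis W_close : forall rho, unit_convex rho ->
  `|fine (P [set w | rho (W w) <= 0]) - fine (P' [set w | rho (Z w) <= 0])| <= b.
Hypothesis PG : fine (P (~` G)) <= g.
Hypothesis r0 : 0 < r.
Hypothesis YW : forall w, G w -> enorm (Y w - W w) <= r.

Let mZ : random_vector Z. Proof. by case: gZ. Qed.

Let fine_leU {dV} {V : measurableType dV} (Q : probability V R) (A B C : set V) :
  measurable A -> measurable B -> measurable C -> A `<=` B `|` C ->
  fine (Q A) <= fine (Q B) + fine (Q C).
Proof.
move=> mA mB mC AB; rewrite -fineD ?fin_num_measure//.
apply: fine_le; rewrite ?fin_numD ?fin_num_measure//.
apply: (@le_trans _ _ (Q (B `|` C))); last exact: measureU2.
by apply: le_measure; rewrite ?inE//; exact: measurableU.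
Qed.

Let mrho {dV} {V : measurableType dV} (X : V -> 'cV[R]_d) rho c :
  random_vector X -> unit_convex rho -> measurable [set w | rho (X w) <= c].
Proof.
move=> mX ur; apply: measurable_le_cst; apply/measurable_EFinP.
exact: (unit_convex_vmeas ur mX).
Qed.

Let mshell rho c : unit_convex rho -> measurable [set w | `|rho (Z w)| <= c].
Proof.
move=> ur; apply: measurable_le_cst; apply: measurableT_comp => //.
by apply/measurable_EFinP; exact: (unit_convex_vmeas ur mZ).
Qed.

Let shellr rho c : unit_convex rho -> 0 < c ->
  fine (P' [set w | `|rho (Z w)| <= c]) <= 48 * rd * c.
Proof.
move=> ur c0; rewrite -lee_fin fineK; first exact: gauss_shell.
by rewrite fin_num_measure//; exact: mshell.
Qed.

Let bounded_case A M : convex_comb_closed A -> (forall y, A y -> enorm y <= M) ->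
  measurable (Y @^-1` A) -> measurable (Z @^-1` A) ->
  `|fine (P (Y @^-1` A)) - fine (P' (Z @^-1` A))| <= b + g + 96 * rd * r.
Proof.
move=> cA AM mYA mZA.
have rd0 : 0 < rd by exact: rd_gt0.
have b0 : 0 <= b.
  have [p [p1 h]] : exists p : 'cV[R]_d, enorm p = 1 /\ unit_convex (fun x => dotv p x).
    exists (delta_mx (Ordinal d0) 0).
    have p1 : enorm (delta_mx (Ordinal d0) 0 : 'cV[R]_d) = 1.
      by rewrite /enorm dotv_delta mxE !eqxx sqrtr1.
    split=> //; split=> [x y|x e e0]; last by exists (delta_mx (Ordinal d0) 0) => // y; rewrite dotvBr; lra.
    by rewrite -dotvBr; apply: le_trans (CauchySchwarz _ _) _; rewrite p1 mul1r.
  exact: le_trans (normr_ge0 _) (W_close h).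
have g0 : 0 <= g by apply: le_trans PG; exact: fine_ge0.
have rr0 : 0 < rd * r by exact: mulr_gt0.
have [A0|/set0P/negP/negPn/eqP ->] := pselect (A !=set0); last first.
  by rewrite !preimage_set0 !measure0 subrr normr0; lra.
have [rho [ur Ale ltA]] := convex_unit_convex d0 cA AM A0.
have lip w : G w -> `|rho (Y w) - rho (W w)| <= r.
  by move=> Gw; apply: le_trans (YW Gw); exact: ur.1.
have mGc := measurableC mG.
have up c : unit_convex (fun x => rho x - c) by exact: unit_convexB.
have E c (V : Type) (X : V -> 'cV[R]_d) :
    [set w | rho (X w) - c <= 0] = [set w | rho (X w) <= c].
  by apply/seteqP; split => w /=; rewrite subr_le0.
(* On the lower side the level is [- (2 * r)], since [rho (Y w) <= - r] then gives the strict
   inequality that [ltA] asks for. *)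
have W1 := W_close (up r); have W2 := W_close (up (- (2 * r))).
rewrite !E in W1 W2.
rewrite ler_norml; apply/andP; split.
- have h1 : fine (P [set w | rho (W w) <= - (2 * r)]) <= fine (P (Y @^-1` A)) + fine (P (~` G)).
    apply: fine_leU => //; first exact: mrho.
    move=> w /= hw; have [Gw|nGw] := pselect (G w); last by right.
    left; apply: ltA; have := lip w Gw; have := r0; rewrite ler_norml => r0' /andP[h3 h4]; lra.
  have h2 : fine (P' (Z @^-1` A)) <= fine (P' [set w | rho (Z w) <= - (2 * r)]) +
      fine (P' [set w | `|rho (Z w)| <= 2 * r]).
    apply: fine_leU => //; [exact: mrho|exact: mshell|].
    move=> w /= Aw; have := Ale _ Aw; have [h3|h3] := leP (rho (Z w)) (- (2 * r)); first by left.
    by right; rewrite ler_norml; apply/andP; split; have := r0; lra.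
  have r20 : 0 < 2 * r by rewrite mulr_gt0.
  have := shellr ur r20; have := PG; move: W2; rewrite ler_norml => /andP[h3 h4]; lra.
- have h1 : fine (P (Y @^-1` A)) <= fine (P [set w | rho (W w) <= r]) + fine (P (~` G)).
    apply: fine_leU => //; first exact: mrho.
    move=> w /= Aw; have [Gw|nGw] := pselect (G w); last by right.
    by left; have := Ale _ Aw; have := lip w Gw; rewrite ler_norml => /andP[h3 h4]; lra.
  have h2 : fine (P' [set w | rho (Z w) <= r]) <= fine (P' (Z @^-1` A)) +
      fine (P' [set w | `|rho (Z w)| <= r]).
    apply: fine_leU => //; [exact: mrho|exact: mshell|].
    move=> w /= hw; have [h3|h3] := leP 0 (rho (Z w)); last by left; exact: ltA.
    by right; rewrite ger0_norm.
  have := shellr ur r0; have := PG; move: W1; rewrite ler_norml => /andP[h3 h4]; lra.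
Qed.

Let preimage_ball_cvg {dV} {V : measurableType dV} (Q : probability V R)
    (X : V -> 'cV[R]_d) A : random_vector X -> measurable (X @^-1` A) ->
  (forall k : nat, measurable (X @^-1` (A `&` [set x | enorm x <= k%:R]))) /\
  (fun k : nat => fine (Q (X @^-1` (A `&` [set x | enorm x <= k%:R])))) @ \oo -->
    fine (Q (X @^-1` A)).
Proof.
move=> mX mA; have mk k : measurable (X @^-1` (A `&` [set x | enorm x <= k%:R])).
  rewrite preimage_setI; apply: measurableI => //.
  by apply: measurable_le_cst; exact: measurable_enorm.
split=> //; have UE : \bigcup_k (X @^-1` (A `&` [set x | enorm x <= k%:R])) = X @^-1` A.
  apply/seteqP; split => [w [k _ []]//|w /= Aw].
  by exists (Num.bound (enorm (X w))) => //; split => //=; apply/ltW/archi_boundP/enorm_ge0.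
apply: fine_cvg; rewrite fineK ?fin_num_measure// -UE.
apply: nondecreasing_cvg_mu => //; first exact: bigcup_measurable.
move=> i j ij; apply/subsetPset => w /= [Aw wi]; split => //.
by apply: le_trans wi _; rewrite /= ler_nat.
Qed.

(** The estimate for bounded sets is uniform in the radius, hence survives the limit along growing
    balls. *)
Lemma convex_transfer A : convex_comb_closed A ->
  measurable (Y @^-1` A) -> measurable (Z @^-1` A) ->
  (`|P (Y @^-1` A) - P' (Z @^-1` A)| <= (b + g + 96 * rd * r)%:E)%E.
Proof.
move=> cA mYA mZA.
have [mYk cYk] := preimage_ball_cvg P mY mYA.
have [mZk cZk] := preimage_ball_cvg P' mZ mZA.
rewrite -(fineK (fin_num_measure P _ mYA)) -(fineK (fin_num_measure P' _ mZA)).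
rewrite -EFinB lee_fin.
apply: (cvgr_to_le (cvg_norm (cvgB cYk cZk))).
apply: nearW => k; apply: (@bounded_case _ k%:R) => //.
- exact: convex_comb_closed_ball.
- by move=> y [].
Qed.

End ConvexTransfer.

(** * Empirical process *)

Section Chernoff.
Context {R : realType} {dT dS : measure_display}.
Context {T : measurableType dT} {S : measurableType dS}.
Variable P : probability T R.
Variable n : nat.
Hypothesis n0 : (0 < n)%N.
Variables (X : T -> S) (Y : 'I_n -> T -> S).
Hypothesis mX : measurable_fun setT X.
Hypothesis mY : forall i, measurable_fun setT (Y i).
Hypothesis ind_Y : mutually_independent P Y.
Hypothesis law_Y : forall i B, measurable B -> P (Y i @^-1` B) = P (X @^-1` B).

Local Notation rn := (Num.sqrt n%:R : R).
Local Notation h := (@hstep R n).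

Let rn0 : 0 < rn. Proof. by rewrite sqrtr_gt0 ltr0n. Qed.
Let h0 : 0 < h. Proof. exact: hstep_gt0. Qed.
Let hrn : h * rn = 1. Proof. by rewrite mulVf// gt_eqF. Qed.

Let measurable_compX (f : S -> R) (V : T -> S) : measurable_fun setT f ->
  measurable_fun setT V -> measurable_fun setT (fun w => f (V w)).
Proof. exact: measurableT_comp. Qed.

(** Independence enters through [op_sum_indep] in dimension one: each averaging operator multiplies
    an exponential by the same constant. *)
Let mgf_prod (f : S -> R) : measurable_fun setT f -> (forall s, `|f s| <= rn) ->
  (\int[P]_w (expR (\sum_i h * f (Y i w)))%:E =
   ((\int[P]_w expR (h * f (X w))) ^+ n)%:E)%E.
Proof.
move=> mf fb; pose c := \int[P]_w expR (h * f (X w)).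
pose u : 'cV[R]_1 := const_mx 1.
pose V (i : 'I_n) s : 'cV[R]_1 := const_mx (h * f s).
have mV i : random_vector (V i).
  by move=> j; under eq_fun do rewrite mxE; apply: measurable_funM.
have uE x : dotv u x = x 0 0 by rewrite /dotv big_ord1 mxE mul1r.
have nE (k : R) : 0 <= k -> nmeas (fun x : 'cV[R]_1 => (k * expR (dotv u x))%:E).
  move=> k0; split => [dU U W mW|x]; last by rewrite lee_fin mulr_ge0// expR_ge0.
  apply/measurable_EFinP; apply: measurable_funM => //.
  apply: (measurableT_comp (@measurable_expR R)); exact: measurable_dotv.
have mef (W : T -> S) : measurable_fun setT W ->
    measurable_fun setT (fun w => expR (h * f (W w))).
  move=> mW; apply: (measurableT_comp (@measurable_expR R)).
  by apply: measurable_funM => //; exact: measurable_compX.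
have iX : P.-integrable setT (EFin \o (fun w => expR (h * f (X w)))).
  apply: (integrable_dom (mef _ mX) _ (integrable_cstP P (expR 1))) => w.
  rewrite ger0_norm ?expR_ge0// ler_expR -hrn.
  by apply: le_trans (ler_norm _) _; rewrite normrM gtr0_norm// ler_wpM2l// ltW.
have c0 : 0 <= c by apply: Rintegral_ge0 => w _; exact: expR_ge0.
have cE i : (\int[P]_w (expR (h * f (Y i w)))%:E = c%:E)%E.
  rewrite -(Rintegral_EFin iX).
  apply: (law_integral (g := fun s => (expR (h * f s))%:E)) => //.
  - by move=> B; exact: law_Y.
  - apply/measurable_EFinP; apply: (measurableT_comp (@measurable_expR R)).
    exact: measurable_funM.
have := op_sum_indep mY ind_Y mV 0 (index_enum_uniq _) (nE 1 ler01).
have fold (s : seq 'I_n) : foldr (fun i => op P (fun w => V i (Y i w)))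
    (fun x => (1 * expR (dotv u x))%:E) s =
    (fun x => (c ^+ size s * expR (dotv u x))%:E).
  elim: s => //= i s ->; apply/funext => x; rewrite /op.
  transitivity (\int[P]_w ((c ^+ size s * expR (dotv u x))%:E *
      (expR (h * f (Y i w)))%:E))%E.
    apply: eq_integral => w _; rewrite -EFinM; congr EFin.
    by rewrite dotvDr expRD (uE (V _ _)) mxE mulrA.
  rewrite ge0_integralZl//.
  - by rewrite cE -EFinM; congr EFin; rewrite exprS; ring.
  - by apply/measurable_EFinP; exact: mef.
  - by rewrite lee_fin mulr_ge0 ?expR_ge0// exprn_ge0.
rewrite fold {fold} (_ : size _ = n); last by rewrite -[RHS](size_enum_ord n) enumT.
rewrite uE mxE expR0 mulr1 => <-; apply: eq_integral => w _; congr EFin.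
by rewrite mul1r add0r uE summxE; congr expR; apply: eq_bigr => i _; rewrite mxE.
Qed.

(** Chernoff's bound with parameter [h = 1 / sqrt n]. As [|h * f| <= 1], the exponential is at most
    1 + h f + e (h f)^2, and [n * h ^+ 2 = 1] leaves [expR 1 * M] in the exponent. *)
Let bernstein (f : S -> R) M u : measurable_fun setT f -> (forall s, `|f s| <= rn) ->
  \int[P]_w (f (X w) ^+ 2) <= M ->
  (P [set w | (n%:R * \int[P]_w f (X w) + u * rn <= \sum_i f (Y i w))%R] <=
   (expR (expR 1 * M - u))%:E)%E.
Proof.
move=> mf fb fM; set m := \int[P]_w f (X w).
have mfX : measurable_fun setT (fun w => f (X w)) by exact: measurable_compX.
have if1 : P.-integrable setT (EFin \o (fun w => f (X w))).
  by apply: (integrable_dom mfX _ (integrable_cstP P rn)) => w; exact: fb.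
have if2 : P.-integrable setT (EFin \o (fun w => f (X w) ^+ 2)).
  apply: (integrable_dom _ _ (integrable_cstP P (rn ^+ 2))).
    exact: (measurableT_comp (exprn_measurable 2)).
  by move=> w; rewrite ger0_norm ?sqr_ge0// -real_normK ?num_real// lerXn2r// nnegrE ltW.
have hf s : `|h * f s| <= 1 by rewrite normrM (gtr0_norm h0) -hrn ler_wpM2l// ltW.
have mE (W : T -> R) : measurable_fun setT W -> measurable_fun setT (fun w => expR (W w)).
  by move=> mW; exact: (measurableT_comp (@measurable_expR R)).
have cle : \int[P]_w expR (h * f (X w)) <= expR (h * m + expR 1 * M * h ^+ 2).
  apply: (@le_trans _ _ (\int[P]_w (1 + h * f (X w) + expR 1 * h ^+ 2 * f (X w) ^+ 2))).
    apply: le_Rintegral => //.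
    - apply: (integrable_dom _ _ (integrable_cstP P (expR 1))).
        by apply: mE; exact: measurable_funM.
      move=> w; rewrite ger0_norm ?expR_ge0// ler_expR.
      exact: le_trans (ler_norm _) (hf _).
    - apply: integrableDr; last exact: integrableZr.
      by apply: integrableDr; [exact: integrable_cstP|exact: integrableZr].
    - move=> w _; have := expR_taylor2 (h * f (X w)).
      rewrite ler_norml => /andP[_ h1].
      have h2 : `|h * f (X w)| ^+ 2 * expR `|h * f (X w)| <= h ^+ 2 * f (X w) ^+ 2 * expR 1.
        rewrite real_normK ?num_real// exprMn ler_wpM2l ?ler_expR//.
        by rewrite mulr_ge0// sqr_ge0.
      by lra.
  have i12 : P.-integrable setT (EFin \o (fun w => 1 + h * f (X w))).
    by apply: integrableDr; [exact: integrable_cstP|exact: integrableZr].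
  rewrite RintegralD//; last exact: integrableZr.
  rewrite RintegralD//; [|exact: integrable_cstP|exact: integrableZr].
  rewrite Rintegral_cstP !RintegralZl//.
  apply: le_trans (expR_ge1Dx _); rewrite -addrA !lerD2l -/m.
  rewrite mulrAC; apply: ler_wpM2r; first exact: sqr_ge0.
  by rewrite ler_wpM2l// expR_ge0.
pose A := [set w | n%:R * m + u * rn <= \sum_i f (Y i w)].
have msum : measurable_fun setT (fun w => \sum_i f (Y i w)).
  by apply: measurable_sum => i; exact: measurable_compX.
have mA : measurable A.
  have := measurable_le_cst (- (n%:R * m + u * rn)) (measurableT_comp (@oppr_measurable R setT) msum).
  by congr (measurable _); apply/seteqP; split => w /=; rewrite lerN2.
have markov : ((expR (rn * m + u))%:E * P A <= \int[P]_w (expR (\sum_i h * f (Y i w)))%:E)%E.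
  rewrite -integral_cst// integral_mkcond; apply: ge0_le_integral => //.
  - by move=> w _; apply: erestrict_ge0 => *; rewrite lee_fin expR_ge0.
  - exact/(measurable_restrictT _ _).1.
  - apply/measurable_EFinP; apply: mE; apply: measurable_sum => i.
    by apply: measurable_funM => //; exact: measurable_compX.
  - move=> w _; rewrite patchE; case: ifPn => [|_]; last by rewrite lee_fin expR_ge0.
    rewrite inE /A/= => wA; rewrite lee_fin ler_expR -mulr_sumr.
    have -> : rn * m + u = h * (n%:R * m + u * rn).
      have {2}-> : n%:R = rn * rn by rewrite -expr2 sqr_sqrtr ?ler0n.
      by rewrite mulrDr (mulrC u) !mulrA hrn !mul1r.
    by rewrite ler_wpM2l// ltW.
rewrite (mgf_prod mf fb) in markov.
have PA := fin_num_measure P _ mA.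
have [q qE] : exists q : R, P A = q%:E by exists (fine (P A)); rewrite fineK.
rewrite -/A qE lee_fin; rewrite qE -EFinM lee_fin in markov; have mk := markov.
rewrite -(ler_pM2l (expR_gt0 (rn * m + u))); apply: le_trans mk _.
rewrite -expRD; apply: (@le_trans _ _ (expR (h * m + expR 1 * M * h ^+ 2) ^+ n)).
  rewrite lerXn2r ?nnegrE ?expR_ge0//.
  by apply: Rintegral_ge0 => w _; exact: expR_ge0.
rewrite -expRM_natl ler_expR.
have -> : n%:R * (h * m + expR 1 * M * h ^+ 2) = rn * m + expR 1 * M.
  rewrite [X in X * _ = _](_ : n%:R = rn * rn); last by rewrite -expr2 sqr_sqrtr ?ler0n.
  have -> : rn * rn * (h * m + expR 1 * M * h ^+ 2) =
    (h * rn) * rn * m + expR 1 * M * (h * rn) ^+ 2 by ring.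
  by rewrite hrn expr1n; ring.
lra.
Qed.

Lemma uniform_deviation (K : finType) (f : K -> S -> R) M u :
  (forall k, measurable_fun setT (f k)) -> (forall k s, `|f k s| <= rn) ->
  (forall k, \int[P]_w (f k (X w) ^+ 2) <= M) ->
  exists2 A : set T, measurable A & fine (P A) <= #|K|%:R * (2 * expR (expR 1 * M - u)) /\
    forall w, ~ A w -> forall k,
      `|\sum_i f k (Y i w) - n%:R * \int[P]_w f k (X w)| <= u * rn.
Proof.
move=> mf fb fM; pose m k := \int[P]_w f k (X w).
pose A1 k := [set w | n%:R * m k + u * rn <= \sum_i f k (Y i w)].
pose A2 k := [set w | n%:R * (- m k) + u * rn <= \sum_i - f k (Y i w)].
have msum (g : S -> R) c : measurable_fun setT g -> measurable [set w | c <= \sum_i g (Y i w)].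
  move=> mg; have mg' : measurable_fun setT (fun w => \sum_i g (Y i w)).
    by apply: measurable_sum => i; exact: measurable_compX.
  have := measurable_le_cst (- c) (measurableT_comp (@oppr_measurable R setT) mg').
  by congr (measurable _); apply/seteqP; split => w /=; rewrite lerN2.
have mN k : measurable_fun setT (fun s => - f k s).
  exact: (measurableT_comp (@oppr_measurable R setT)).
have mA1 k : measurable (A1 k) by exact: msum.
have mA2 k : measurable (A2 k) by exact: (msum (fun s => - f k s)).
have PA1 k : (P (A1 k) <= (expR (expR 1 * M - u))%:E)%E by exact: bernstein.
have PA2 k : (P (A2 k) <= (expR (expR 1 * M - u))%:E)%E.
  rewrite /A2 (_ : - m k = \int[P]_w (- f k (X w))).
    apply: (@bernstein (fun s => - f k s)) => //; first by move=> s; rewrite normrN.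
    by under eq_Rintegral do rewrite sqrrN.
  rewrite -mulN1r -RintegralZl//; first by apply: eq_Rintegral => w _; rewrite mulN1r.
  apply: (integrable_dom _ _ (integrable_cstP P rn)); first exact: measurable_compX.
  by move=> w; exact: fb.
pose s : seq K := enum K.
exists (\big[setU/set0]_(k <- s) (A1 k `|` A2 k)).
  by apply: bigsetU_measurable => k _; exact: measurableU.
split.
  rewrite -lee_fin fineK; last first.
    by rewrite fin_num_measure//; apply: bigsetU_measurable => k _; exact: measurableU.
  rewrite cardE -/s; elim: s => [|k s ih]; first by rewrite big_nil measure0 mul0r.
  rewrite big_cons /= -natr1 mulrDl mul1r addrC EFinD.
  apply: (@le_trans _ _ (P (A1 k `|` A2 k) + P (\big[setU/set0]_(k <- s) (A1 k `|` A2 k)))%E).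
    apply: measureU2; first exact: measurableU.
    by apply: bigsetU_measurable => k' _; exact: measurableU.
  apply: leeD; last exact: ih.
  apply: (@le_trans _ _ (P (A1 k) + P (A2 k))%E); first exact: measureU2.
  by rewrite mulr_natl mulr2n EFinD; exact: leeD.
move=> w nA k; have nAk : ~ (A1 k `|` A2 k) w.
  move=> Ak; apply: nA; rewrite -bigcup_seq; exists k => //=; exact: mem_enum.
rewrite ler_norml; apply/andP; split.
  rewrite leNgt; apply/negP => lt; apply: nAk; right; rewrite /A2/= sumrN -/(m k); move: lt; rewrite -/(m k); lra.
rewrite leNgt; apply/negP => lt; apply: nAk; left; rewrite /A1/= -/(m k); move: lt; rewrite -/(m k); lra.
Qed.

End Chernoff.

Section Net.
Context {R : realType} {d : nat}.
Variables (Theta : set 'cV[R]_d) (t0 : 'cV[R]_d) (D s : R).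
Hypotheses (Tt0 : Theta t0) (s0 : 0 < s).
Hypothesis diamT : forall t t', Theta t -> Theta t' -> enorm (t - t') <= D.

(** Coordinates relative to [t0] lie in an interval of length [2 * D], cut into cells of side [s]. A
    point of [Theta] is chosen in each cell that meets it, which keeps the net inside [Theta]; other
    cells receive [t0]. *)
Lemma finite_net : exists (K : finType) (t : K -> 'cV[R]_d),
  [/\ #|K|%:R <= (2 * D / s + 1) ^+ d, forall k, Theta (t k) &
      forall th, Theta th -> exists k, enorm (th - t k) <= Num.sqrt d%:R * s].
Proof.
have D0 : 0 <= D by have := diamT Tt0 Tt0; rewrite subrr enorm0.
pose m := (Num.truncn (2 * D / s)).+1.
have Ds : 0 <= 2 * D / s by rewrite divr_ge0 ?(ltW s0)// mulr_ge0.
pose a (th : 'cV[R]_d) j := (th j 0 - t0 j 0 + D) / s.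
have a_itv th j : Theta th -> 0 <= a th j <= 2 * D / s.
  move=> Tth; have := le_trans (coord_le_enorm (th - t0) j) (diamT Tth Tt0).
  rewrite !mxE ler_norml => /andP[h1 h2].
  rewrite /a divr_ge0 ?(ltW s0)//=; last lra.
  by rewrite ler_pM2r ?invr_gt0//; lra.
pose c th : {ffun 'I_d -> 'I_m} := [ffun j => inord (Num.truncn (a th j))].
pose t k := xget t0 [set th | Theta th /\ c th = k].
exists {ffun 'I_d -> 'I_m}, t; split.
- rewrite card_ffun !card_ord natrX.
  apply: lerXn2r; rewrite ?nnegrE ?ler0n ?addr_ge0//.
  by rewrite /m -natr1 lerD2r truncn_le.
- by move=> k; rewrite /t; case: xgetP => // th _ [].
- move=> th Tth; exists (c th).
  have [Tt ct] : Theta (t (c th)) /\ c (t (c th)) = c th.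
    by apply: (@xgetPex _ t0 [set th' | Theta th' /\ c th' = c th]); exists th.
  apply: enorm_le_coord => [|j]; first exact: ltW.
  have /andP[p1 p2] := a_itv th j Tth; have /andP[q1 q2] := a_itv _ j Tt.
  have lt_m x : 0 <= x -> x <= 2 * D / s -> (Num.truncn x < m)%N.
    by move=> x0 xD; rewrite ltnS le_truncn.
  have e : Num.truncn (a th j) = Num.truncn (a (t (c th)) j).
    move/ffunP: ct => /(_ j); rewrite !ffunE => /(congr1 val).
    by rewrite /= !inordK ?lt_m// => ->.
  have /andP[h1 h2] := truncn_itv p1; have /andP[h3 h4] := truncn_itv q1.
  rewrite -e in h3 h4; rewrite -natr1 in h2 h4.
  have : `|a th j - a (t (c th)) j| <= 1.
    by rewrite ler_norml; apply/andP; split; lra.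
  rewrite /a -mulrBl normrM (gtr0_norm (_ : 0 < s^-1)) ?invr_gt0// ler_pdivrMr// mul1r.
  by rewrite !mxE; congr (`|_| <= _); ring.
Qed.

End Net.

Section EmpiricalProcess.
Context {R : realType} {dT dS : measure_display}.
Context {T : measurableType dT} {S : measurableType dS}.
Variable P : probability T R.
Variable n : nat.
Hypothesis n0 : (0 < n)%N.
Variables (X : T -> S) (Y : 'I_n -> T -> S).
Hypothesis mX : measurable_fun setT X.
Hypothesis mY : forall i, measurable_fun setT (Y i).
Hypothesis ind_Y : mutually_independent P Y.
Hypothesis law_Y : forall i B, measurable B -> P (Y i @^-1` B) = P (X @^-1` B).
Local Notation rn := (Num.sqrt n%:R : R).

Variables (b : S -> R) (M : R).
Hypotheses (mb : measurable_fun setT b) (b0 : forall x, 0 <= b x).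
Hypothesis ib : P.-integrable setT (EFin \o (fun w => b (X w) ^+ 3)).
Hypothesis bM : \int[P]_w (b (X w) ^+ 3) <= M.

Let rn0 : 0 < rn. Proof. by rewrite sqrtr_gt0 ltr0n. Qed.
Let rn2 : rn ^+ 2 = n%:R. Proof. by rewrite sqr_sqrtr// ler0n. Qed.

Let mbX : measurable_fun setT (fun w => b (X w)).
Proof. exact: measurableT_comp. Qed.

Let mbXk k : measurable_fun setT (fun w => b (X w) ^+ k).
Proof. exact: (measurableT_comp (exprn_measurable k)). Qed.

Let i1b3 : P.-integrable setT (EFin \o (fun w => 1 + b (X w) ^+ 3)).
Proof. by apply: integrableDr => //; exact: integrable_cstP. Qed.

Let le1b3 (x : R) : 0 <= x -> x <= 1 + x ^+ 3 /\ x ^+ 2 <= 1 + x ^+ 3.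
Proof.
move=> x0; have x3 := exprn_ge0 3 x0.
have [x1|x1] := leP x 1.
  by split; [lra|apply: le_trans (exprn_ile1 _ x0 x1) _; lra].
have x2 : x <= x ^+ 2 by rewrite ler_eXnr// ltW.
have : x ^+ 2 <= x ^+ 3 by rewrite ler_eXn2l// ltW.
by move=> h; split; lra.
Qed.

Let ib1 : P.-integrable setT (EFin \o (fun w => b (X w))).
Proof.
apply: (integrable_dom mbX _ i1b3) => w; rewrite ger0_norm ?b0//.
by have [] := le1b3 (b0 (X w)).
Qed.

Let ib2 : P.-integrable setT (EFin \o (fun w => b (X w) ^+ 2)).
Proof.
apply: (integrable_dom (mbXk 2) _ i1b3) => w; rewrite ger0_norm ?sqr_ge0//.
by have [] := le1b3 (b0 (X w)).
Qed.

Lemma integrable_envelope : P.-integrable setT (EFin \o (fun w => b (X w))) /\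
  P.-integrable setT (EFin \o (fun w => b (X w) ^+ 2)).
Proof. by []. Qed.

Let E13 : \int[P]_w (1 + b (X w) ^+ 3) <= 1 + M.
Proof. by rewrite RintegralD//; [rewrite Rintegral_cstP lerD2l|exact: integrable_cstP]. Qed.

Let Eb : \int[P]_w b (X w) <= 1 + M.
Proof.
apply: le_trans E13; apply: le_Rintegral => // w _.
by have [] := le1b3 (b0 (X w)).
Qed.

Let Eb2 : \int[P]_w (b (X w) ^+ 2) <= 1 + M.
Proof.
apply: le_trans E13; apply: le_Rintegral => // w _.
by have [] := le1b3 (b0 (X w)).
Qed.

Let G : set S := [set x | b x <= rn].
Let mG : measurable G. Proof. exact: measurable_le_cst. Qed.

Let PG (V : T -> S) : measurable_fun setT V -> measurable (V @^-1` (~` G)).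
Proof. by move=> mV; rewrite -[_ @^-1` _]setTI; apply: mV => //; exact: measurableC. Qed.

Let PGc : fine (P (X @^-1` (~` G))) <= M / rn ^+ 3.
Proof.
have mA := PG mX; rewrite ler_pdivlMr ?exprn_gt0// mulrC -Rintegral_indicP//.
rewrite -RintegralZl//; last exact: integrable_indic.
apply: le_trans bM; apply: le_Rintegral => //.
  by apply: integrableZr; exact: integrable_indic.
move=> w _; rewrite indicE; case: (boolP (_ \in _)) => [|_]; last by rewrite mulr0 exprn_ge0.
rewrite inE/= => /negP; rewrite -ltNge mulr1 => h.
by rewrite lerXn2r ?nnegrE ?(ltW rn0) ?b0// ltW.
Qed.

Let tail : \int[P]_w (b (X w) * \1_(X @^-1` (~` G)) w) <= (1 + M) / rn.
Proof.
have mA := PG mX; rewrite ler_pdivlMr// mulrC -RintegralZl//; last first.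
  apply: (integrable_dom _ _ ib1).
    by apply: measurable_funM => //; exact: measurable_indic.
  move=> w; rewrite normrM (ger0_norm (b0 _)) ler_piMr// ?b0//.
  by rewrite indicE; case: (_ \in _); rewrite ?normr1 ?normr0.
apply: le_trans Eb2; apply: le_Rintegral => //.
  apply: integrableZr; apply: (integrable_dom _ _ ib1).
    by apply: measurable_funM => //; exact: measurable_indic.
  move=> w; rewrite normrM (ger0_norm (b0 _)) ler_piMr// ?b0//.
  by rewrite indicE; case: (_ \in _); rewrite ?normr1 ?normr0.
move=> w _; rewrite indicE; case: (boolP (_ \in _)) => [|_]; last by rewrite !mulr0 sqr_ge0.
rewrite inE/= => /negP; rewrite -ltNge mulr1 expr2 => h.
by rewrite ler_wpM2r// ?b0// ltW.
Qed.

(* The functions are truncated to the event that the envelope [b] is at most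
   [sqrt n]; this costs a probability of order [1 / sqrt n] and changes the
   means by a quantity of the same order. *)
Lemma envelope_deviation (K : finType) (g : K -> S -> R) u :
  (forall k, measurable_fun setT (g k)) -> (forall k x, `|g k x| <= b x) ->
  exists2 A : set T, measurable A &
    fine (P A) <= M / rn + #|K|%:R * (2 * expR (expR 1 * (1 + M) - u)) /\
    forall w, ~ A w -> (forall i, b (Y i w) <= rn) /\
      forall k, `|\sum_i g k (Y i w) - n%:R * \int[P]_w g k (X w)| <= (u + 1 + M) * rn.
Proof.
move=> mg gb; pose f k x := g k x * \1_G x.
have mf k : measurable_fun setT (f k) by apply: measurable_funM => //; exact: measurable_indic.
have fb k x : `|f k x| <= rn.
  rewrite /f indicE normrM; case: (boolP (_ \in _)) => [|_]; last by rewrite normr0 mulr0 ltW.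
  by rewrite inE normr1 mulr1 => h; exact: le_trans (gb k x) h.
have fgb k x : `|f k x| <= b x.
  rewrite normrM; apply: le_trans (gb k x); rewrite ler_piMr//.
  by rewrite indicE; case: (_ \in _); rewrite ?normr1 ?normr0.
have fM k : \int[P]_w (f k (X w) ^+ 2) <= 1 + M.
  apply: le_trans Eb2; apply: le_Rintegral => //.
    apply: (integrable_dom _ _ ib2).
      by apply: (measurableT_comp (exprn_measurable 2)); exact: measurableT_comp.
    by move=> w; rewrite ger0_norm ?sqr_ge0// -real_normK ?num_real// lerXn2r ?nnegrE ?b0.
  by move=> w _; rewrite -real_normK ?num_real// lerXn2r ?nnegrE ?b0.
have [A mA [PA hA]] := uniform_deviation n0 mX mY ind_Y law_Y u mf fb fM.
pose B := \big[setU/set0]_(i <- enum 'I_n) (Y i @^-1` (~` G)).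
have mB : measurable B by apply: bigsetU_measurable => i _; exact: PG.
exists (A `|` B); [exact: measurableU|split].
  apply: (@le_trans _ _ (fine (P A) + fine (P B))).
    rewrite -fineD ?fin_num_measure//; apply: fine_le; rewrite ?fin_numD ?fin_num_measure//.
      exact: measurableU.
    exact: measureU2.
  rewrite addrC; apply: lerD => //.
  have -> : M / rn = n%:R * (M / rn ^+ 3).
    by rewrite -[X in _ = X * _]rn2; field; rewrite gt_eqF.
  rewrite -[X in X%:R * _](size_enum_ord n) /B; elim: (enum 'I_n) => [|i s ih].
    by rewrite big_nil measure0 mul0r.
  rewrite big_cons/= -natr1 mulrDl mul1r addrC.
  have ms : measurable (\big[setU/set0]_(i <- s) (Y i @^-1` (~` G))).
    by apply: bigsetU_measurable => j _; exact: PG.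
  apply: (@le_trans _ _ (fine (P (Y i @^-1` (~` G))) +
      fine (P (\big[setU/set0]_(i <- s) (Y i @^-1` (~` G)))))).
    have mi : measurable (Y i @^-1` (~` G)) by exact: PG.
    rewrite -fineD ?fin_num_measure//; apply: fine_le; rewrite ?fin_numD ?fin_num_measure//.
      exact: measurableU.
    exact: measureU2.
  apply: lerD; last exact: ih.
  by rewrite law_Y//; exact: measurableC.
move=> w nAB; have bY i : b (Y i w) <= rn.
  apply: contrapT => h; apply: nAB; right; rewrite /B -bigcup_seq.
  by exists i => //=; exact: mem_enum.
split=> // k; have := hA w (fun Aw => nAB (or_introl Aw)) k.
have -> : \sum_i f k (Y i w) = \sum_i g k (Y i w).
  by apply: eq_bigr => i _; rewrite /f indicE (mem_set (bY i : G (Y i w))) mulr1.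
have ig : P.-integrable setT (EFin \o (fun w => g k (X w))).
  by apply: (integrable_dom _ _ ib1) => // ; exact: measurableT_comp.
have if_ : P.-integrable setT (EFin \o (fun w => f k (X w))).
  by apply: (integrable_dom _ _ ib1) => // ; exact: measurableT_comp.
have diff : `|\int[P]_w g k (X w) - \int[P]_w f k (X w)| <= (1 + M) / rn.
  rewrite -RintegralB//; apply: le_trans tail.
  have mA' := PG mX.
  have itail : P.-integrable setT (EFin \o (fun w => b (X w) * \1_(X @^-1` (~` G)) w)).
    apply: (integrable_dom _ _ ib1).
      by apply: measurable_funM => //; exact: measurable_indic.
    move=> w'; rewrite normrM (ger0_norm (b0 _)) ler_piMr// ?b0//.
    by rewrite indicE; case: (_ \in _); rewrite ?normr1 ?normr0.
  have key w' : `|g k (X w') - f k (X w')| <= b (X w') * \1_(X @^-1` (~` G)) w'.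
    rewrite /f !indicE; have [h|h] := pselect (G (X w')).
      by rewrite mem_set// mulr1 subrr normr0 mulr_ge0// b0.
    rewrite memNset// mulr0 subr0 mem_set ?mulr1//.
  apply: le_trans (le_normr_Rintegral _ _) _ => //; first exact: integrableBr.
  apply: le_Rintegral => //; first exact: (integrable_norm (integrableBr ig if_)).
rewrite !ler_norml; move: diff; rewrite ler_norml.
have -> : (u + 1 + M) * rn = u * rn + n%:R * ((1 + M) / rn).
  by rewrite -[X in _ = _ + X * _]rn2; field; rewrite gt_eqF.
have nn : 0 < n%:R :> R by rewrite ltr0n.
move=> /andP[d1 d2] /andP[d3 d4].
have := ler_wpM2l (ltW nn) d1; have := ler_wpM2l (ltW nn) d2.
by rewrite !mulrBr => d5 d6; apply/andP; split; lra.
Qed.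

Section family.
Context {d : nat}.
Variables (Theta : set 'cV[R]_d) (ts : 'cV[R]_d) (h : 'cV[R]_d -> S -> 'cV[R]_d).
Variables (D u : R).
Hypotheses (d0 : (0 < d)%N) (Tts : Theta ts) (u1 : 1 <= u).
Hypothesis diamT : forall t t', Theta t -> Theta t' -> enorm (t - t') <= D.
Hypothesis mh : forall th j, Theta th -> measurable_fun setT (fun x => h th x j 0).
Hypothesis h_lip : forall x th th' j, Theta th -> Theta th' ->
  `|h th x j 0 - h th' x j 0| <= b x * enorm (th - th').
Hypothesis h_ts : forall x j, `|h ts x j 0| <= Num.sqrt d%:R * b x.
Hypothesis E_ts : forall j, \int[P]_w (h ts (X w) j 0) = 0.
Local Notation rd := (Num.sqrt d%:R : R).

Let nn0 : 0 < n%:R :> R. Proof. by rewrite ltr0n. Qed.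

Let ih th j : Theta th -> P.-integrable setT (EFin \o (fun w => h th (X w) j 0)).
Proof.
move=> Tth; have mX' := measurableT_comp (mh j Tth) mX.
apply: (integrable_dom (g := fun w => (enorm (th - ts) + rd) * b (X w))) => //.
  move=> w; rewrite -[h th (X w) j 0](subrK (h ts (X w) j 0)).
  apply: le_trans (ler_normD _ _) _; have := h_lip (X w) j Tth Tts; have := h_ts (X w) j.
  by lra.
exact: integrableZr.
Qed.

Let M0 : 0 <= M.
Proof. by apply: le_trans bM; apply: Rintegral_ge0 => w _; exact: exprn_ge0. Qed.

(** A union bound over a net of [Theta] and the coordinates, applied to increments divided by their
    distance to [ts], gives deviations that shrink with [enorm (th - ts)]. *)
Lemma empirical_process : exists2 A : set T, measurable A &
  fine (P A) <= M / rn + (2 * D * (n%:R ^+ 2 * d%:R) + 1) ^+ d * d%:R *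
    (2 * expR (expR 1 * (1 + M) - u)) /\
  forall w, ~ A w -> forall th j, Theta th ->
      `|\sum_i (h th (Y i w) j 0 - h ts (Y i w) j 0) -
        n%:R * \int[P]_w (h th (X w) j 0)| <=
      (u + 1 + M) * rn * (enorm (th - ts) + 3 / n%:R).
Proof.
have rd1 : 1 <= rd by exact: rd_ge1.
have rd0 : 0 < rd by lra.
have rdd : rd * rd = d%:R by rewrite -expr2 sqr_sqrtr.
have dd0 : 0 < d%:R :> R by rewrite ltr0n.
(* Net points come within [n ^- 2]. With the envelope at most [rn], passing to the net changes the
   sum by at most [rn / n%:R]. *)
pose s : R := (n%:R ^+ 2 * d%:R)^-1.
have s0 : 0 < s by rewrite invr_gt0 mulr_gt0// exprn_gt0.
have [K [t [cK Tt near]]] := finite_net Tts s0 diamT.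
rewrite /s invrK in cK.
(* The summand [1 / n] keeps the weights bounded for net points near [ts]. *)
pose l k := enorm (t k - ts) + n%:R^-1.
have l0 k : 0 < l k by rewrite ltr_wpDl ?enorm_ge0// invr_gt0.
pose g (kj : K * 'I_d) x := (l kj.1)^-1 * (h (t kj.1) x kj.2 0 - h ts x kj.2 0).
have mg kj : measurable_fun setT (g kj).
  by apply: measurable_funM => //; apply: measurable_funB; exact: mh.
have gb kj x : `|g kj x| <= b x.
  rewrite /g normrM gtr0_norm ?invr_gt0// ler_pdivrMl//.
  apply: le_trans (h_lip x kj.2 (Tt kj.1) Tts) _; rewrite mulrC ler_wpM2r//.
  by rewrite /l lerDl invr_ge0 ltW.
have [A mA [PA hA]] := envelope_deviation u mg gb.
exists A => //; split.
  apply: le_trans PA _; rewrite lerD2l; apply: ler_wpM2r.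
    by rewrite mulr_ge0// expR_ge0.
  by rewrite card_prod card_ord natrM ler_wpM2r.
move=> w nA th j Tth; have [bY gY] := hA w nA.
have [k hk] := near th Tth.
have hk1 : enorm (th - t k) <= (n%:R ^+ 2)^-1.
  apply: le_trans hk _; rewrite /s invfM mulrCA ler_piMr//.
  by rewrite ler_pdivrMr// mul1r -[leRHS]rdd ler_peMr// ltW.
have -> : \int[P]_w h th (X w) j 0 =
    \int[P]_w (h th (X w) j 0 - h (t k) (X w) j 0) +
    \int[P]_w (h (t k) (X w) j 0 - h ts (X w) j 0).
  rewrite !RintegralB//; try exact: ih.
  by rewrite E_ts subr0 subrK.
have -> : \sum_i (h th (Y i w) j 0 - h ts (Y i w) j 0) =
    \sum_i (h th (Y i w) j 0 - h (t k) (Y i w) j 0) +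
    \sum_i (h (t k) (Y i w) j 0 - h ts (Y i w) j 0).
  by rewrite -big_split; apply: eq_bigr => i _ /=; rewrite addrA subrK.
have c1 : `|\sum_i (h (t k) (Y i w) j 0 - h ts (Y i w) j 0) -
    n%:R * \int[P]_w (h (t k) (X w) j 0 - h ts (X w) j 0)| <= (u + 1 + M) * rn * l k.
  have := gY (k, j); rewrite /g/=.
  rewrite -mulr_sumr RintegralZl//; last by apply: integrableBr; exact: ih.
  rewrite mulrCA -mulrBr normrM gtr0_norm ?invr_gt0// ler_pdivrMl//.
  by rewrite [leRHS]mulrC.
have c2 : `|\sum_i (h th (Y i w) j 0 - h (t k) (Y i w) j 0)| <= rn / n%:R.
  apply: le_trans (ler_norm_sum _ _ _) _.
  apply: (@le_trans _ _ (\sum_(i < n) rn * (n%:R ^+ 2)^-1)).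
    apply: ler_sum => i _; apply: le_trans (h_lip (Y i w) j Tth (Tt k)) _.
    by apply: ler_pM => //; exact: enorm_ge0.
  rewrite sumr_const card_ord -(mulr_natr (rn * (n%:R ^+ 2)^-1)).
  rewrite (_ : rn * (n%:R ^+ 2)^-1 * n%:R = rn / n%:R)//.
  by field; rewrite gt_eqF.
have c3 : `|n%:R * \int[P]_w (h th (X w) j 0 - h (t k) (X w) j 0)| <= (1 + M) / n%:R.
  rewrite normrM (gtr0_norm nn0) -ler_pdivlMl// mulrCA -invfM -expr2.
  apply: le_trans (ler_wpM2r _ Eb); last by rewrite invr_ge0 exprn_ge0.
  rewrite mulrC -RintegralZl//.
  have iB : P.-integrable setT (EFin \o (fun w => h th (X w) j 0 - h (t k) (X w) j 0)).
    by apply: integrableBr; exact: ih.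
  apply: le_trans (le_normr_Rintegral _ _) _ => //.
  apply: le_Rintegral => //; first exact: (integrable_norm iB).
    exact: integrableZr.
  move=> w' _ /=; apply: le_trans (h_lip _ _ Tth (Tt k)) _.
  by rewrite mulrC ler_wpM2r.
have rn1 : 1 <= rn by rewrite -[leLHS]sqrtr1 ler_wsqrtr// ler1n.
(* One [1 / n] is in the weight and one covers the distance to the net; the third one in the
   statement absorbs [c2] and [c3]. *)
have lk : l k <= enorm (th - ts) + 2 / n%:R.
  have -> : 2 / n%:R = n%:R^-1 + n%:R^-1 :> R by ring.
  rewrite addrA lerD2r; have -> : t k - ts = (th - ts) + (t k - th).
    by rewrite [RHS]addrC addrA subrK.
  apply: le_trans (ler_enormD _ _) _; rewrite lerD2l enormC; apply: le_trans hk1 _.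
  by rewrite lef_pV2 ?posrE ?exprn_gt0// ler_eXnr// ler1n.
rewrite mulrDr opprD addrACA; apply: le_trans (ler_normD _ _) _.
apply: le_trans (lerD (ler_normB _ _) c1) _.
apply: le_trans (lerD (lerD c2 c3) (ler_wpM2l _ lk)) _.
  by rewrite mulr_ge0// ?(ltW rn0)//; have := M0; have := u1; lra.
have nV : 0 < n%:R^-1 :> R by rewrite invr_gt0.
have q1 : (1 + M) / n%:R <= (1 + M) * rn / n%:R.
  by rewrite ler_wpM2r ?(ltW nV)// ler_peMr//; have := M0; lra.
have hu : 0 <= (u - 1) * rn / n%:R.
  by rewrite mulr_ge0 ?(ltW nV)// mulr_ge0 ?(ltW rn0)// subr_ge0.
lra.
Qed.

Lemma centered_deviation : exists2 A : set T, measurable A &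
  fine (P A) <= M / rn + d%:R * (2 * expR (expR 1 * (1 + M) - u)) /\
  forall w, ~ A w -> forall j, `|\sum_i h ts (Y i w) j 0| <= (u + 1 + M) * rn * rd.
Proof.
have rd0 : 0 < rd by exact: rd_gt0.
pose g (j : 'I_d) x := rd^-1 * h ts x j 0.
have mg j : measurable_fun setT (g j) by apply: measurable_funM => //; exact: mh.
have gb j x : `|g j x| <= b x.
  by rewrite /g normrM gtr0_norm ?invr_gt0// ler_pdivrMl.
have [A mA [PA hA]] := envelope_deviation u mg gb.
exists A => //; split; first by rewrite card_ord in PA.
move=> w nA j; have [_ /(_ j)] := hA w nA; rewrite /g.
rewrite -mulr_sumr RintegralZl//; last exact: ih.
rewrite E_ts mulr0 mulr0 subr0 normrM gtr0_norm ?invr_gt0// ler_pdivrMl//.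
by rewrite mulrC.
Qed.

End family.
End EmpiricalProcess.

(** * Linearization *)

Section Linearization.
Context {R : realType} {d n : nat}.
Hypotheses (d0 : (0 < d)%N) (n0 : (0 < n)%N).
Local Notation rd := (Num.sqrt d%:R : R).
Local Notation rn := (Num.sqrt n%:R : R).
Variables (B A : 'M[R]_d) (mu c1 lamV u v : R).
Hypotheses (mu0 : 0 < mu) (c10 : 0 <= c1) (lam0 : 0 <= lamV).
Hypotheses (u1 : 1 <= u) (v1 : 1 <= v).
Hypothesis B_le : forall x, enorm (B *m x) <= lamV * enorm x.
Variables (th ts psi : 'cV[R]_d) (a e : 'I_n -> 'cV[R]_d).
Local Notation del := (enorm (th - ts)).
Hypothesis root_th : \sum_i a i = 0.
Hypothesis dev_ts : forall j, `|\sum_i e i j 0| <= v * rn * rd.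
Hypothesis dev_th : forall j,
  `|\sum_i (a i j 0 - e i j 0) - n%:R * psi j 0| <= u * rn * (del + 3 / n%:R).
Hypothesis mono : mu * del ^+ 2 <= dotv psi (th - ts).
Hypothesis lin : enorm (psi - A *m (th - ts)) <= c1 * del ^+ 2.
Hypothesis small : rd * u / rn <= mu / 2.

Let rn1 : 1 <= rn. Proof. by rewrite -[leLHS]sqrtr1 ler_wsqrtr// ler1n. Qed.
Let rn0 : 0 < rn. Proof. exact: lt_le_trans ltr01 rn1. Qed.
Let rn2 : rn ^+ 2 = n%:R. Proof. by rewrite sqr_sqrtr// ler0n. Qed.
Let rd1 : 1 <= rd. Proof. exact: rd_ge1. Qed.
Let rd0 : 0 < rd. Proof. exact: rd_gt0. Qed.
Let del0 : 0 <= del. Proof. exact: enorm_ge0. Qed.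

Let kap : R := 2 / mu + 3.

(** [s] is the normalized score at [ts]; [ee] is the increment of the empirical process between [ts]
    and [th]. *)
Let s : 'cV[R]_d := rn^-1 *: \sum_i e i.
Let ee : 'cV[R]_d := rn^-1 *: \sum_i (a i - e i) - rn *: psi.

Let s_le : enorm s <= rd ^+ 2 * v.
Proof.
have -> : rd ^+ 2 * v = rd * (rd * v) by ring.
apply: enorm_le_coord => [|j]; first by rewrite mulr_ge0 ?(ltW rd0)//; have := v1; lra.
rewrite mxE summxE normrM gtr0_norm ?invr_gt0// ler_pdivrMl//.
by apply: le_trans (dev_ts j) _; rewrite le_eqVlt; apply/orP; left; apply/eqP; ring.
Qed.

Let ee_le : enorm ee <= rd * u * (del + 3 / rn ^+ 2).
Proof.
rewrite -mulrA; apply: enorm_le_coord => [|j].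
  apply: mulr_ge0; first by have := u1; lra.
  by apply: addr_ge0 => //; rewrite divr_ge0// exprn_ge0// ltW.
have -> : ee j 0 = rn^-1 * (\sum_i (a i j 0 - e i j 0) - n%:R * psi j 0).
  rewrite !mxE summxE mulrBr -[X in _ = _ - _ * (X * _)]rn2; congr (_ - _).
    by congr (_ * _); apply: eq_bigr => i _; rewrite !mxE.
  by field; rewrite gt_eqF.
rewrite normrM gtr0_norm ?invr_gt0// ler_pdivrMl//.
apply: le_trans (dev_th j) _; rewrite rn2 le_eqVlt; apply/orP; left; apply/eqP; ring.
Qed.

Let psiE : rn *: psi = - (s + ee).
Proof.
have : s + ee = - (rn *: psi).
  rewrite /s /ee addrA -scalerDr -big_split/=.
  under eq_bigr do rewrite addrCA subrr addr0.
  by rewrite root_th scaler0 add0r.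
by move=> ->; rewrite opprK.
Qed.

(** Monotonicity bounds [mu * del * rn] by the norms of [s] and [ee]. The bound on [ee] contains
    [del] again; by [small] that part is at most half of the left side and is absorbed, which
    produces [2 / mu + 3]. *)
Let del_le : del * rn <= kap * rd ^+ 2 * v.
Proof.
have h1 : mu * del ^+ 2 * rn <= del * (enorm s + enorm ee).
  have : rn * dotv psi (th - ts) <= (enorm s + enorm ee) * del.
    rewrite -dotvZl psiE; apply: le_trans (dotv_le _ _) _.
    by rewrite ler_wpM2r// enormN; exact: ler_enormD.
  by have := ler_wpM2l (ltW rn0) mono; lra.
have h2 : mu * (del * rn) <= enorm s + enorm ee.
  have := del0; rewrite le_eqVlt => /predU1P[<-|dl0].
    by rewrite mul0r mulr0 addr_ge0// enorm_ge0.
  by rewrite -(ler_pM2l dl0); lra.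
have h3 : rd * u * (del + 3 / rn ^+ 2) <= mu / 2 * rn * (del + 3 / rn ^+ 2).
  apply: ler_wpM2r; last by have := small; rewrite ler_pdivrMr.
  by apply: addr_ge0 => //; rewrite divr_ge0// exprn_ge0// ltW.
have rV : rn / rn ^+ 2 <= 1.
  by rewrite ler_pdivrMr ?exprn_gt0// mul1r expr2 ler_peMr// ltW.
have rdv : 1 <= rd ^+ 2 * v by rewrite mulr_ege1// exprn_ege1.
have h4 : mu * (del * rn) <= 2 * (rd ^+ 2 * v) + 3 * mu.
  have := s_le; have := ee_le.
  have e1 : mu / 2 * rn * (del + 3 / rn ^+ 2) =
      mu * (del * rn) / 2 + 3 / 2 * (mu * (rn / rn ^+ 2)).
    by field; rewrite gt_eqF.
  move: h3; rewrite e1.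
  have := ler_wpM2l (ltW mu0) rV; lra.
rewrite -(ler_pM2l mu0); apply: le_trans h4 _.
have -> : mu * (kap * rd ^+ 2 * v) = 2 * (rd ^+ 2 * v) + 3 * (mu * (rd ^+ 2 * v)).
  by rewrite /kap; field; rewrite gt_eqF.
rewrite lerD2l ler_pM2l// ler_peMr// ltW//.
Qed.

(** Since [th] is a root, [rn *: psi = - (s + ee)]. What remains is [ee] and [rn] times the
    nonlinear part of [psi], which is quadratic in [del]; both are O(1 / rn) by [del_le]. *)
Lemma linearization :
  enorm (rn *: (B *m A *m (th - ts)) - \sum_i (hstep n *: (- (B *m e i)))) <=
  lamV * ((kap + 3) * (rd ^+ 3 * u * v) + c1 * kap ^+ 2 * (rd ^+ 4 * v ^+ 2)) / rn.
Proof.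
pose q := A *m (th - ts) - psi.
have -> : rn *: (B *m A *m (th - ts)) - \sum_i (hstep n *: (- (B *m e i))) =
    B *m (rn *: q - ee).
  have -> : \sum_i (hstep n *: (- (B *m e i))) = - (B *m s).
    rewrite -scaler_sumr sumrN scalerN -mulmx_sumr /s.
    by rewrite -scalemxAr.
  rewrite opprK -mulmxA scalemxAr -mulmxDr; congr (_ *m _).
  by rewrite /q scalerBr psiE opprK -addrA addrK.
apply: le_trans (B_le _) _; rewrite -mulrA; apply: ler_wpM2l => //.
apply: le_trans (ler_enormD _ _) _; rewrite enormN enormZ (gtr0_norm rn0).
rewrite ler_pdivlMr//.
have kap0 : 0 <= kap by rewrite /kap addr_ge0// divr_ge0// ltW.
have dr := del_le.
have dr0 : 0 <= del * rn by rewrite mulr_ge0// ltW.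
have q_le : enorm q * rn ^+ 2 <= c1 * kap ^+ 2 * (rd ^+ 4 * v ^+ 2).
  have -> : c1 * kap ^+ 2 * (rd ^+ 4 * v ^+ 2) = c1 * (kap * rd ^+ 2 * v) ^+ 2 by ring.
  apply: (@le_trans _ _ (c1 * (del * rn) ^+ 2)).
    have -> : c1 * (del * rn) ^+ 2 = c1 * del ^+ 2 * rn ^+ 2 by ring.
    by apply: ler_wpM2r; [exact: sqr_ge0|rewrite /q (enormC _ psi); exact: lin].
  by apply: ler_wpM2l => //; rewrite lerXn2r ?nnegrE//; exact: le_trans dr0 dr.
have rdv : 1 <= rd ^+ 2 * v by rewrite mulr_ege1// exprn_ege1.
have e_le : enorm ee * rn <= (kap + 3) * (rd ^+ 3 * u * v).
  apply: (@le_trans _ _ (rd * u * (del * rn + 3))).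
    apply: le_trans (ler_wpM2r (ltW rn0) ee_le) _; rewrite -(mulrA (rd * u)); apply: ler_wpM2l.
      by rewrite mulr_ge0 ?(ltW rd0)//; have := u1; lra.
    rewrite mulrDl lerD2l -mulrA ler_piMr// mulrC -[_ * _]/(rn / rn ^+ 2).
    by rewrite ler_pdivrMr ?exprn_gt0// mul1r expr2 ler_peMr// ltW.
  have -> : (kap + 3) * (rd ^+ 3 * u * v) = rd * u * (kap * rd ^+ 2 * v + 3 * (rd ^+ 2 * v)) by ring.
  apply: ler_wpM2l; first by rewrite mulr_ge0 ?(ltW rd0)//; have := u1; lra.
  by apply: lerD => //; lra.
by move: q_le e_le; rewrite expr2 mulrA; lra.
Qed.

End Linearization.

(** * Numerical estimates and the main bound *)

Section TailNumerics.
Context {R : realType} {d n : nat}.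
Hypotheses (d0 : (0 < d)%N) (n0 : (0 < n)%N) (dn : (d <= n)%N).
Local Notation l := (ln n%:R : R).
Local Notation rn := (Num.sqrt n%:R : R).

Let nn0 : 0 < n%:R :> R. Proof. by rewrite ltr0n. Qed.
Let l0 : 0 <= l. Proof. by rewrite ln_ge0// ler1n. Qed.
Let nE : n%:R = expR l. Proof. by rewrite lnK. Qed.
Let d1 : 1 <= d%:R :> R. Proof. by rewrite ler1n. Qed.
Let dle : d%:R <= expR l. Proof. by rewrite lnK// ler_nat. Qed.

Let rnE : rn = expR (l / 2).
Proof.
have <- : Num.sqrt (expR (l / 2) ^+ 2) = expR (l / 2) by rewrite sqrtr_sqr ger0_norm// expR_ge0.
by rewrite -expRM_natl (mulrC 2) divfK// lnK.
Qed.

Lemma centered_tail (c : R) : d%:R * (2 * expR (c - 2 * (1 + l))) <= 2 * expR c / rn.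
Proof.
rewrite rnE -expRN mulrCA -mulrA -expRD ler_pM2l//.
apply: le_trans (ler_wpM2r (expR_ge0 _) dle) _.
rewrite -expRD ler_expR; have := l0; lra.
Qed.

(** For [d <= n] the net has at most [expR (d%:R * (2 * D + 3 * l))] points, because
    [n ^ 2 * d <= n ^ 3]. The factor 5 leaves room for [expR l], which counts the coordinates, and
    for [expR (l / 2)], which is [rn]. *)
Lemma net_tail (c D : R) : 0 <= D ->
  (2 * D * (n%:R ^+ 2 * d%:R) + 1) ^+ d * d%:R *
    (2 * expR (c - 5 * d%:R * (D + 1) * (1 + l))) <= 2 * expR c / rn.
Proof.
move=> D0; rewrite rnE -expRN (mulrCA _ 2) -(mulrA 2 (expR c)) -expRD ler_pM2l//.
have base : 2 * D * (n%:R ^+ 2 * d%:R) + 1 <= expR (2 * D + 3 * l).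
  have -> : expR (2 * D + 3 * l) = expR (2 * D) * n%:R ^+ 3.
    by rewrite expRD [expR (3 * l)]expRM_natl -nE.
  have h1 := expR_ge1Dx (2 * D).
  have h2 : n%:R ^+ 2 * d%:R <= n%:R ^+ 3 :> R.
    by rewrite (exprSr _ 2) ler_wpM2l ?exprn_ge0// ler_nat.
  have h3 : 1 <= n%:R ^+ 3 :> R by rewrite exprn_ege1// ler1n.
  have h4 : 2 * D * (n%:R ^+ 2 * d%:R) <= 2 * D * n%:R ^+ 3.
    by rewrite ler_wpM2l// mulr_ge0.
  have h5 : (1 + 2 * D) * n%:R ^+ 3 <= expR (2 * D) * n%:R ^+ 3.
    by rewrite ler_wpM2r// exprn_ge0.
  by lra.
have b0 : 0 <= 2 * D * (n%:R ^+ 2 * d%:R) + 1.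
  by rewrite addr_ge0// !mulr_ge0// exprn_ge0.
apply: (@le_trans _ _ (expR (d%:R * (2 * D + 3 * l)) * expR l *
    expR (c - 5 * d%:R * (D + 1) * (1 + l)))).
  apply: ler_wpM2r; first exact: expR_ge0.
  apply: ler_pM => //; first exact: exprn_ge0.
  rewrite expRM_natl; apply: lerXn2r => //; rewrite nnegrE ?expR_ge0//.
rewrite -!expRD ler_expR.
have h1 : 0 <= (d%:R - 1) * l by rewrite mulr_ge0 ?subr_ge0.
have h2 : 0 <= d%:R * D by rewrite mulr_ge0.
have h3 : 0 <= d%:R * D * l by rewrite mulr_ge0.
have := l0; have := d1; lra.
Qed.

End TailNumerics.

(** With [l = ln n]: (1 + l)^2 <= 2 + 2 l^2 and (eps l)^2 <= 2 exp(eps l). *)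
Lemma log_sqr_le {R : realType} (eps : R) n : 0 < eps -> (0 < n)%N ->
  (1 + ln n%:R) ^+ 2 <= (2 + 4 / eps ^+ 2) * n%:R `^ eps :> R.
Proof.
move=> e0 n0; have nn0 : 0 < n%:R :> R by rewrite ltr0n.
have l0 : 0 <= ln n%:R :> R by rewrite ln_ge0// ler1n.
rewrite /powR gt_eqF//; set l := ln _ in l0 *.
have el0 : 0 <= eps * l by rewrite mulr_ge0// ltW.
have h2 : (eps * l) ^+ 2 <= 2 * expR (eps * l) by exact: (exprn_le_expR 2 el0).
have h1 : 1 <= expR (eps * l) by rewrite -[leLHS]expR0 ler_expR.
have e2 : 0 < eps ^+ 2 by rewrite exprn_gt0.
have h3 : l ^+ 2 <= 2 / eps ^+ 2 * expR (eps * l).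
  rewrite mulrAC ler_pdivlMr//; apply: le_trans h2.
  by rewrite exprMn mulrC.
rewrite mulrDl; have := sqr_ge0 (1 - l).
have -> : 4 / eps ^+ 2 * expR (eps * l) = 2 * (2 / eps ^+ 2 * expR (eps * l)) by ring.
lra.
Qed.

Section MainBound.
Context {R : realType}.

(* The first three summands come from the Berry-Esseen bound for the linear part,
   from the probability of the bad event and from the linearization error;
   the last two make the bound trivial when [n] is too small. *)
Definition main_const (mu c1 lamV M : R) : R :=
  let kap := 2 / mu + 3 in
  5376 * Krem * (lamV ^+ 3 * M + (1 + 4`!%:R * (2 * expR (1 / 2))) / 2) +
  (2 * M + 4 * expR (expR 1 * (1 + M))) +
  96 * (lamV * ((kap + 3) * ((6 + M) * (3 + M)) + c1 * kap ^+ 2 * (3 + M) ^+ 2)) +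
  2 * (6 + M) / mu + 1.

Lemma main_const_ge (mu c1 lamV M : R) : 0 < mu -> 0 < c1 -> 0 < lamV -> 0 <= M ->
  2 * (6 + M) / mu + 1 <= main_const mu c1 lamV M.
Proof.
move=> mu0 c10 lam0 M0; have kap0 : 0 <= 2 / mu + 3.
  by rewrite addr_ge0// divr_ge0// ltW.
rewrite /main_const -[leRHS]addrA lerDr; apply: addr_ge0; first apply: addr_ge0.
- apply: mulr_ge0.
    by apply: mulr_ge0; [exact: ler0n|exact/ltW/Krem_gt0].
  apply: addr_ge0; first by rewrite mulr_ge0// exprn_ge0// ltW.
  by rewrite divr_ge0// addr_ge0// mulr_ge0// mulr_ge0// expR_ge0.
- by rewrite addr_ge0// mulr_ge0// expR_ge0.
- apply: mulr_ge0 => //; apply: mulr_ge0; first exact: ltW.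
  apply: addr_ge0; apply: mulr_ge0; last exact: sqr_ge0.
  + by rewrite addr_ge0.
  + by rewrite mulr_ge0// addr_ge0.
  + by rewrite mulr_ge0 ?sqr_ge0// ltW.
Qed.

(** The dominant term is [rd * (rd ^+ 3 * u * v)] from the linearization: [u] of order
    [rd ^+ 2 * (D + 1) * L] and [v] of order [L] give the sixth power of [rd] and the square of
    [L]. *)
Lemma main_numerics (d n : nat) (mu c1 lamV M D u v : R)
    (rd := Num.sqrt d%:R : R) (rn := Num.sqrt n%:R : R) (L := 1 + ln n%:R : R)
    (kap := 2 / mu + 3) :
  (0 < d)%N -> (0 < n)%N -> 0 < mu -> 0 < c1 -> 0 < lamV -> 0 <= M -> 0 <= D ->
  1 <= u -> 1 <= v ->
  u <= (6 + M) * (rd ^+ 2 * (D + 1) * L) -> v <= (3 + M) * L ->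
  5376 * Krem * (lamV ^+ 3 * M * rd ^+ 3 + @gauss_beta R d) * harm n * d%:R * hstep n +
  2 * (M / rn + 2 * expR (expR 1 * (1 + M)) / rn) +
  96 * rd * (lamV * ((kap + 3) * (rd ^+ 3 * u * v) + c1 * kap ^+ 2 * (rd ^+ 4 * v ^+ 2)) / rn)
  <= main_const mu c1 lamV M * (rd ^+ 6 * (D + 1) * L ^+ 2 / rn).
Proof.
move=> d0 n0 mu0 c10 lam0 M0 D0 u1 v1 ule vle.
have rd1 : 1 <= rd by exact: rd_ge1.
have rd0 : 0 < rd by exact: rd_gt0.
have rn0 : 0 < rn by rewrite sqrtr_gt0 ltr0n.
have L1 : 1 <= L by rewrite lerDl ln_ge0// ler1n.
have L0 : 0 < L by exact: lt_le_trans ltr01 L1.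
have D1 : 1 <= D + 1 by rewrite lerDr.
have kap0 : 0 < kap by rewrite /kap addr_gt0// divr_gt0.
have hL := @harm_le R n n0; rewrite -/L in hL.
have h1 := @harm_ge1 R n n0.
rewrite -(sqr_sqrtr (ler0n R d)) -/rd /gauss_beta -/rd /hstep -/rn.
set gb := (1 + 4`!%:R * _) / 2.
have gb0 : 0 <= gb.
  by rewrite /gb divr_ge0// addr_ge0// mulr_ge0// mulr_ge0// expR_ge0.
set E := expR (expR 1 * _); have E0 : 0 <= E by exact: expR_ge0.
set F := rd ^+ 6 * (D + 1) * L ^+ 2.
have rdX k m : (k <= m)%N -> rd ^+ k <= rd ^+ m by move=> km; rewrite ler_weXn2l.
have Fge k x : (k <= 6)%N -> 0 <= x -> x <= L ^+ 2 -> rd ^+ k * x <= F.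
  move=> k6 x0 xL; apply: ler_pM => //; first exact/exprn_ge0/ltW.
  by apply: le_trans (rdX _ _ k6) _; rewrite ler_peMr// exprn_ge0// ltW.
have LL : L <= L ^+ 2 by rewrite ler_eXnr.
have F1 : 1 <= F.
  by have := Fge 0%N 1 isT ler01; rewrite expr0 mulr1; apply; exact: exprn_ege1.
have KK : 0 <= 5376 * (Krem : R).
  by apply: mulr_ge0; [exact: ler0n|exact/ltW/Krem_gt0].
set c := 5376 * Krem in KK *.
have e1 : (lamV ^+ 3 * M * rd ^+ 3 + gb * rd ^+ 3) * harm n * rd ^+ 2 <= (lamV ^+ 3 * M + gb) * F.
  have -> : (lamV ^+ 3 * M * rd ^+ 3 + gb * rd ^+ 3) * harm n * rd ^+ 2 =
    (lamV ^+ 3 * M + gb) * (rd ^+ 5 * harm n) by ring.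
  apply: ler_wpM2l; first by rewrite addr_ge0// mulr_ge0// exprn_ge0// ltW.
  by apply: Fge => //; [exact: le_trans ler01 h1|exact: le_trans hL LL].
have v0 : 0 <= v by exact: le_trans ler01 v1.
have u0 : 0 <= u by exact: le_trans ler01 u1.
have e2 : rd * (rd ^+ 3 * u * v) <= (6 + M) * (3 + M) * F.
  have -> : rd * (rd ^+ 3 * u * v) = rd ^+ 4 * (u * v) by ring.
  have -> : (6 + M) * (3 + M) * F =
    rd ^+ 4 * (((6 + M) * (rd ^+ 2 * (D + 1) * L)) * ((3 + M) * L)) by rewrite /F; ring.
  by apply: ler_wpM2l; [exact/exprn_ge0/ltW|exact: ler_pM].
have e3 : rd * (rd ^+ 4 * v ^+ 2) <= (3 + M) ^+ 2 * F.
  have -> : rd * (rd ^+ 4 * v ^+ 2) = rd ^+ 5 * v ^+ 2 by ring.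
  apply: (@le_trans _ _ ((3 + M) ^+ 2 * (rd ^+ 5 * L ^+ 2))).
    have -> : (3 + M) ^+ 2 * (rd ^+ 5 * L ^+ 2) = rd ^+ 5 * ((3 + M) * L) ^+ 2 by ring.
    apply: ler_wpM2l; first exact/exprn_ge0/ltW.
    by apply: lerXn2r; rewrite ?nnegrE// (le_trans v0).
  apply: ler_wpM2l; first exact: sqr_ge0.
  by apply: Fge => //; exact: sqr_ge0.
rewrite [leRHS]mulrA ler_pdivlMr// /main_const -/kap -/gb -/E -/c.
have -> : (c * (lamV ^+ 3 * M * rd ^+ 3 + gb * rd ^+ 3) * harm n * rd ^+ 2 / rn +
    2 * (M / rn + 2 * E / rn) +
    96 * rd * (lamV * ((kap + 3) * (rd ^+ 3 * u * v) + c1 * kap ^+ 2 * (rd ^+ 4 * v ^+ 2)) / rn)) * rn =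
  c * ((lamV ^+ 3 * M * rd ^+ 3 + gb * rd ^+ 3) * harm n * rd ^+ 2) + (2 * M + 4 * E) +
  96 * (lamV * ((kap + 3) * (rd * (rd ^+ 3 * u * v)) + c1 * kap ^+ 2 * (rd * (rd ^+ 4 * v ^+ 2)))).
  by field; rewrite gt_eqF.
have f1 := ler_wpM2l KK e1.
have f2 : (2 * M + 4 * E) <= (2 * M + 4 * E) * F.
  by rewrite ler_peMr// addr_ge0// mulr_ge0.
have f3 : (kap + 3) * (rd * (rd ^+ 3 * u * v)) <= (kap + 3) * ((6 + M) * (3 + M) * F).
  by apply: ler_wpM2l => //; rewrite addr_ge0// ltW.
have f4 : c1 * kap ^+ 2 * (rd * (rd ^+ 4 * v ^+ 2)) <= c1 * kap ^+ 2 * ((3 + M) ^+ 2 * F).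
  by apply: ler_wpM2l => //; rewrite mulr_ge0 ?(ltW c10)// sqr_ge0.
have f5 := ler_wpM2l (ltW lam0) (lerD f3 f4).
have f6 : 0 <= (2 * (6 + M) / mu + 1) * F.
  apply: mulr_ge0; last exact: le_trans ler01 F1.
  by rewrite addr_ge0// divr_ge0 ?(ltW mu0)// mulr_ge0// addr_ge0.
have f7 : lamV * ((kap + 3) * ((6 + M) * (3 + M) * F) + c1 * kap ^+ 2 * ((3 + M) ^+ 2 * F)) =
  lamV * ((kap + 3) * ((6 + M) * (3 + M)) + c1 * kap ^+ 2 * (3 + M) ^+ 2) * F by ring.
rewrite f7 in f5; rewrite -[X in X * F]addrA [leRHS]mulrDl.
rewrite [X in _ <= X + _]mulrDl [X in _ <= X + _ + _]mulrDl -(mulrA c) -(mulrA 96).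
by rewrite -[leLHS]addr0; apply: lerD => //; apply: lerD; [exact: lerD|rewrite ler_pM2l].
Qed.

Context {d n : nat}.
Hypotheses (d0 : (0 < d)%N) (n0 : (0 < n)%N).
Local Notation rd := (Num.sqrt d%:R : R).
Local Notation rn := (Num.sqrt n%:R : R).
Local Notation L := (1 + ln n%:R : R).
Variables (mu c1 lamV M D : R).
Hypotheses (mu0 : 0 < mu) (c10 : 0 < c1) (lam0 : 0 < lamV) (M0 : 0 <= M) (D0 : 0 <= D).

Context {dT dS dU : measure_display}.
Context {T : measurableType dT} {S : measurableType dS} {U : measurableType dU}.
Variables (P : probability T R) (P' : probability U R) (Z : U -> 'cV[R]_d).
Hypothesis gZ : std_gaussian P' Z.
Variables (X : T -> S) (Y : 'I_n -> T -> S).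
Hypothesis mX : measurable_fun setT X.
Hypothesis mY : forall i, measurable_fun setT (Y i).
Hypothesis ind_Y : mutually_independent P Y.
Hypothesis law_Y : forall i B, measurable B -> P (Y i @^-1` B) = P (X @^-1` B).
Variables (b : S -> R) (Theta : set 'cV[R]_d) (ts : 'cV[R]_d)
  (h : 'cV[R]_d -> S -> 'cV[R]_d).
Hypotheses (mb : measurable_fun setT b) (b0 : forall x, 0 <= b x).
Hypothesis ib : P.-integrable setT (EFin \o (fun w => b (X w) ^+ 3)).
Hypothesis bM : \int[P]_w (b (X w) ^+ 3) <= M.
Hypothesis Tts : Theta ts.
Hypothesis diamT : forall t t', Theta t -> Theta t' -> enorm (t - t') <= D.
Hypothesis mh : forall th j, Theta th -> measurable_fun setT (fun x => h th x j 0).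
Hypothesis h_lip : forall x th th' j, Theta th -> Theta th' ->
  `|h th x j 0 - h th' x j 0| <= b x * enorm (th - th').
Hypothesis h_ts : forall x, enorm (h ts x) <= rd * b x.
Hypothesis E_ts : forall j, \int[P]_w (h ts (X w) j 0) = 0.
Variables (A B : 'M[R]_d).
Hypothesis sB : B^T = B.
Hypothesis cov : B *m (\matrix_(j, k) \int[P]_w (h ts (X w) j 0 * h ts (X w) k 0)) *m B = 1%:M.
Hypothesis B_le : forall x, enorm (B *m x) <= lamV * enorm x.
Let Psi th : 'cV[R]_d := \col_j \int[P]_w (h th (X w) j 0).
Hypothesis mono : forall th, Theta th -> mu * enorm (th - ts) ^+ 2 <= dotv (Psi th) (th - ts).
Hypothesis lin : forall th, Theta th ->
  enorm (Psi th - A *m (th - ts)) <= c1 * enorm (th - ts) ^+ 2.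
Variables (th : T -> 'cV[R]_d) (N : set T).
Hypotheses (mth : random_vector th) (mN : measurable N) (PN : P N = 0%E).
Hypothesis thN : forall w, ~ N w -> Theta (th w) /\ \sum_i h (th w) (Y i w) = 0.

Let rd1 : 1 <= rd. Proof. exact: rd_ge1. Qed.
Let rd0 : 0 < rd. Proof. exact: rd_gt0. Qed.
Let rn1 : 1 <= rn. Proof. by rewrite -[leLHS]sqrtr1 ler_wsqrtr// ler1n. Qed.
Let rn0 : 0 < rn. Proof. exact: lt_le_trans ltr01 rn1. Qed.
Let L1 : 1 <= L. Proof. by rewrite lerDl ln_ge0// ler1n. Qed.
Let rd2 : rd ^+ 2 = d%:R. Proof. by rewrite sqr_sqrtr// ler0n. Qed.

Let V x : 'cV[R]_d := - (B *m h ts x).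

Let mhts : random_vector (h ts). Proof. by move=> j; exact: mh. Qed.

Let mV : random_vector V.
Proof.
have := random_vectorZ (measurable_cst (-1 : R)) (random_vector_mulmx B mhts).
by congr random_vector; apply/funext => x; rewrite scaleN1r.
Qed.

Let ihts j : P.-integrable setT (EFin \o (fun w => h ts (X w) j 0)).
Proof.
have [ib1 _] := integrable_envelope mX mb b0 ib.
apply: (integrable_dom (g := fun w => rd * b (X w))); [|move=> w|exact: integrableZr].
  exact: (measurableT_comp (mhts j) mX).
exact: le_trans (coord_le_enorm _ _) (h_ts _).
Qed.

Let ihts2 j k : P.-integrable setT (EFin \o (fun w => h ts (X w) j 0 * h ts (X w) k 0)).
Proof.
have [_ ib2] := integrable_envelope mX mb b0 ib.
apply: (integrable_dom (g := fun w => rd ^+ 2 * b (X w) ^+ 2)); [|move=> w|exact: integrableZr].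
  by apply: measurable_funM; [exact: (measurableT_comp (mhts j) mX)|
    exact: (measurableT_comp (mhts k) mX)].
rewrite normrM -exprMn expr2; apply: ler_pM => //;
  exact: le_trans (coord_le_enorm _ _) (h_ts _).
Qed.

Let sV : standardized P (V \o X) (lamV ^+ 3 * M * rd ^+ 3).
Proof.
have VE x j : V x j 0 = - \sum_k B j k * h ts x k 0 by rewrite !mxE.
have sBE j k : B j k = B k j by rewrite -[in LHS]sB mxE.
have Vle x : enorm (V x) ^+ 3 <= (lamV * rd) ^+ 3 * b x ^+ 3.
  rewrite -exprMn lerXn2r ?nnegrE ?enorm_ge0//.
    by rewrite !mulr_ge0// ltW.
  rewrite /V enormN; apply: le_trans (B_le _) _.
  by rewrite -mulrA ler_wpM2l// ltW.
have iV : P.-integrable setT (EFin \o (fun w => enorm ((V \o X) w) ^+ 3)).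
  apply: (integrable_dom (g := fun w => (lamV * rd) ^+ 3 * b (X w) ^+ 3)).
  - apply: (measurableT_comp (exprn_measurable 3)); apply: measurable_enorm.
    exact: random_vector_comp mX mV.
  - by move=> w; rewrite ger0_norm ?exprn_ge0 ?enorm_ge0//; exact: Vle.
  - exact: integrableZr.
split.
- exact: random_vector_comp mX mV.
- move=> j /=; under eq_Rintegral do rewrite VE -mulN1r.
  rewrite RintegralZl//; last by apply: integrable_sumr => k; exact: integrableZr.
  rewrite Rintegral_sum; last by move=> k; exact: integrableZr.
  by rewrite big1 ?mulr0// => k _; rewrite RintegralZl// E_ts mulr0.
- move=> j k /=; have := congr1 (fun m : 'M[R]_d => m j k) cov; rewrite !mxE => <-.
  transitivity (\int[P]_w (\sum_a \sum_c
      B j c * B a k * (h ts (X w) c 0 * h ts (X w) a 0))).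
    apply: eq_Rintegral => w _; rewrite !VE mulrNN mulr_sumr.
    apply: eq_bigr => a _; rewrite mulr_suml; apply: eq_bigr => c _.
    by rewrite (sBE k a); ring.
  have i2 a c : P.-integrable setT (EFin \o (fun w =>
      B j c * B a k * (h ts (X w) c 0 * h ts (X w) a 0))) by exact: integrableZr.
  rewrite Rintegral_sum; last by move=> a; exact: integrable_sumr.
  apply: eq_bigr => a _; rewrite Rintegral_sum// mxE mulr_suml.
  by apply: eq_bigr => c _; rewrite RintegralZl// !mxE; ring.
- exact: iV.
- apply: (@le_trans _ _ (\int[P]_w ((lamV * rd) ^+ 3 * b (X w) ^+ 3))).
    apply: le_Rintegral => //; first exact: integrableZr.
    by move=> w _; exact: Vle.
  rewrite RintegralZl// exprMn mulrAC.
  by rewrite ler_wpM2r ?exprn_ge0 ?(ltW rd0)// ler_wpM2l// exprn_ge0// ltW.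
Qed.

Let Q : R := rd ^+ 6 * (D + 1) * L ^+ 2 / rn.

Let rdX k m : (k <= m)%N -> rd ^+ k <= rd ^+ m.
Proof. by move=> km; rewrite ler_weXn2l. Qed.

Let Tw w : 'cV[R]_d := rn *: (B *m A *m (th w - ts)).

Let main_case (C : set 'cV[R]_d) : (d <= n)%N ->
  rd * (5 * d%:R * (D + 1) * L + 1 + M) / rn <= mu / 2 ->
  convex_comb_closed C -> measurable (Tw @^-1` C) -> measurable (Z @^-1` C) ->
  (`|P (Tw @^-1` C) - P' (Z @^-1` C)| <= (main_const mu c1 lamV M * Q)%:E)%E.
Proof.
move=> dn small cC mTC mZC.
(* The thresholds for which [net_tail] and [centered_tail] make the exponential terms O(1 / rn). *)
pose u : R := 5 * d%:R * (D + 1) * L; pose v : R := 2 * L.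
have d1 : 1 <= d%:R :> R by rewrite ler1n.
have dDL : 1 <= d%:R * (D + 1) * L.
  by have := L1; have := D0 => *; rewrite !mulr_ege1//; lra.
have u1 : 1 <= u by rewrite /u; lra.
have v1 : 1 <= v by rewrite /v; have := L1; lra.
have h_ts' x j : `|h ts x j 0| <= rd * b x by exact: le_trans (coord_le_enorm _ _) (h_ts _).
have [A1 mA1 [PA1 hA1]] := empirical_process n0 mX mY ind_Y law_Y mb b0 ib bM d0
  Tts u1 diamT mh h_lip h_ts' E_ts.
have [A2 mA2 [PA2 hA2]] := centered_deviation n0 mX mY ind_Y law_Y mb b0 ib bM v d0
  Tts mh h_lip h_ts' E_ts.
pose u' := u + 1 + M; pose v' := v + 1 + M.
have u1' : 1 <= u' by rewrite /u'; have := M0; lra.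
have v1' : 1 <= v' by rewrite /v'; have := M0; lra.
have ule : u' <= (6 + M) * (rd ^+ 2 * (D + 1) * L).
  rewrite /u' /u rd2; have := ler_wpM2l M0 dDL; lra.
have vle : v' <= (3 + M) * L.
  by rewrite /v' /v; have := L1; have := ler_wpM2l M0 L1; lra.
pose kap : R := 2 / mu + 3.
have kap0 : 0 < kap by rewrite /kap addr_gt0// divr_gt0.
pose r := lamV * ((kap + 3) * (rd ^+ 3 * u' * v') + c1 * kap ^+ 2 * (rd ^+ 4 * v' ^+ 2)) / rn.
have u0' : 0 < u' by lra.
have v0' : 0 < v' by lra.
have r0 : 0 < r.
  rewrite /r divr_gt0// mulr_gt0// addr_gt0//.
    by rewrite !mulr_gt0 ?exprn_gt0// addr_gt0.
  by rewrite !mulr_gt0 ?exprn_gt0.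
pose G := ~` (A1 `|` A2 `|` N).
have mA12 : measurable (A1 `|` A2) by exact: measurableU.
have mBad : measurable (A1 `|` A2 `|` N) by exact: measurableU.
have mG : measurable G by exact: measurableC.
pose e := 2 * expR (expR 1 * (1 + M)) / rn.
have PG : fine (P (~` G)) <= 2 * (M / rn + e).
  rewrite /G setCK; apply: (@le_trans _ _ (fine (P A1) + fine (P A2) + fine (P N))).
    rewrite -!fineD ?fin_numD ?fin_num_measure//; apply: fine_le;
      rewrite ?fin_numD ?fin_num_measure//.
    apply: le_trans (measureU2 _ _ _) _ => //.
    by apply: leeD => //; exact: measureU2.
  rewrite PN addr0 mulr_natl mulr2n; apply: lerD.
    apply: le_trans PA1 _; rewrite lerD2l; exact: net_tail.
  by apply: le_trans PA2 _; rewrite lerD2l; exact: centered_tail.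
pose W w := \sum_(i < n) (@hstep R n) *: V (Y i w).
have mW : random_vector W.
  apply: random_vector_sum => i; apply: random_vectorZ => //.
  exact: random_vector_comp (mY i) mV.
have mTw : random_vector Tw.
  apply: random_vectorZ => //; apply: random_vector_mulmx.
  exact: random_vectorD mth (random_vector_cst (- ts)).
have YW w : G w -> enorm (Tw w - W w) <= r.
  move=> Gw.
  have nA1 : ~ A1 w by move=> Aw; apply: Gw; left; left.
  have nA2 : ~ A2 w by move=> Aw; apply: Gw; left; right.
  have nN : ~ N w by move=> Nw; apply: Gw; right.
  have [Tth root] := thN nN.
  apply: (linearization d0 n0 mu0 (ltW c10) (ltW lam0) u1' v1' B_le root
    (hA2 w nA2) _ (mono Tth) (lin Tth)).
  - by move=> j; rewrite mxE; exact: hA1.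
  - exact: small.
have Wc rho : unit_convex rho -> _ := BerryEsseen gZ d0 n0 mX mY ind_Y law_Y mV sV (rho := rho).
have := convex_transfer gZ d0 mTw mW mG Wc PG r0 YW cC mTC mZC.
move=> /le_trans; apply; rewrite lee_fin.
by apply: (main_numerics d0 n0 mu0 c10 lam0 M0 D0 u1' v1' ule vle).
Qed.

(** Outside the range of [main_case] the right side is at least 1: for [n < d] because [1 <= Q], and
    when the smallness condition fails because [mu / 2 < (6 + M) * Q], which the summand
    [2 * (6 + M) / mu] of the constant turns into 1. *)
Lemma main_bound (C : set 'cV[R]_d) : convex_comb_closed C ->
  measurable (Tw @^-1` C) -> measurable (Z @^-1` C) ->
  (`|P (Tw @^-1` C) - P' (Z @^-1` C)| <= (main_const mu c1 lamV M * Q)%:E)%E.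
Proof.
move=> cC mTC mZC.
have trivial : 1 <= main_const mu c1 lamV M * Q ->
    (`|P (Tw @^-1` C) - P' (Z @^-1` C)| <= (main_const mu c1 lamV M * Q)%:E)%E.
  move=> h1; apply: (@le_trans _ _ 1%:E); last by rewrite lee_fin.
  have p1 := probability_le1 P mTC; have p2 := probability_le1 P' mZC.
  have q1 := fine_ge0 (measure_ge0 P (Tw @^-1` C)).
  have q2 := fine_ge0 (measure_ge0 P' (Z @^-1` C)).
  move: p1 p2; rewrite -(fineK (fin_num_measure P _ mTC)).
  rewrite -(fineK (fin_num_measure P' _ mZC)) -EFinB !lee_fin => p1 p2.
  by rewrite ler_norml; apply/andP; split; lra.
have cge := main_const_ge mu0 c10 lam0 M0.
have z0 : 0 <= 2 * (6 + M) / mu by rewrite divr_ge0 ?(ltW mu0)// mulr_ge0// addr_ge0.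
have D1 : 1 <= D + 1 by rewrite lerDr.
have LL1 : 1 <= L ^+ 2 by rewrite exprn_ege1.
have Q0 : 0 <= Q.
  by rewrite /Q divr_ge0 ?(ltW rn0)// !mulr_ge0 ?exprn_ge0 ?(ltW rd0) ?(le_trans ler01).
have [dn|nd] := leqP d n; last first.
  apply: trivial; have Q1 : 1 <= Q.
    rewrite /Q ler_pdivlMr// mul1r.
    have rnd : rn <= rd by rewrite ler_wsqrtr// ler_nat ltnW.
    apply: le_trans rnd _; apply: le_trans (rdX (isT : (1 <= 6)%N)) _.
    by rewrite -mulrA ler_peMr ?mulr_ege1// exprn_ge0// ltW.
  by rewrite mulr_ege1//; apply: le_trans cge; rewrite lerDr.
have [sm|big] := leP (rd * (5 * d%:R * (D + 1) * L + 1 + M) / rn) (mu / 2).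
  exact: main_case.
apply: trivial; apply: (@le_trans _ _ (2 * (6 + M) / mu * Q)); last first.
  by apply: ler_wpM2r => //; apply: le_trans cge; rewrite lerDl.
have d1 : 1 <= d%:R :> R by rewrite ler1n.
have dDL : 1 <= d%:R * (D + 1) * L by rewrite !mulr_ege1.
have h1 : rd * (5 * d%:R * (D + 1) * L + 1 + M) <= (6 + M) * (rd ^+ 6 * (D + 1) * L ^+ 2).
  apply: (@le_trans _ _ (rd * ((6 + M) * (d%:R * (D + 1) * L)))).
    by rewrite ler_wpM2l ?(ltW rd0)//; have := ler_wpM2l M0 dDL; lra.
  rewrite mulrCA ler_wpM2l ?addr_ge0//.
  have -> : rd * (d%:R * (D + 1) * L) = rd ^+ 3 * (D + 1) * L.
    by rewrite -[X in _ * (X * _ * _) = _]rd2; ring.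
  apply: ler_pM.
  - by rewrite !mulr_ge0 ?exprn_ge0 ?(ltW rd0) ?(le_trans ler01).
  - exact: le_trans ler01 L1.
  - by apply: ler_wpM2r; [exact: le_trans ler01 D1|exact: rdX].
  - by rewrite ler_eXnr// L1.
have h2 : mu / 2 < (6 + M) * Q.
  apply: lt_le_trans big _; rewrite /Q mulrA ler_wpM2r// ltW// invr_gt0//.
have -> : 2 * (6 + M) / mu * Q = (6 + M) * Q * (2 / mu) by ring.
apply: le_trans (ler_wpM2r _ (ltW h2)); last by rewrite divr_ge0// ltW.
by rewrite mulrA divfK// divff// gt_eqF.
Qed.

End MainBound.

(** * Reduction of the theorem to the main bound *)

Section Transfer.
Context {R : realType}.

Lemma law_Rintegral {dT dU dS} {T : measurableType dT} {U : measurableType dU}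
    {S : measurableType dS} (P : probability T R) (Q : probability U R)
    (X : T -> S) (Y : U -> S) (f : S -> R) :
  measurable_fun setT X -> measurable_fun setT Y ->
  (forall B, measurable B -> P (X @^-1` B) = Q (Y @^-1` B)) ->
  measurable_fun setT f -> \int[P]_w f (X w) = \int[Q]_w f (Y w).
Proof.
move=> mX mY law mf; have mF : measurable_fun setT (EFin \o f) by exact/measurable_EFinP.
rewrite /Rintegral [X in fine X = _]integralE [X in _ = fine X]integralE.
congr (fine (_ - _)%E).
- have h := law_integral (g := (EFin \o f)^\+%E) mX mY law (measurable_funepos mF)
    (funepos_ge0 (EFin \o f)).
  by apply: etrans (etrans h _); apply: eq_integral => w _; rewrite !funeposE.
- have h := law_integral (g := (EFin \o f)^\-%E) mX mY law (measurable_funeneg mF)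
    (funeneg_ge0 (EFin \o f)).
  by apply: etrans (etrans h _); apply: eq_integral => w _; rewrite !funenegE.
Qed.

(** From x^3 <= 1 + x^p for x >= 0, as [3 <= p]. Dividing by [s] first, later 1 or sqrt d, makes the
    bound independent of the dimension. *)
Lemma cube_moment {dT} {T : measurableType dT} (P : probability T R)
    (f : T -> R) (p c s : R) : 3 <= p -> 0 < c -> 0 < s ->
  measurable_fun setT f -> (forall w, 0 <= f w) ->
  (Lnorm P p%:E (fun w => (f w)%:E) <= (c * s)%:E)%E ->
  P.-integrable setT (EFin \o (fun w => (f w / s) ^+ 3)) /\
  \int[P]_w ((f w / s) ^+ 3) <= 1 + c `^ p.
Proof.
move=> p3 c0 s0 mf f0 fp; have p0 : 0 < p by lra.
have cs0 : 0 <= c * s by rewrite mulr_ge0// ltW.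
have fs0 w : 0 <= f w / s by rewrite divr_ge0// ltW.
have int_p : (\int[P]_w ((f w) `^ p)%:E <= ((c * s) `^ p)%:E)%E.
  have := gt0_ler_poweR (ltW p0) _ _ fp.
  rewrite powR_Lnorm ?gt_eqF// poweR_EFin.
  under eq_integral do rewrite abse_EFin ger0_norm// poweR_EFin.
  by apply; rewrite !in_itv/= ?leey ?andbT ?Lnorm_ge0// lee_fin.
have sp0 : 0 < s `^ p by exact: powR_gt0.
have mfp : measurable_fun setT (fun w => (f w) `^ p).
  exact: (measurableT_comp (measurable_powR p) mf).
have m3 : measurable_fun setT (fun w => (f w / s) ^+ 3).
  by apply: (measurableT_comp (exprn_measurable 3)); exact: measurable_funM.
have le3 (x : R) : 0 <= x -> x ^+ 3 <= 1 + x `^ p.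
  move=> x0; have [x1|x1] := leP x 1.
    by apply: (le_trans (exprn_ile1 3 x0 x1)); rewrite lerDl powR_ge0.
  by rewrite -powR_mulrn// (le_trans (ler_powR (ltW x1) p3))// lerDr.
have fsp w : (f w / s) `^ p = (s `^ p)^-1 * (f w) `^ p.
  by rewrite powRM ?invr_ge0 ?(ltW s0)// -powRN -mulrC -(powR_inv1 (ltW s0)) -powRrM mulN1r.
have sV0 : 0 <= (s `^ p)^-1 by rewrite invr_ge0 ltW.
have key : (\int[P]_w ((f w / s) ^+ 3)%:E <= (1 + c `^ p)%:E)%E.
  apply: (@le_trans _ _ (\int[P]_w (1%:E + (s `^ p)^-1%:E * ((f w) `^ p)%:E))%E).
    apply: ge0_le_integral => //.
    - by move=> w _; rewrite lee_fin exprn_ge0.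
    - exact/measurable_EFinP.
    - apply: emeasurable_funD => //; apply: measurable_funeM; exact/measurable_EFinP.
    - by move=> w _; rewrite -EFinM -EFinD lee_fin -fsp; exact: le3.
  rewrite ge0_integralD//=; last 2 first.
  - by move=> w _; rewrite -EFinM lee_fin mulr_ge0// powR_ge0.
  - by apply: measurable_funeM; exact/measurable_EFinP.
  rewrite integral_cst//= probability_setT mule1 EFinD leeD2l//.
  rewrite ge0_integralZl//; last 2 first.
  - exact/measurable_EFinP.
  - by move=> w _; rewrite lee_fin powR_ge0.
  apply: (le_trans (lee_wpmul2l _ int_p)); first by rewrite lee_fin.
  rewrite -EFinM lee_fin powRM ?(ltW c0) ?(ltW s0)// mulrCA mulVf ?mulr1//.
  by rewrite gt_eqF.
have i3 : P.-integrable setT (EFin \o (fun w => (f w / s) ^+ 3)).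
  apply: ge0_integrable => //; first by move=> w; exact: exprn_ge0.
  exact: le_lt_trans key (ltry _).
by split=> //; rewrite -lee_fin -Rintegral_EFin.
Qed.

End Transfer.

(** The sixth power of sqrt d is d^3 <= d^(7/2), [D + 1] is at most its square, and the squared
    logarithm goes into n^eps. *)
Lemma rate_le {R : realType} (d n : nat) (D eps : R) :
  (0 < d)%N -> (0 < n)%N -> 0 <= D -> 0 < eps ->
  Num.sqrt d%:R ^+ 6 * (D + 1) * (1 + ln n%:R) ^+ 2 / Num.sqrt n%:R <=
  (2 + 4 / eps ^+ 2) * (D + 1) ^+ 2 * (d%:R `^ (7 / 2) * n%:R `^ (- (1 / 2) + eps)) :> R.
Proof.
move=> d0 n0 D0 e0; have nn0 : 0 < n%:R :> R by rewrite ltr0n.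
have d1 : 1 <= d%:R :> R by rewrite ler1n.
have D1 : 1 <= D + 1 by rewrite lerDr.
have -> : n%:R `^ (- (1 / 2) + eps) = (Num.sqrt n%:R)^-1 * n%:R `^ eps :> R.
  rewrite powRD; last by apply/implyP => _; rewrite gt_eqF.
  by rewrite mul1r powRN powR12_sqrt// ltW.
have d3 : Num.sqrt d%:R ^+ 6 <= d%:R `^ (7 / 2) :> R.
  rewrite (exprM _ 2 3) sqr_sqrtr ?ler0n// -powR_mulrn ?ler0n//.
  by apply: ler_powR => //; lra.
have hL := log_sqr_le e0 n0.
set l := 1 + ln _ in hL *; set k := 2 + _ in hL *; set q := n%:R `^ eps in hL *.
set rn := Num.sqrt n%:R; set x := d%:R `^ _ in d3 *.
have rV : 0 <= rn^-1 by rewrite invr_ge0 sqrtr_ge0.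
have x0 : 0 <= x by exact: powR_ge0.
have -> : k * (D + 1) ^+ 2 * (x * (rn^-1 * q)) = x * (D + 1) ^+ 2 * (k * q) / rn by ring.
apply: ler_wpM2r => //; apply: ler_pM => //.
- by rewrite mulr_ge0 ?exprn_ge0 ?sqrtr_ge0 ?(le_trans ler01).
- exact: sqr_ge0.
- apply: ler_pM; rewrite ?exprn_ge0 ?sqrtr_ge0 ?(le_trans ler01)//.
  by rewrite ler_eXnr.
Qed.

Theorem theorem3p2 (R : realType) (p mu c1 c2 c3 lambda1 lambda2 : R)
    (p_ge3 : 3 <= p) (mu_gt0 : 0 < mu)
    (c1_gt0 : 0 < c1) (c2_gt0 : 0 < c2) (c3_gt0 : 0 < c3)
    (lambda1_gt0 : 0 < lambda1) (lambda2_gt0 : 0 < lambda2) :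
  exists2 C : R, 0 < C &
  forall (d n : nat) (d_gt0 : (0 < d)%N) (n_gt0 : (0 < n)%N)
    (dO : measure_display) (Omega : measurableType dO)
    (P : probability Omega R)
    (dX : measure_display) (calX : measurableType dX)
    (X : {RV P >-> calX}) (Xs : 'I_n -> {RV P >-> calX})
    (Theta : set 'cV[R]_d) (h : 'cV[R]_d -> calX -> 'cV[R]_d)
    (theta_star : 'cV[R]_d) (theta_hat : Omega -> 'cV[R]_d)
    (dPsi0 Sigma : 'M[R]_d) (h0 : calX -> R)
    (dO' : measure_display) (Omega' : measurableType dO')
    (P' : probability Omega' R) (Z : Omega' -> 'cV[R]_d),
  let Psi_n theta w : 'cV[R]_d := n%:R^-1 *: \sum_(i < n) h theta (Xs i w) in
  let Psi theta := expectation_mx P (fun w => h theta (X w)) in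
  let xi (i : 'I_n) w := h theta_star (Xs i w) in
  iid P (fun (o : option 'I_n) w => if o is Some i then Xs i w else X w) ->
  (forall theta j, Theta theta ->
     measurable_fun [set: calX] (fun x => h theta x j 0)) ->
  random_vector theta_hat ->
  {ae P, forall w, Theta (theta_hat w) /\ Psi_n (theta_hat w) w = 0} ->
  Theta theta_star -> Psi theta_star = 0 ->
  (forall theta1 theta2, Theta theta1 -> Theta theta2 ->
     mu * enorm (theta1 - theta2) ^+ 2
       <= dotv (Psi theta1 - Psi theta2) (theta1 - theta2)) ->
  posdefmx dPsi0 ->
  (forall theta, Theta theta ->
     enorm (Psi theta - Psi theta_star - dPsi0 *m (theta - theta_star))
       <= c1 * enorm (theta - theta_star) ^+ 2) ->
  lambda1 <= lambda_min dPsi0 ->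
  (forall x, 0 <= h0 x) -> measurable_fun [set: calX] h0 ->
  {ae distribution P X, forall x, forall theta theta' j,
     Theta theta -> Theta theta' ->
     `|h theta x j 0 - h theta' x j 0| <= h0 x * enorm (theta - theta')} ->
  (Lnorm P p%:E (fun w => (h0 (X w))%:E) <= c2%:E)%E ->
  (forall i, Sigma = expectation_mx P (fun w => xi i w *m (xi i w)^T)) ->
  lambda2 <= lambda_min Sigma ->
  (vec_Lnorm P p (xi (Ordinal n_gt0)) <= (c3 * d%:R `^ (1 / 2))%:E)%E ->
  std_gaussian P' Z ->
  let eps_p := 1 / (2 * p - 2) in
  (convex_distance P P'
     (fun w => Num.sqrt n%:R *:
        (invsqrtmx Sigma *m dPsi0 *m (theta_hat w - theta_star))) Z
   <= C%:E * (diameter Theta + 1) ^+ 2 *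
      (d%:R `^ (7 / 2) * n%:R `^ (- (1 / 2) + eps_p))%:E)%E.
Proof.
(* [lamV] bounds the operator norm of [invsqrtmx Sigma]; [M] bounds the third moment of the envelope
   [b] below, a sum of two functions with third moments at most 1 + c2^p and 1 + c3^p. *)
pose lamV := (Num.sqrt lambda2)^-1; pose M := 4 * (2 + c2 `^ p + c3 `^ p).
pose eps := 1 / (2 * p - 2).
have lam0 : 0 < lamV by rewrite invr_gt0 sqrtr_gt0.
have M0 : 0 <= M.
  by rewrite /M mulr_ge0// addr_ge0 ?powR_ge0// addr_ge0 ?powR_ge0.
have eps0 : 0 < eps by rewrite divr_gt0//; lra.
pose K := main_const mu c1 lamV M.
have K0 : 0 < K.
  apply: lt_le_trans (main_const_ge mu_gt0 c1_gt0 lam0 M0).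
  by rewrite ltr_wpDl// divr_ge0 ?(ltW mu_gt0)// mulr_ge0// addr_ge0.
have e20 : 0 < 2 + 4 / eps ^+ 2 by rewrite addr_gt0// divr_gt0// exprn_gt0.
exists (K * (2 + 4 / eps ^+ 2)); first exact: mulr_gt0.
move=> d n d0 n0 dO Omega P dX calX X Xs Theta h ts th dPsi0 Sigma h0 dO' Omega' P' Z.
move=> Psi_n Psi xi [ind_o law_o] mh mth th_ae Tts Psi_ts mono _ lin _ h0_ge0 mh0
  lip_ae h0_p SigmaE lamS xi_p gZ; cbv zeta; rewrite -/eps.
have dn0 : 0 < d%:R `^ (7 / 2) * n%:R `^ (- (1 / 2) + eps) :> R.
  by rewrite mulr_gt0// powR_gt0// ltr0n.
have diam0 : (0 <= diameter Theta)%E.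
  apply: ereal_sup_ubound; exists (ts, ts) => //.
  by rewrite /= subrr enorm0.
have Kpos : 0 < K * (2 + 4 / eps ^+ 2) by exact: mulr_gt0.
(* For an unbounded [Theta] the right side is +oo. *)
have [[D D0 DE]|Dy] : (exists2 D : R, 0 <= D & diameter Theta = D%:E) \/
    diameter Theta = +oo%E.
  by case: (diameter Theta) diam0 => [D D0|_|//]; [left; exists D|right].
2: {
  rewrite Dy addye// expe2 mulyy.
  rewrite gt0_muley ?lte_fin// gt0_mulye ?lte_fin//; exact: leey.
}
have diamT t t' : Theta t -> Theta t' -> enorm (t - t') <= D.
  move=> Tt Tt'; rewrite -lee_fin -DE; apply: ereal_sup_ubound.
  by exists (t, t').
apply: ge_ereal_sup => _ [A [/convex_setE cA mA mA'] <-].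
rewrite DE -EFinD -EFin_expe -!EFinM.
apply: (@le_trans _ _ (K * (Num.sqrt d%:R ^+ 6 * (D + 1) * (1 + ln n%:R) ^+ 2 /
    Num.sqrt n%:R))%:E); last first.
  by rewrite lee_fin -!mulrA ler_pM2l//; have := rate_le d0 n0 D0 eps0; rewrite -!mulrA.
clear diam0 DE dn0.
have mX : measurable_fun setT X by exact: measurable_funPT.
have mXs i : measurable_fun setT (Xs i) by exact: measurable_funPT.
have law_Xs i B : measurable B -> P (Xs i @^-1` B) = P (X @^-1` B).
  exact: (law_o (Some i) None B).
have ind_Xs : mutually_independent P (fun i => Xs i : Omega -> calX).
  move=> B mB.
  have := ind_o (fun o => if o is Some i then B i else setT).
  have mB' : forall o, measurable (if o is Some i then B i else setT) by case.
  move=> /(_ mB') e; transitivity (P (\bigcap_(o in [set: option 'I_n])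
      ((fun w => if o is Some i then Xs i w else X w) @^-1`
       (if o is Some i then B i else setT)))).
    congr (P _); apply/seteqP; split => w hw o _; last exact: (hw (Some o)).
    by case: o => [i|]; [exact: hw|].
  rewrite e (bigD1 None)//= preimage_setT probability_setT mul1e.
  rewrite (reindex_omap Some id)/=; last by case.
  by apply: eq_bigl => i; rewrite eqxx.
have [N0 [mN0 PN0 lipN0]] := lip_ae.
(* The Lipschitz condition holds outside the null set [N0]. Setting the functions to 0 there makes
   it hold everywhere and changes neither expectations nor, almost surely, the estimating
   equation. *)
pose g t x : 'cV[R]_d := \1_(~` N0) x *: h t x.
have gE t x : ~ N0 x -> g t x = h t x.
  by move=> nx; rewrite /g indicE mem_set// scale1r.
have g0 t x : N0 x -> g t x = 0.
  by move=> nx; rewrite /g indicE memNset ?scale0r//= => /(_ nx).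
have mg t j : Theta t -> measurable_fun setT (fun x => g t x j 0).
  move=> Tt; under eq_fun do rewrite mxE.
  by apply: measurable_funM; [apply: measurable_indic; exact: measurableC|exact: mh].
have g_lip0 x t t' j : Theta t -> Theta t' ->
    `|g t x j 0 - g t' x j 0| <= h0 x * enorm (t - t').
  move=> Tt Tt'; have [nx|nx] := pselect (N0 x).
    by rewrite !g0// subrr normr0 mulr_ge0// enorm_ge0.
  rewrite !gE//; have : ~ ~ (forall theta theta' j, Theta theta -> Theta theta' ->
      `|h theta x j 0 - h theta' x j 0| <= h0 x * enorm (theta - theta')).
    by move=> nl; apply: nx; exact: lipN0.
  by move=> /contrapT; apply.
have ae_int (f f' : calX -> R) : measurable_fun setT f -> measurable_fun setT f' ->
    (forall x, ~ N0 x -> f x = f' x) -> \int[P]_w f (X w) = \int[P]_w f' (X w).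
  move=> mf mf' ff; congr fine; apply: ae_eq_integral => //.
  - by apply/measurable_EFinP; exact: measurableT_comp.
  - by apply/measurable_EFinP; exact: measurableT_comp.
  exists (X @^-1` N0); split=> //; first by rewrite -[_ @^-1` _]setTI; exact: mX.
  move=> w /= nw; apply: contrapT => nx; apply: nw => _; congr EFin; exact: ff.
have rd0 : 0 < Num.sqrt d%:R :> R by exact: rd_gt0.
have mgts : random_vector (g ts) by move=> j; exact: mg.
have mhts : random_vector (h ts) by move=> j; exact: mh.
have PsiE t j : Theta t -> Psi t j 0 = \int[P]_w (g t (X w) j 0).
  move=> Tt; rewrite /Psi mxE unlock.
  by apply: (ae_int (fun x => h t x j 0) (fun x => g t x j 0));
    [exact: mh|exact: mg|move=> x nx; rewrite gE].
(* A single envelope for the increments and, up to the factor sqrt d, for the score at [ts]. *)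
pose b x := h0 x + enorm (g ts x) / Num.sqrt d%:R.
have bt0 x : 0 <= enorm (g ts x) / Num.sqrt d%:R by rewrite divr_ge0 ?enorm_ge0// ltW.
have mbt (f : calX -> 'cV[R]_d) : random_vector f ->
    measurable_fun setT (fun x => enorm (f x) / Num.sqrt d%:R).
  by move=> mf; apply: measurable_funM => //; exact: measurable_enorm.
have mb : measurable_fun setT b by apply: measurable_funD => //; exact: mbt.
have b0 x : 0 <= b x by rewrite addr_ge0.
have m3 (f : calX -> R) : measurable_fun setT f -> measurable_fun setT (fun x => f x ^+ 3).
  by move=> mf; exact: (measurableT_comp (exprn_measurable 3) mf).
have [ih3 h3] : P.-integrable setT (EFin \o (fun w => h0 (X w) ^+ 3)) /\
    \int[P]_w (h0 (X w) ^+ 3) <= 1 + c2 `^ p.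
  have := @cube_moment R _ _ P (fun w => h0 (X w)) p c2 1 p_ge3 c2_gt0 ltr01.
  rewrite mulr1; under eq_Rintegral do rewrite divr1.
  rewrite (_ : (fun w => (h0 (X w) / 1) ^+ 3) = (fun w => h0 (X w) ^+ 3)); last first.
    by apply/funext => w; rewrite divr1.
  by apply=> //; exact: measurableT_comp.
pose i0 := Ordinal n0.
have [ix3 x3] : P.-integrable setT (EFin \o (fun w => (enorm (g ts (X w)) / Num.sqrt d%:R) ^+ 3)) /\
    \int[P]_w ((enorm (g ts (X w)) / Num.sqrt d%:R) ^+ 3) <= 1 + c3 `^ p.
  have mxi : measurable_fun setT (fun w => enorm (xi i0 w)).
    by apply: measurable_enorm; exact: (random_vector_comp (mXs i0) mhts).
  have := @cube_moment R _ _ P (fun w => enorm (xi i0 w)) p c3 _ p_ge3 c3_gt0 rd0 mxi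
    (fun w => enorm_ge0 _).
  have -> : Num.sqrt d%:R = d%:R `^ (1 / 2) :> R by rewrite mul1r powR12_sqrt// ler0n.
  move=> /(_ xi_p); rewrite mul1r powR12_sqrt ?ler0n// => -[i3 b3].
  pose F x := (enorm (h ts x) / Num.sqrt d%:R) ^+ 3.
  have mF : measurable_fun setT F by apply: m3; exact: mbt.
  have F0 x : 0 <= F x by rewrite exprn_ge0// divr_ge0 ?enorm_ge0// ltW.
  have FE : \int[P]_w F (X w) = \int[P]_w F (Xs i0 w).
    by apply: law_Rintegral => // B mB; exact/esym/law_Xs.
  have FEE : (\int[P]_w (F (X w))%:E = (\int[P]_w F (Xs i0 w))%:E)%E.
    rewrite -(Rintegral_EFin i3).
    apply: (law_integral (g := EFin \o F)) => //; last exact/measurable_EFinP.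
    by move=> B mB; exact/esym/law_Xs.
  have iF : P.-integrable setT (EFin \o (fun w => F (X w))).
    by apply: ge0_integrable => //; [exact: measurableT_comp|rewrite FEE ltry].
  have gF x : (enorm (g ts x) / Num.sqrt d%:R) ^+ 3 <= F x.
    rewrite lerXn2r ?nnegrE//; first by rewrite divr_ge0 ?enorm_ge0// ltW.
    rewrite ler_wpM2r ?invr_ge0 ?(ltW rd0)//.
    have [nx|nx] := pselect (N0 x); last by rewrite gE.
    by rewrite g0// enorm0 enorm_ge0.
  have mgX : measurable_fun setT (fun w => (enorm (g ts (X w)) / Num.sqrt d%:R) ^+ 3).
    by apply: (measurableT_comp (m3 _ (mbt _ mgts)) mX).
  have ig : P.-integrable setT (EFin \o (fun w => (enorm (g ts (X w)) / Num.sqrt d%:R) ^+ 3)).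
    apply: (integrable_dom mgX _ iF) => w; rewrite ger0_norm ?exprn_ge0//; exact: gF.
  split=> //; apply: le_trans b3; rewrite -FE; apply: le_Rintegral => // w _; exact: gF.
have cube x : b x ^+ 3 <= 4 * (h0 x ^+ 3 + (enorm (g ts x) / Num.sqrt d%:R) ^+ 3).
  have := bt0 x; have := h0_ge0 x; rewrite /b; move: (h0 x) (enorm _ / _) => y z y0 z0.
  (* 4 (y^3 + z^3) - (y + z)^3 = 3 (y + z) (y - z)^2. *)
  have : 0 <= (y + z) * (y - z) ^+ 2 by rewrite mulr_ge0 ?sqr_ge0// addr_ge0.
  lra.
have i4 : P.-integrable setT (EFin \o
    (fun w => 4 * (h0 (X w) ^+ 3 + (enorm (g ts (X w)) / Num.sqrt d%:R) ^+ 3))).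
  by apply: integrableZr; exact: integrableDr.
have ib : P.-integrable setT (EFin \o (fun w => b (X w) ^+ 3)).
  apply: (integrable_dom _ _ i4); first exact: (measurableT_comp (m3 _ mb) mX).
  by move=> w; rewrite ger0_norm ?exprn_ge0//; exact: cube.
have bM : \int[P]_w (b (X w) ^+ 3) <= M.
  apply: (@le_trans _ _ (\int[P]_w
      (4 * (h0 (X w) ^+ 3 + (enorm (g ts (X w)) / Num.sqrt d%:R) ^+ 3)))).
    by apply: le_Rintegral => // w _; exact: cube.
  rewrite RintegralZl//; last exact: integrableDr.
  by rewrite RintegralD// /M; lra.
have g_ts x : enorm (g ts x) <= Num.sqrt d%:R * b x.
  rewrite /b mulrDr (mulrC _ (_ / _)) divfK ?gt_eqF// lerDr mulr_ge0//; exact: ltW.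
have g_lip x t t' j : Theta t -> Theta t' ->
    `|g t x j 0 - g t' x j 0| <= b x * enorm (t - t').
  move=> Tt Tt'; apply: le_trans (g_lip0 x t t' j Tt Tt') _.
  by rewrite ler_wpM2r ?enorm_ge0// lerDl.
pose S' := \matrix_(j, k) \int[P]_w (g ts (X w) j 0 * g ts (X w) k 0) : 'M[R]_d.
have SE : Sigma = S'.
  rewrite (SigmaE i0); apply/matrixP => j k; rewrite !mxE unlock.
  have mhh : measurable_fun setT (fun x => h ts x j 0 * h ts x k 0).
    by apply: measurable_funM; exact: mhts.
  transitivity (\int[P]_w (h ts (Xs i0 w) j 0 * h ts (Xs i0 w) k 0)).
    rewrite /Rintegral; congr fine; apply: eq_integral => w _; congr EFin.
    by rewrite mxE big_ord1 !mxE.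
  transitivity (\int[P]_w (h ts (X w) j 0 * h ts (X w) k 0)).
    apply: (law_Rintegral (f := fun x => h ts x j 0 * h ts x k 0)) => //.
    by move=> B mB; exact: law_Xs.
  apply: (ae_int (fun x => h ts x j 0 * h ts x k 0) (fun x => g ts x j 0 * g ts x k 0)) => //.
    by apply: measurable_funM; exact: mgts.
  by move=> x nx; rewrite gE.
have symS : Sigma^T = Sigma.
  rewrite SE; apply/matrixP => j k; rewrite !mxE; apply: eq_Rintegral => w _.
  exact: mulrC.
have [ib1 ib2] := integrable_envelope mX mb b0 ib.
have igg j k : P.-integrable setT (EFin \o (fun w => g ts (X w) j 0 * g ts (X w) k 0)).
  apply: (integrable_dom (g := fun w => Num.sqrt d%:R ^+ 2 * b (X w) ^+ 2)).
  - by apply: measurable_funM; [exact: (measurableT_comp (mgts j) mX)|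
      exact: (measurableT_comp (mgts k) mX)].
  - move=> w; rewrite normrM -exprMn expr2; apply: ler_pM => //;
      exact: le_trans (coord_le_enorm _ _) (g_ts _).
  - exact: integrableZr.
have psdS v : 0 <= dotv v (Sigma *m v).
  have iv j k : P.-integrable setT (EFin \o (fun w =>
      v j 0 * v k 0 * (g ts (X w) j 0 * g ts (X w) k 0))) by exact: integrableZr.
  rewrite (_ : dotv _ _ = \int[P]_w (\sum_j \sum_k
      v j 0 * v k 0 * (g ts (X w) j 0 * g ts (X w) k 0))).
    apply: Rintegral_ge0 => w _; rewrite (_ : \sum_j _ = dotv v (g ts (X w)) ^+ 2) ?sqr_ge0//.
    rewrite expr2 {1}/dotv mulr_suml; apply: eq_bigr => j _.
    by rewrite /dotv mulr_sumr; apply: eq_bigr => k _; ring.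
  rewrite Rintegral_sum; last by move=> j; exact: integrable_sumr.
  apply: eq_bigr => j _; rewrite Rintegral_sum// mxE mulr_sumr; apply: eq_bigr => k _.
  by rewrite RintegralZl// SE mxE; ring.
have [sB cov B_le] := invsqrtmxP symS psdS lambda2_gt0 lamS.
rewrite [X in _ *m X *m _]SE in cov.
have E_ts j : \int[P]_w (g ts (X w) j 0) = 0 by rewrite -PsiE// Psi_ts mxE.
have psiE t : Theta t -> (\col_j \int[P]_w (g t (X w) j 0)) = Psi t.
  by move=> Tt; apply/matrixP => j k; rewrite ord1 PsiE// mxE.
have [N1 [mN1 PN1 hN1]] := th_ae.
(* Off this null event no observation falls into [N0], so that a root of the equation for [h] is one
   for [g]. *)
pose N2 := \big[setU/set0]_(i <- enum 'I_n) (Xs i @^-1` N0).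
have mN2' i : measurable (Xs i @^-1` N0).
  by rewrite -[_ @^-1` _]setTI; exact: mXs.
have mN2 : measurable N2 by apply: bigsetU_measurable.
have PXs i : (P (Xs i @^-1` N0) <= 0)%E.
  by have -> : P (Xs i @^-1` N0) = 0%E := etrans (law_Xs i N0 mN0) PN0.
have PN2 : P N2 = 0%E.
  apply/eqP; rewrite eq_le measure_ge0 andbT.
  rewrite /N2; elim: (enum 'I_n) => [|i s ih]; first by rewrite big_nil measure0.
  rewrite big_cons; apply: le_trans (measureU2 _ _ _) _ => //.
    exact: bigsetU_measurable.
  by rewrite -[leRHS]adde0; apply: leeD; [exact: PXs|exact: ih].
have mN : measurable (N1 `|` N2) by exact: measurableU.
have PN : P (N1 `|` N2) = 0%E.
  apply/eqP; rewrite eq_le measure_ge0 andbT.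
  have PN1' : (P N1 <= 0)%E by have -> : P N1 = 0%E := PN1.
  have PN2' : (P N2 <= 0)%E by rewrite PN2.
  apply: le_trans (measureU2 _ _ _) _ => //.
  by rewrite -[leRHS]adde0; apply: leeD; [exact: PN1'|exact: PN2'].
have thN w : ~ (N1 `|` N2) w -> Theta (th w) /\ \sum_i g (th w) (Xs i w) = 0.
  move=> nN; have [Tth root] : Theta (th w) /\ Psi_n (th w) w = 0.
    by apply: contrapT => nh; apply: nN; left; exact: hN1.
  split=> //; have nX i : ~ N0 (Xs i w).
    move=> hi; apply: nN; right; rewrite /N2 -bigcup_seq; exists i => //=.
    exact: mem_enum.
  under eq_bigr do rewrite gE//.
  move: root; rewrite /Psi_n => /eqP; rewrite scaler_eq0 invr_eq0 pnatr_eq0.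
  by rewrite -leqn0 leqNgt n0 => /eqP.
apply: (main_bound d0 n0 mu_gt0 c1_gt0 lam0 M0 D0 gZ mX mXs ind_Xs law_Xs mb b0 ib bM
  Tts diamT mg g_lip g_ts E_ts sB cov B_le _ _ mth mN PN thN cA mA mA').
- by move=> t Tt; rewrite psiE//; have := mono _ _ Tt Tts; rewrite Psi_ts subr0.
- by move=> t Tt; rewrite psiE//; have := lin _ Tt; rewrite Psi_ts subr0.
Qed.
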